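(* Let $\mathbb{C}$ be a tensor-generated compact closed category with finite biproducts, with $0_{I,I}\neq 1_I$. Then the double-glued category $\mathbf{G}\mathbb{C}$ satisfies $\mathrm{MLL}^-$ full completeness.
   Context: A compact closed category with finite biproducts is tensor-generated if its tensor unit $I$ is a separator: whenever $f\ne g:A\to B$ there is $h:I\to A$ with $f\circ h\neq g\circ h$. Logic. $\mathrm{MLL}^-$ is unit-free multiplicative linear logic: formulae are built from literals $\alpha_i,\alpha_i^\bot$ with $\otimes$ and par, written $\wp$; sequents are right-sided, commas read as $\wp$. A proof structure over a sequent is its parse forest together with a set of axiom links perfectly matching each positive literal occurrence with a negative occurrence of the same literal. A switching is the subgraph obtained by deleting, at each $\wp$-vertex, exactly one of its two argument edges. A cut-free $\mathrm{MLL}^-$ proof net is a proof structure all of whose switchings are acyclic and connected. Categories. In a $*$-autonomous category $\mathbb{D}$ with unit $I$, put $\bot=I^\bot$ and $A\wp B=(A^\bot\otimes B^\bot)^\bot$. A sequent over literals $\alpha_1,\dots,\alpha_N$ gives an $\mathrm{MLL}^-$ functor $F:\mathbb{D}^N\times(\mathbb{D}^{op})^N\to\mathbb{D}$ (first arguments for positive occurrences, duals of the second arguments for negative occurrences). An $\mathrm{MLL}^-$ transformation is a dinatural transformation from the constant functor at $I$ to an $\mathrm{MLL}^-$ functor $F$: a family $\tau_{\mathbf R}:I\to F(\mathbf R,\mathbf R)$, $\mathbf R\in\mathbb{D}^N$, with $F(\mathbf f,1_{\mathbf R})\circ\tau_{\mathbf R}=F(1_{\mathbf S},\mathbf f)\circ\tau_{\mathbf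 S}$ for all $\mathbf f:\mathbf R\to\mathbf S$. Proof nets are interpreted as $\mathrm{MLL}^-$ transformations in the standard way. $\mathbb{D}$ satisfies $\mathrm{MLL}^-$ full completeness if every $\mathrm{MLL}^-$ transformation in $\mathbb{D}$ is the interpretation of a cut-free proof net. Double glueing. $\mathbf{G}\mathbb{C}$ has objects $(A,U,X)$ with $A\in\mathbb{C}$, $U\subseteq\mathbb{C}[I,A]$, $X\subseteq\mathbb{C}[A,\bot]$; an arrow $(A,U,X)\to(B,V,Y)$ is an $f\in\mathbb{C}[A,B]$ with $f\circ U\subseteq V$ and $Y\circ f\subseteq X$. It is $*$-autonomous, with structure on arrows inherited from $\mathbb{C}$ and, on objects, $(A,U,X)^\bot=(A^\bot,\{x^\bot\circ\chi_I: x\in X\},\{u^\bot:u\in U\})$ where $\chi_I:I\to\bot^\bot$ is canonical; $(A,U,X)\otimes(B,V,Y)=(A\otimes B,\{(u\otimes v)\circ\lambda_I^{-1}\},Z)$, where $\lambda_I:I\otimes I\to I$ and $Z$ is the set of $z:A\otimes B\to\bot$ with $z\circ(1_A\otimes v)\circ\rho_A^{-1}\in X$ for all $v\in V$ and $z\circ(u\otimes1_B)\circ\lambda_B^{-1}\in Y$ for all $u\in U$; and unit $(I,\{1_I\},\mathbb{C}[I,\bot])$. *)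

(* Defs.v *)
From mathcomp Require Import all_boot.
From Stdlib Require Import ProofIrrelevance.

Set Implicit Arguments.
Unset Strict Implicit.
Unset Printing Implicit Defensive.

Declare Scope cat_scope.
Delimit Scope cat_scope with cat.
Local Open Scope cat_scope.

Record category := Category {
  obj :> Type;
  hom : obj -> obj -> Type;
  idc : forall A, hom A A;
  comp : forall A B C, hom B C -> hom A B -> hom A C;
  comp1f : forall A B (f : hom A B), comp (idc B) f = f;
  compf1 : forall A B (f : hom A B), comp f (idc A) = f;
  compA : forall A B C D (h : hom C D) (g : hom B C) (f : hom A B),
    comp (comp h g) f = comp h (comp g f) }.

Arguments hom {c} A B.
Arguments idc {c} A.
Arguments comp {c A B C} g f.
Notation "g ∘ f" := (comp g f) (at level 40, left associativity) : cat_scope.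

Record smcat := SMCat {
  sm_cat :> category;
  tunit : sm_cat;
  tens : sm_cat -> sm_cat -> sm_cat;
  tensm : forall (A B A' B' : sm_cat),
    hom A A' -> hom B B' -> hom (tens A B) (tens A' B');
  tensm1 : forall A B, tensm (idc A) (idc B) = idc (tens A B);
  tensmD : forall A A' A'' B B' B'' (g : hom A' A'') (f : hom A A')
      (k : hom B' B'') (h : hom B B'),
    tensm (g ∘ f) (k ∘ h) = tensm g k ∘ tensm f h;
  assoc : forall A B C, hom (tens (tens A B) C) (tens A (tens B C));
  associ : forall A B C, hom (tens A (tens B C)) (tens (tens A B) C);
  assocK : forall A B C, associ A B C ∘ assoc A B C = idc _;
  associK : forall A B C, assoc A B C ∘ associ A B C = idc _;
  assoc_nat : forall A A' B B' C C'
      (f : hom A A') (g : hom B B') (h : hom C C'),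
    assoc A' B' C' ∘ tensm (tensm f g) h
    = tensm f (tensm g h) ∘ assoc A B C;
  lun : forall A, hom (tens tunit A) A;
  luni : forall A, hom A (tens tunit A);
  lunK : forall A, luni A ∘ lun A = idc _;
  luniK : forall A, lun A ∘ luni A = idc _;
  lun_nat : forall A B (f : hom A B),
    lun B ∘ tensm (idc tunit) f = f ∘ lun A;
  run : forall A, hom (tens A tunit) A;
  runi : forall A, hom A (tens A tunit);
  runK : forall A, runi A ∘ run A = idc _;
  runiK : forall A, run A ∘ runi A = idc _;
  run_nat : forall A B (f : hom A B),
    run B ∘ tensm f (idc tunit) = f ∘ run A;
  braid : forall A B, hom (tens A B) (tens B A);
  braidK : forall A B, braid B A ∘ braid A B = idc _;
  braid_nat : forall A A' B B' (f : hom A A') (g : hom B B'),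
    braid A' B' ∘ tensm f g = tensm g f ∘ braid A B;
  triangle : forall A B,
    tensm (idc A) (lun B) ∘ assoc A tunit B = tensm (run A) (idc B);
  pentagon : forall A B C D,
    assoc A B (tens C D) ∘ assoc (tens A B) C D
    = tensm (idc A) (assoc B C D)
      ∘ (assoc A (tens B C) D ∘ tensm (assoc A B C) (idc D));
  hexagon : forall A B C,
    assoc B C A ∘ (braid A (tens B C) ∘ assoc A B C)
    = tensm (idc B) (braid A C)
      ∘ (assoc B A C ∘ tensm (braid A B) (idc C)) }.

Arguments tunit {s}.
Arguments tens {s} A B.
Arguments tensm {s A B A' B'} f g.
Arguments assoc {s} A B C.
Arguments associ {s} A B C.
Arguments lun {s} A.
Arguments luni {s} A.
Arguments run {s} A.
Arguments runi {s} A.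
Arguments braid {s} A B.
Notation "A ⊗ B" := (tens A B) (at level 35, right associativity) : cat_scope.
Notation "f ⊗m g" := (tensm f g) (at level 35, right associativity) : cat_scope.

Section Coherence.
Variable S : smcat.
Implicit Types A B C D : S.

Lemma pre A B C D (g : hom B C) (f : hom A B) (k : hom A C) (x : hom D A) :
  g ∘ f = k -> g ∘ (f ∘ x) = k ∘ x.
Proof. by move=> <-; rewrite compA. Qed.

Lemma tens1D A B C D (g : hom C D) (f : hom B C) :
  idc A ⊗m (g ∘ f) = (idc A ⊗m g) ∘ (idc A ⊗m f).
Proof. by rewrite -tensmD comp1f. Qed.

Lemma tensD1 A B C D (g : hom C D) (f : hom B C) :
  (g ∘ f) ⊗m idc A = (g ⊗m idc A) ∘ (f ⊗m idc A).
Proof. by rewrite -tensmD comp1f. Qed.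

Lemma tens_lr A B C D (f : hom A B) (g : hom C D) :
  (f ⊗m idc D) ∘ (idc A ⊗m g) = f ⊗m g.
Proof. by rewrite -tensmD comp1f compf1. Qed.

Lemma tens_rl A B C D (f : hom A B) (g : hom C D) :
  (idc B ⊗m g) ∘ (f ⊗m idc C) = f ⊗m g.
Proof. by rewrite -tensmD comp1f compf1. Qed.

Lemma split_epi A B C (r : hom A B) (s : hom B A) (f g : hom B C) :
  r ∘ s = idc _ -> f ∘ r = g ∘ r -> f = g.
Proof.
by move=> rs e; rewrite -[f]compf1 -[g]compf1 -rs -!compA e.
Qed.

Lemma split_mono A B C (r : hom A B) (s : hom B A) (f g : hom C A) :
  s ∘ r = idc _ -> r ∘ f = r ∘ g -> f = g.
Proof.
by move=> rs e; rewrite -[f]comp1f -[g]comp1f -rs !compA e.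
Qed.

Lemma associ_nat A A' B B' C C' (f : hom A A') (g : hom B B') (h : hom C C') :
  associ A' B' C' ∘ (f ⊗m (g ⊗m h)) = ((f ⊗m g) ⊗m h) ∘ associ A B C.
Proof.
apply: (split_mono (assocK _ _ _)); rewrite -compA associK comp1f.
by rewrite -compA assoc_nat compA associK compf1.
Qed.

Lemma luni_nat A B (f : hom A B) : luni B ∘ f = (idc tunit ⊗m f) ∘ luni A.
Proof.
apply: (split_mono (lunK _)); rewrite -compA luniK comp1f.
by rewrite -compA lun_nat compA luniK compf1.
Qed.

Lemma runi_nat A B (f : hom A B) : runi B ∘ f = (f ⊗m idc tunit) ∘ runi A.
Proof.
apply: (split_mono (runK _)); rewrite -compA runiK comp1f.
by rewrite -compA run_nat compA runiK compf1.
Qed.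

Lemma tens1_inj A B (f g : hom A B) :
  idc tunit ⊗m f = idc tunit ⊗m g -> f = g.
Proof.
by move=> e; apply: (split_epi (luniK A)); rewrite -!lun_nat e.
Qed.

Lemma tensI_inj A B (f g : hom A B) :
  f ⊗m idc tunit = g ⊗m idc tunit -> f = g.
Proof.
by move=> e; apply: (split_epi (runiK A)); rewrite -!run_nat e.
Qed.

Lemma lunM A B : lun (A ⊗ B) ∘ assoc tunit A B = lun A ⊗m idc B.
Proof.
apply: tens1_inj; rewrite tens1D.
apply: (split_epi (associK _ _ _)).
apply: (split_epi (r := assoc _ _ _ ⊗m idc _) (s := associ _ _ _ ⊗m idc _)).
  by rewrite -tensD1 associK tensm1.
rewrite !compA -pentagon (pre _ (triangle _ _)) -tensm1 -assoc_nat.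
by rewrite (pre _ (esym (assoc_nat _ _ _))) compA -tensD1 triangle.
Qed.

Lemma runM A B : (idc A ⊗m run B) ∘ assoc A B tunit = run (A ⊗ B).
Proof.
apply: tensI_inj; rewrite tensD1.
apply: (split_mono (assocK _ _ _)).
rewrite (pre _ (assoc_nat _ _ _)) -triangle tens1D !compA -pentagon.
by rewrite -triangle -[in RHS]tensm1 (pre _ (assoc_nat _ _ _)) compA.
Qed.

Lemma lunMi A B : lun A ⊗m idc B ∘ associ tunit A B = lun (A ⊗ B).
Proof. by rewrite -lunM compA associK compf1. Qed.

Lemma lun1 A : lun (tunit ⊗ A) = idc tunit ⊗m lun A.
Proof. by apply: (split_mono (lunK A)); rewrite lun_nat. Qed.

Lemma run1 A : run (A ⊗ tunit) = run A ⊗m idc tunit.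
Proof. by apply: (split_mono (runK A)); rewrite run_nat. Qed.

Lemma lun_run : lun tunit = run tunit :> hom (tunit ⊗ tunit : S) tunit.
Proof.
apply: tens1_inj.
apply: (split_epi (associK _ _ _)).
by rewrite runM run1 triangle.
Qed.

Lemma lun_braid A : lun A ∘ braid A tunit = run A.
Proof.
apply: tensI_inj; rewrite tensD1.
apply: (split_mono (braidK _ _)).
have e := congr1 (comp (lun _)) (hexagon A tunit tunit).
move: e; rewrite (pre _ (lunM _ _)) (pre _ (lun_nat _)) !compA.
rewrite (pre _ (lunM _ _)) (pre _ (esym (braid_nat _ _))) compA triangle.
by move=> <-.
Qed.

Lemma run_braid A : run A ∘ braid tunit A = lun A.
Proof. by rewrite -lun_braid compA braidK compf1. Qed.

Lemma braid_luni A : braid A tunit ∘ runi A = luni A.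
Proof.
apply: (split_mono (lunK A)); rewrite (pre _ (lun_braid A)) runiK.
by rewrite luniK.
Qed.

Lemma luni_runi : luni tunit = runi tunit :> hom (tunit : S) (tunit ⊗ tunit).
Proof.
by apply: (split_mono (lunK _)); rewrite luniK lun_run runiK.
Qed.

Lemma luniM A B : assoc tunit A B ∘ (luni A ⊗m idc B) = luni (A ⊗ B).
Proof.
apply: (split_mono (lunK _)).
by rewrite (pre _ (lunM _ _)) -tensD1 !luniK tensm1.
Qed.

Lemma runiM A B : assoc A B tunit ∘ runi (A ⊗ B) = idc A ⊗m runi B.
Proof.
apply: (split_mono (r := idc A ⊗m run B) (s := idc A ⊗m runi B)).
  by rewrite -tens1D runK tensm1.
by rewrite (pre _ (runM _ _)) -tens1D !runiK tensm1.
Qed.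

Lemma triangle_i A B :
  assoc A tunit B ∘ (runi A ⊗m idc B) = idc A ⊗m luni B.
Proof.
apply: (split_mono (r := idc A ⊗m lun B) (s := idc A ⊗m luni B)).
  by rewrite -tens1D lunK tensm1.
by rewrite (pre _ (triangle _ _)) -tensD1 -tens1D runiK luniK !tensm1.
Qed.

Lemma inverse_eq A B (f f' : hom A B) (g g' : hom B A) :
  g ∘ f = idc _ -> f' ∘ g' = idc _ -> g = g' -> f = f'.
Proof. by move=> e e' eg; rewrite -[f]comp1f -e' -eg compA e compf1. Qed.

Lemma hexagon_i A B C :
  associ A B C ∘ (braid (B ⊗ C) A ∘ associ B C A)
  = (braid B A ⊗m idc C) ∘ (associ B A C ∘ (idc B ⊗m braid C A)).
Proof.
apply: (inverse_eq _ _ (hexagon A B C)); rewrite !compA.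
  rewrite (pre _ (associK _ _ _)) comp1f (pre _ (braidK _ _)) comp1f.
  by rewrite associK.
rewrite (pre _ (esym (tens1D _ _ _))) braidK tensm1 comp1f.
by rewrite (pre _ (assocK _ _ _)) comp1f -tensD1 braidK tensm1.
Qed.

Lemma braid_rot A B C :
  braid (C ⊗ A) B ∘ (associ C A B ∘ braid (A ⊗ B) C)
  = assoc B C A ∘ (braid A (B ⊗ C) ∘ assoc A B C).
Proof.
rewrite hexagon; apply: (split_epi (r := braid B A ⊗m idc C)
  (s := braid A B ⊗m idc C)); first by rewrite -tensD1 braidK tensm1.
rewrite !compA braid_nat -[in RHS]tensD1 braidK tensm1 compf1.
have e : braid (C ⊗ A) B ∘ (associ C A B ∘ (idc C ⊗m braid B A))
    = assoc B C A ∘ ((braid C B ⊗m idc A) ∘ associ C B A).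
  apply: (split_mono (associK _ _ _)).
  rewrite (pre _ (assocK _ _ _)) comp1f -2!compA [X in X ∘ _]compA hexagon_i.
  by rewrite !compA -tens1D braidK tensm1 compf1.
rewrite -!compA in e *; rewrite e.
apply: (split_epi (assocK _ _ _)); rewrite !compA associK compf1 hexagon_i.
rewrite (pre _ (esym (tensD1 _ _ _))) braidK tensm1 comp1f.
by rewrite (pre _ (associK _ _ _)) comp1f.
Qed.

Lemma braid_roti A B C :
  braid C (A ⊗ B) ∘ (assoc C A B ∘ braid B (C ⊗ A))
  = associ A B C ∘ (braid (B ⊗ C) A ∘ associ B C A).
Proof.
apply: (inverse_eq _ _ (braid_rot A B C)); rewrite !compA.
  rewrite (pre _ (braidK _ _)) comp1f (pre _ (assocK _ _ _)) comp1f.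
  by rewrite braidK.
rewrite (pre _ (assocK _ _ _)) comp1f (pre _ (braidK _ _)) comp1f.
by rewrite assocK.
Qed.

Lemma runi_braid A : braid tunit A ∘ luni A = runi A.
Proof. by rewrite -braid_luni (pre _ (braidK _ _)) comp1f. Qed.

End Coherence.

(* A symmetric monoidal category with a dualizing object, presented by the
   operation A ↦ A^⊥.  The dualizing object is ⊥ := I^⊥; [ev A] exhibits A^⊥
   as the internal hom [A, ⊥] (with the canonical choice [ev I = ρ]), [tr] being
   transposition, and [chii] states that the canonical arrow χ_A : A → A^⊥⊥ is
   invertible.  The remaining internal homs are A ⊸ B = (A ⊗ B^⊥)^⊥. *)
Record star_autonomous := StarAutonomous {
  sa_sm :> smcat;
  dual : sa_sm -> sa_sm;
  ev : forall A, hom (dual A ⊗ A) (dual tunit);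
  tr : forall X A, hom (X ⊗ A) (dual tunit) -> hom X (dual A);
  trK : forall X A (f : hom (X ⊗ A) (dual tunit)),
    ev A ∘ (tr f ⊗m idc A) = f;
  tr_uniq : forall X A (g : hom X (dual A)), tr (ev A ∘ (g ⊗m idc A)) = g;
  ev_unit : ev tunit = run (dual tunit);
  chii : forall A, hom (dual (dual A)) A;
  chiiK : forall A, tr (ev A ∘ braid A (dual A)) ∘ chii A = idc _;
  chiK : forall A, chii A ∘ tr (ev A ∘ braid A (dual A)) = idc _ }.

Arguments dual {s} A.
Arguments ev {s} A.
Arguments tr {s X A} f.
Arguments chii {s} A.
Notation "A ^⊥" := (dual A) (at level 2, format "A ^⊥") : cat_scope.

Section StarAutonomousOps.
Variable D : star_autonomous.
Implicit Types A B C X : D.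

Definition bot : D := tunit^⊥.

Definition chi A : hom A A^⊥^⊥ := tr (ev A ∘ braid A A^⊥).

Definition dualm A B (f : hom A B) : hom B^⊥ A^⊥ := tr (ev B ∘ (idc _ ⊗m f)).

Definition par A B : D := (A^⊥ ⊗ B^⊥)^⊥.

Definition parm A A' B B' (f : hom A A') (g : hom B B') :
  hom (par A B) (par A' B') := dualm (dualm f ⊗m dualm g).

(* The symmetric monoidal structure (⅋, ⊥), dual to (⊗, I). *)
Definition par_assoc A B C : hom (par (par A B) C) (par A (par B C)) :=
  dualm ((chi _ ⊗m idc C^⊥) ∘ associ _ _ _ ∘ (idc A^⊥ ⊗m chii _)).

Definition par_associ A B C : hom (par A (par B C)) (par (par A B) C) :=
  dualm ((idc A^⊥ ⊗m chi _) ∘ assoc _ _ _ ∘ (chii _ ⊗m idc C^⊥)).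

Definition par_braid A B : hom (par A B) (par B A) := dualm (braid B^⊥ A^⊥).

Definition par_run A : hom (par A bot) A :=
  chii A ∘ dualm ((idc A^⊥ ⊗m chi tunit) ∘ runi A^⊥).

Definition par_runi A : hom A (par A bot) :=
  dualm (run A^⊥ ∘ (idc A^⊥ ⊗m chii tunit)) ∘ chi A.

Definition par_lun A : hom (par bot A) A := par_run A ∘ par_braid bot A.

(* The bijection hom(X^⊥, A) ≅ hom(I, A ⅋ X). *)
Definition name A X (g : hom X^⊥ A) : hom tunit (par A X) :=
  tr (ev A ∘ (idc A^⊥ ⊗m g) ∘ lun (A^⊥ ⊗ X^⊥)).

Definition coname A X (s : hom tunit (par A X)) : hom X^⊥ A :=
  chii A ∘ tr (ev (A^⊥ ⊗ X^⊥) ∘ (s ⊗m idc _) ∘ luni _ ∘ braid X^⊥ A^⊥).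

End StarAutonomousOps.

Arguments bot {D}.
Arguments chi {D} A.

Section StarAutonomousTheory.
Variable D : star_autonomous.
Implicit Types A B C X : D.

Lemma tr_inj X A (f g : hom X A^⊥) :
  ev A ∘ (f ⊗m idc A) = ev A ∘ (g ⊗m idc A) -> f = g.
Proof. by move=> e; rewrite -[f]tr_uniq e tr_uniq. Qed.

Lemma ev_dualm A B (f : hom A B) :
  ev A ∘ (dualm f ⊗m idc A) = ev B ∘ (idc _ ⊗m f).
Proof. exact: trK. Qed.

Lemma ev_chi A : ev A^⊥ ∘ (chi A ⊗m idc _) = ev A ∘ braid A A^⊥.
Proof. exact: trK. Qed.

Lemma dualmD A B C (g : hom B C) (f : hom A B) :
  dualm (g ∘ f) = dualm f ∘ dualm g.
Proof.
apply: tr_inj; rewrite ev_dualm tensD1 (pre _ (ev_dualm f)) compA tens_rl.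
by rewrite -(tens_lr (dualm g)) (pre _ (ev_dualm g)) compA -tens1D.
Qed.

Lemma dualm1 A : dualm (idc A) = idc _.
Proof. by apply: tr_inj; rewrite ev_dualm. Qed.

Lemma chi_nat A B (f : hom A B) : chi B ∘ f = dualm (dualm f) ∘ chi A.
Proof.
apply: tr_inj; rewrite !tensD1 (pre _ (ev_chi _)) (pre _ (ev_dualm _)) !compA.
rewrite tens_rl -(tens_lr (chi A)) (pre _ (ev_chi _)) !compA !braid_nat.
by rewrite (pre _ (ev_dualm _)) compA.
Qed.

Lemma dualm_chi A : dualm (chi A) ∘ chi A^⊥ = idc _.
Proof.
apply: tr_inj; rewrite tensD1 (pre _ (ev_dualm _)) compA tens_rl -(tens_lr (chi _)).
rewrite (pre _ (ev_chi _)) compA braid_nat (pre _ (ev_chi _)) compA.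
by rewrite braidK tensm1.
Qed.

Lemma dualm_point A (u : hom tunit A) : dualm u = ev A ∘ (idc _ ⊗m u) ∘ runi _.
Proof.
apply: (split_epi (runiK _)); rewrite !compA runK compf1 -ev_dualm ev_unit.
by rewrite run_nat.
Qed.

Lemma ev_bot_chi :
  ev bot ∘ (chi tunit ⊗m idc bot) = lun bot :> hom (tunit ⊗ bot : D) bot.
Proof. by rewrite ev_chi ev_unit run_braid. Qed.

Lemma ev_copoint A (x : hom A (bot : D)) :
  ev A ∘ ((dualm x ∘ chi tunit) ⊗m idc A) = x ∘ lun A.
Proof.
rewrite tensD1 (pre _ (ev_dualm _)) compA tens_rl -(tens_lr (chi _)).
by rewrite (pre _ ev_bot_chi) lun_nat.
Qed.

Lemma bot_copoint (x : hom tunit (bot : D)) :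
  dualm (dualm x ∘ chi tunit) ∘ chi tunit = x.
Proof.
by rewrite dualmD compA -chi_nat -compA dualm_chi comp1f.
Qed.

End StarAutonomousTheory.

Record compact_closed := CompactClosed {
  cc_sm :> smcat;
  cdual : cc_sm -> cc_sm;
  cunit : forall A, hom tunit (A ⊗ cdual A);
  counit : forall A, hom (cdual A ⊗ A) tunit;
  zigzag : forall A,
    (idc A ⊗m counit A) ∘ assoc _ _ _ ∘ (cunit A ⊗m idc A)
    = runi A ∘ lun A;
  zagzig : forall A,
    (counit A ⊗m idc (cdual A)) ∘ associ _ _ _ ∘ (idc (cdual A) ⊗m cunit A)
    = luni (cdual A) ∘ run (cdual A) }.

Arguments cdual {c} A.
Arguments cunit {c} A.
Arguments counit {c} A.

Section DualPair.
Variables (S : smcat) (A L : S) (eta : hom tunit (A ⊗ L)) (eps : hom (L ⊗ A) tunit).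
Hypothesis zig : (idc A ⊗m eps) ∘ assoc _ _ _ ∘ (eta ⊗m idc A) = runi A ∘ lun A.
Hypothesis zag : (eps ⊗m idc L) ∘ associ _ _ _ ∘ (idc L ⊗m eta) = luni L ∘ run L.

Definition ptr X (f : hom (X ⊗ A) tunit) : hom X L :=
  lun L ∘ (f ⊗m idc L) ∘ associ X A L ∘ (idc X ⊗m eta) ∘ runi X.

Lemma ptrK X (f : hom (X ⊗ A) tunit) : eps ∘ (ptr f ⊗m idc A) = f.
Proof.
have e : run (X ⊗ A) ∘ (idc _ ⊗m eps) ∘ assoc _ _ _ ∘ (associ X A L ⊗m idc A)
   ∘ ((idc X ⊗m eta) ⊗m idc A) ∘ (runi X ⊗m idc A) = idc _.
  have p : assoc (X ⊗ A) L A ∘ (associ X A L ⊗m idc A)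
     = associ _ _ _ ∘ (idc X ⊗m assoc A L A) ∘ assoc X (A ⊗ L) A.
    apply: (split_mono (assocK _ _ _)).
    rewrite (pre _ (pentagon _ _ _ _)) !compA -tensD1 associK tensm1 compf1.
    by rewrite (pre _ (associK _ _ _)) comp1f.
  rewrite !compA (pre _ p) !compA -tensm1 (pre _ (esym (associ_nat _ _ _))).
  rewrite -runM !compA (pre _ (associK _ _ _)) comp1f.
  rewrite (pre _ (assoc_nat _ _ _)) !compA.
  rewrite (pre _ (esym (tens1D _ _ _))) (pre _ (esym (tens1D _ _ _))).
  rewrite (pre _ (esym (tens1D _ _ _))) !compA.
  move: zig; rewrite compA => ->.
  rewrite (pre _ (runiK _)) comp1f (pre _ (triangle _ _)) -tensD1 runiK.
  by rewrite tensm1.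
rewrite /ptr !compA !tensD1 -lunM !compA.
rewrite (pre _ (esym (lun_nat _))) !compA (pre _ (assoc_nat _ _ _)) tensm1.
rewrite !compA (pre _ (tens_rl _ _)) -(tens_lr f) lun_run !compA.
rewrite (pre _ (run_nat _)) !compA.
by move: e; rewrite !compA => ->; rewrite compf1.
Qed.

Lemma ptr_uniq X (g : hom X L) : ptr (eps ∘ (g ⊗m idc A)) = g.
Proof.
rewrite /ptr tensD1 !compA (pre _ (esym (associ_nat _ _ _))) tensm1.
rewrite !compA (pre _ (tens_lr _ _)) -(tens_rl g) !compA -runi_nat.
have z : (eps ⊗m idc L) ∘ (associ _ _ _ ∘ ((idc L ⊗m eta) ∘ (runi L ∘ g)))
   = luni L ∘ g.
  rewrite -!compA; congr (_ ∘ _); rewrite zag compA runiK compf1.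
  by [].
by rewrite z (pre _ (luniK _)) comp1f.
Qed.

Lemma ptr_inj X (f g : hom X L) :
  eps ∘ (f ⊗m idc A) = eps ∘ (g ⊗m idc A) -> f = g.
Proof. by move=> e; rewrite -[f]ptr_uniq e ptr_uniq. Qed.

End DualPair.

Section DualPairSym.
Variables (S : smcat) (A L : S) (eta : hom tunit (A ⊗ L)) (eps : hom (L ⊗ A) tunit).
Hypothesis zig : (idc A ⊗m eps) ∘ assoc _ _ _ ∘ (eta ⊗m idc A) = runi A ∘ lun A.
Hypothesis zag : (eps ⊗m idc L) ∘ associ _ _ _ ∘ (idc L ⊗m eta) = luni L ∘ run L.

Let eta' := braid A L ∘ eta.
Let eps' := eps ∘ braid A L.

Lemma dual_pair_sym_zag :
  (eps' ⊗m idc A) ∘ associ _ _ _ ∘ (idc A ⊗m eta') = luni A ∘ run A.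
Proof using zig.
have e := hexagon_i L A A; rewrite -braid_roti in e.
move: zig; rewrite !compA => z.
rewrite /eps' /eta' tensD1 tens1D !compA.
have -> : (braid A L ⊗m idc A) ∘ (associ A L A ∘
    ((idc A ⊗m braid A L) ∘ (idc A ⊗m eta)))
  = braid A (L ⊗ A) ∘ (assoc A L A ∘ ((eta ⊗m idc A) ∘ braid A tunit)).
  by rewrite -braid_nat -!compA; congr (_ ∘ _); rewrite !compA -e.
rewrite (pre _ (esym (braid_nat _ _))) !compA.
move/(congr1 (fun x => x ∘ braid A tunit)): z; rewrite !compA => ->.
by rewrite lun_braid (pre _ (braid_luni A)).
Qed.

Lemma dual_pair_sym_zig :
  (idc L ⊗m eps') ∘ assoc _ _ _ ∘ (eta' ⊗m idc L) = runi L ∘ lun L.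
Proof using zag.
have e := hexagon A L L; rewrite -braid_rot in e.
move: zag; rewrite !compA => z.
rewrite /eps' /eta' tensD1 tens1D !compA.
have -> : (idc L ⊗m braid A L) ∘ (assoc L A L ∘
    ((braid A L ⊗m idc L) ∘ (eta ⊗m idc L)))
  = braid (L ⊗ A) L ∘ (associ L A L ∘ ((idc L ⊗m eta) ∘ braid tunit L)).
  by rewrite -braid_nat -!compA; congr (_ ∘ _); rewrite !compA -e.
rewrite (pre _ (esym (braid_nat _ _))) !compA.
move/(congr1 (fun x => x ∘ braid tunit L)): z; rewrite !compA => ->.
by rewrite run_braid (pre _ (runi_braid L)).
Qed.

End DualPairSym.

Section CompactStar.
Variable C : compact_closed.
Implicit Types A X : C.

Definition cc_tr X A (f : hom (X ⊗ A) tunit) : hom X (cdual A) :=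
  ptr (cunit A) f.

Lemma cc_trK X A (f : hom (X ⊗ A) tunit) :
  counit A ∘ (cc_tr f ⊗m idc A) = f.
Proof. exact: ptrK (zigzag A) _ _. Qed.

Lemma cc_tr_uniq X A (g : hom X (cdual A)) :
  cc_tr (counit A ∘ (g ⊗m idc A)) = g.
Proof. exact: ptr_uniq (zagzig A) _ _. Qed.

Lemma cc_tr_inj X A (f g : hom X (cdual A)) :
  counit A ∘ (f ⊗m idc A) = counit A ∘ (g ⊗m idc A) -> f = g.
Proof. by move=> e; rewrite -[f]cc_tr_uniq e cc_tr_uniq. Qed.

(* The canonical isomorphism I ≅ I^⊥. *)
Definition cc_iota : hom (tunit : C) (cdual tunit) := cc_tr (lun tunit).
Definition cc_iotai : hom (cdual tunit) (tunit : C) := counit tunit ∘ runi _.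

Lemma cc_iotaiK : cc_iotai ∘ cc_iota = idc _.
Proof.
rewrite /cc_iotai compA runi_nat -compA cc_trK.
by rewrite lun_run runiK.
Qed.

Lemma cc_iotaK : cc_iota ∘ cc_iotai = idc _.
Proof.
apply: cc_tr_inj; rewrite tensD1 -compA cc_trK lun_run run_nat.
by rewrite /cc_iotai compA runK tensm1.
Qed.

Definition cc_ev A : hom (cdual A ⊗ A) (cdual tunit) := cc_iota ∘ counit A.

Definition cc_trb X A (f : hom (X ⊗ A) (cdual tunit)) : hom X (cdual A) :=
  cc_tr (cc_iotai ∘ f).

Lemma cc_trbK X A (f : hom (X ⊗ A) (cdual tunit)) :
  cc_ev A ∘ (cc_trb f ⊗m idc A) = f.
Proof. by rewrite /cc_ev compA cc_trK -compA cc_iotaK comp1f. Qed.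

Lemma cc_trb_uniq X A (g : hom X (cdual A)) :
  cc_trb (cc_ev A ∘ (g ⊗m idc A)) = g.
Proof.
by rewrite /cc_trb /cc_ev compA -compA cc_iotaiK comp1f cc_tr_uniq.
Qed.

Lemma cc_ev_unit : cc_ev tunit = run (cdual tunit).
Proof.
rewrite /cc_ev; apply: (split_mono cc_iotaK).
rewrite -compA cc_iotaiK comp1f /cc_iotai compA runK.
by rewrite compf1.
Qed.

Definition cc_chii A : hom (cdual (cdual A)) A :=
  ptr (braid A (cdual A) ∘ cunit A) (counit (cdual A)).

Lemma cc_chiE A :
  cc_trb (cc_ev A ∘ braid A (cdual A)) = cc_tr (counit A ∘ braid A (cdual A)).
Proof. by rewrite /cc_trb /cc_ev compA -compA cc_iotaiK comp1f. Qed.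

Lemma cc_chiiP A :
  counit A ∘ braid A (cdual A) ∘ (cc_chii A ⊗m idc _) = counit (cdual A).
Proof. exact: ptrK (dual_pair_sym_zig (zagzig A)) _ _. Qed.

Lemma cc_chiiK A : cc_trb (cc_ev A ∘ braid A (cdual A)) ∘ cc_chii A = idc _.
Proof.
rewrite cc_chiE; apply: cc_tr_inj; rewrite tensD1 -compA cc_trK.
by rewrite cc_chiiP tensm1 compf1.
Qed.

Lemma cc_chiK A : cc_chii A ∘ cc_trb (cc_ev A ∘ braid A (cdual A)) = idc _.
Proof.
rewrite cc_chiE.
apply: (ptr_inj (dual_pair_sym_zag (zigzag A))).
by rewrite tensD1 -compA cc_chiiP cc_trK tensm1 compf1.
Qed.

Definition compact_star : star_autonomous :=
  @StarAutonomous C (@cdual C) cc_ev cc_trb cc_trbK cc_trb_uniq cc_ev_unit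
    cc_chii cc_chiiK cc_chiK.

End CompactStar.

Section Glueing.
Variable C : star_autonomous.

Record gobj := GObj {
  gcar : C;
  gpt : hom tunit gcar -> Prop;
  gcopt : hom gcar bot -> Prop }.

Implicit Types P Q R T : gobj.

Definition is_ghom P Q (f : hom (gcar P) (gcar Q)) : Prop :=
  (forall u, gpt u -> gpt (f ∘ u)) /\
  (forall y : hom (gcar Q) bot, gcopt y -> gcopt (y ∘ f)).

Definition ghom P Q := {f : hom (gcar P) (gcar Q) | @is_ghom P Q f}.

Lemma ghom_eq P Q (f g : ghom P Q) : proj1_sig f = proj1_sig g -> f = g.
Proof. by case: f g => [f hf] [g hg] /= e; apply: subset_eq_compat. Qed.

Lemma is_gid P : @is_ghom P P (idc _).
Proof. by split=> u; rewrite ?comp1f ?compf1. Qed.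

Lemma is_gcomp P Q R g f :
  @is_ghom Q R g -> @is_ghom P Q f -> @is_ghom P R (g ∘ f).
Proof.
move=> [g1 g2] [f1 f2]; split=> u hu; first by rewrite compA; apply/g1/f1.
by rewrite -compA; apply/f2/g2.
Qed.

Definition gcat : category.
Proof.
refine (@Category gobj ghom (fun P => exist _ _ (is_gid P))
  (fun P Q R g f => exist _ _ (is_gcomp (proj2_sig g) (proj2_sig f))) _ _ _).
- by move=> P Q f; apply: ghom_eq; rewrite /= comp1f.
- by move=> P Q f; apply: ghom_eq; rewrite /= compf1.
- by move=> P Q R T h g f; apply: ghom_eq; rewrite /= compA.
Defined.

Definition gunit : gobj :=
  GObj (fun u : hom tunit (tunit : C) => u = idc tunit) (fun=> True).

Definition gtens P Q : gobj :=
  @GObj (gcar P ⊗ gcar Q)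
    (fun w => exists u v, [/\ gpt u, gpt v & w = (u ⊗m v) ∘ luni tunit])
    (fun z => (forall v : hom tunit (gcar Q), gpt v ->
                 gcopt (z ∘ (idc (gcar P) ⊗m v) ∘ runi (gcar P))) /\
              (forall u : hom tunit (gcar P), gpt u ->
                 gcopt (z ∘ (u ⊗m idc (gcar Q)) ∘ luni (gcar Q)))).

Definition gdual P : gobj :=
  @GObj (gcar P)^⊥
    (fun w => exists2 x : hom (gcar P) bot, gcopt x & w = dualm x ∘ chi tunit)
    (fun y => exists2 u : hom tunit (gcar P), gpt u & y = dualm u).

Lemma is_gtensm P P' Q Q' f g :
  @is_ghom P P' f -> @is_ghom Q Q' g ->
  @is_ghom (gtens P Q) (gtens P' Q') (f ⊗m g).
Proof.
move=> [f1 f2] [g1 g2]; split=> [w [u [v [hu hv ->]]]|z [z1 z2]].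
  exists (f ∘ u), (g ∘ v); split; [exact: f1|exact: g1|].
  by rewrite -compA tensmD.
split=> [v hv|u hu].
- have := f2 _ (z1 _ (g1 _ hv)); congr gcopt; rewrite !compA runi_nat.
  by rewrite !(pre _ (esym (tensmD _ _ _ _))) !comp1f !compf1.
- have := g2 _ (z2 _ (f1 _ hu)); congr gcopt; rewrite !compA luni_nat.
  by rewrite !(pre _ (esym (tensmD _ _ _ _))) !comp1f !compf1.
Qed.

Section AssocPoints.
Variables (A B E : C) (p : hom tunit A) (q : hom tunit B) (r : hom tunit E).

Lemma assoc_pts :
  assoc A B E ∘ ((((p ⊗m q) ∘ luni _) ⊗m r) ∘ luni _)
  = (p ⊗m ((q ⊗m r) ∘ luni _)) ∘ luni _.
Proof.
have -> : ((p ⊗m q) ∘ luni _) ⊗m r = ((p ⊗m q) ⊗m r) ∘ (luni _ ⊗m idc _).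
  by rewrite -tensmD compf1.
rewrite !compA (pre _ (assoc_nat _ _ _)) !compA (pre _ (luniM _ _)).
by rewrite luni_nat (pre _ (esym (tensmD _ _ _ _))) compf1.
Qed.

Lemma assoc_pts_l :
  assoc A B E ∘ ((idc _ ⊗m r) ∘ (runi _ ∘ ((idc _ ⊗m q) ∘ runi _)))
  = (idc _ ⊗m ((q ⊗m r) ∘ luni _)) ∘ runi _.
Proof.
rewrite (pre _ (runi_nat _)) !compA (pre _ (tens_rl _ _)).
rewrite (pre _ (assoc_nat _ _ _)) !compA (pre _ (runiM _ _)).
by rewrite (pre _ (esym (tensmD _ _ _ _))) compf1 luni_runi.
Qed.

Lemma assoc_pts_m :
  assoc A B E ∘ ((idc _ ⊗m r) ∘ (runi _ ∘ ((p ⊗m idc _) ∘ luni _)))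
  = (p ⊗m idc _) ∘ (luni _ ∘ ((idc _ ⊗m r) ∘ runi _)).
Proof.
rewrite (pre _ (runi_nat _)) !compA (pre _ (tens_rl _ _)).
rewrite (pre _ (assoc_nat _ _ _)) !compA (pre _ (runiM _ _)).
by rewrite [in RHS]luni_nat tens1D !compA (pre _ (tens_lr _ _)).
Qed.

Lemma assoc_pts_r :
  assoc A B E ∘ ((((p ⊗m q) ∘ luni _) ⊗m idc _) ∘ luni _)
  = (p ⊗m idc _) ∘ (luni _ ∘ ((q ⊗m idc _) ∘ luni _)).
Proof.
rewrite tensD1 !compA (pre _ (assoc_nat _ _ _)) !compA (pre _ (luniM _ _)).
by rewrite [in RHS](pre _ (luni_nat _)) !compA (pre _ (tens_lr _ _)).
Qed.

End AssocPoints.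

Lemma is_gassoc P Q R :
  @is_ghom (gtens (gtens P Q) R) (gtens P (gtens Q R)) (assoc _ _ _).
Proof.
split=> [w [_ [r [[p [q [hp hq ->]]] hr ->]]]|z [z1 z2]].
  by rewrite assoc_pts; exists p, ((q ⊗m r) ∘ luni _); split=> //; exists q, r.
split=> [r hr|_ [p [q [hp hq ->]]]]; first split=> [q hq|p hp].
- have := z1 ((q ⊗m r) ∘ luni _); rewrite !compA assoc_pts_l; apply.
  by exists q, r.
- by have := (z2 p hp).1 r hr; rewrite !compA assoc_pts_m.
- by have := (z2 p hp).2 q hq; rewrite !compA -assoc_pts_r.
Qed.

Lemma is_gassoci P Q R :
  @is_ghom (gtens P (gtens Q R)) (gtens (gtens P Q) R) (associ _ _ _).
Proof.
split=> [w [p [_ [hp [q [r [hq hr ->]]] ->]]]|z [z1 z2]].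
  rewrite -assoc_pts (pre _ (assocK _ _ _)) comp1f.
  by exists ((p ⊗m q) ∘ luni _), r; split=> //; exists p, q.
split=> [_ [q [r [hq hr ->]]]|p hp]; last split=> [r hr|q hq].
- have := (z1 r hr).1 q hq; rewrite !compA -assoc_pts_l.
  by rewrite (pre _ (assocK _ _ _)) comp1f.
- have := (z1 r hr).2 p hp; rewrite !compA -assoc_pts_m.
  by rewrite (pre _ (assocK _ _ _)) comp1f.
- have := z2 ((p ⊗m q) ∘ luni _); rewrite !compA -assoc_pts_r.
  by rewrite (pre _ (assocK _ _ _)) comp1f; apply; exists p, q.
Qed.

Lemma is_glun P : @is_ghom (gtens gunit P) P (lun _).
Proof.
split=> [_ [_ [u [-> hu ->]]]|x hx].
  by rewrite (pre _ (lun_nat _)) compA luniK compf1.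
by split=> // u ->; rewrite tensm1 compf1 compA luniK compf1.
Qed.

Lemma is_gluni P : @is_ghom P (gtens gunit P) (luni _).
Proof.
split=> [u hu|z [_ z2]].
  by rewrite luni_nat; exists (idc _), u.
by have := z2 _ erefl; rewrite tensm1 compf1.
Qed.

Lemma is_grun P : @is_ghom (gtens P gunit) P (run _).
Proof.
split=> [_ [u [_ [hu -> ->]]]|x hx].
  by rewrite (pre _ (run_nat _)) compA luni_runi runiK compf1.
by split=> // u ->; rewrite tensm1 compf1 compA runiK compf1.
Qed.

Lemma is_gruni P : @is_ghom P (gtens P gunit) (runi _).
Proof.
split=> [u hu|z [z1 _]].
  by rewrite runi_nat -luni_runi; exists u, (idc _).
by have := z1 _ erefl; rewrite tensm1 compf1.
Qed.

Lemma is_gbraid P Q : @is_ghom (gtens P Q) (gtens Q P) (braid _ _).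
Proof.
split=> [_ [u [v [hu hv ->]]]|z [z1 z2]].
  rewrite (pre _ (braid_nat _ _)) compA runi_braid -luni_runi.
  by exists v, u.
split=> [v hv|u hu]; rewrite !compA (pre _ (braid_nat _ _)) !compA.
  by rewrite braid_luni -compA; apply: z2.
by rewrite runi_braid -compA; apply: z1.
Qed.

Definition gsm : smcat.
Proof.
refine (@SMCat gcat gunit gtens
  (fun _ _ _ _ f g => exist _ _ (is_gtensm (proj2_sig f) (proj2_sig g))) _ _
  (fun P Q R => exist _ _ (is_gassoc P Q R))
  (fun P Q R => exist _ _ (is_gassoci P Q R)) _ _ _
  (fun P => exist _ _ (is_glun P)) (fun P => exist _ _ (is_gluni P)) _ _ _
  (fun P => exist _ _ (is_grun P)) (fun P => exist _ _ (is_gruni P)) _ _ _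
  (fun P Q => exist _ _ (is_gbraid P Q)) _ _ _ _ _);
  intros; apply: ghom_eq => /=.
- exact: tensm1.
- exact: tensmD.
- exact: assocK.
- exact: associK.
- exact: assoc_nat.
- exact: lunK.
- exact: luniK.
- exact: lun_nat.
- exact: runK.
- exact: runiK.
- exact: run_nat.
- exact: braidK.
- exact: braid_nat.
- exact: triangle.
- exact: pentagon.
- exact: hexagon.
Defined.

(* Every arrow I → ⊥ is a point of the dualizing object of the glued category,
   since I carries all its copoints. *)
Lemma gbot_pt (x : hom tunit (bot : C)) : @gpt (gdual gunit) x.
Proof. by exists (dualm x ∘ chi tunit); rewrite ?bot_copoint. Qed.

Lemma gbot_copt : @gcopt (gdual gunit) (idc bot).
Proof. by exists (idc tunit); rewrite ?dualm1. Qed.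

Lemma is_gev P : @is_ghom (gtens (gdual P) P) (gdual gunit) (ev (gcar P)).
Proof.
split=> [w _|_ [_ -> ->]]; first exact: gbot_pt.
rewrite dualm1; split=> [u hu|_ [x hx ->]].
  by exists u; rewrite ?comp1f ?dualm_point.
by rewrite comp1f ev_copoint compA luniK compf1.
Qed.

Lemma is_gtr P Q (f : hom (gcar P ⊗ gcar Q) bot) :
  @is_ghom (gtens P Q) (gdual gunit) f -> @is_ghom P (gdual Q) (tr f).
Proof.
case=> [_ /(_ _ gbot_copt)[f1 f2]]; split=> [u hu|_ [v hv ->]].
  exists (f ∘ (u ⊗m idc _) ∘ luni _).
    by have := f2 u hu; rewrite comp1f.
  apply: tr_inj; rewrite ev_copoint tensD1 (pre _ (trK _)) !compA lunK.
  by rewrite compf1.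
have := f1 v hv; congr gcopt.
rewrite dualm_point !compA runi_nat (pre _ (tens_rl _ _)) -(tens_lr (tr f)).
by rewrite !compA (pre _ (trK _)) comp1f.
Qed.

Lemma is_gchii P : @is_ghom (gdual (gdual P)) P (chii _).
Proof.
split=> [_ [_ [u hu ->] ->]|x hx].
  by rewrite -chi_nat -compA chiK comp1f.
exists (dualm x ∘ chi tunit); first by exists x.
have e : dualm (dualm x ∘ chi tunit) ∘ chi _ = x.
  by rewrite dualmD compA -chi_nat -compA dualm_chi comp1f.
by rewrite -{1}e compA; apply: etrans (compf1 _); congr (_ ∘ _); apply: chiiK.
Qed.

Definition glue : star_autonomous.
Proof.
refine (@StarAutonomous gsm gdual (fun P => exist _ _ (is_gev P))
  (fun P Q f => exist _ _ (is_gtr (proj2_sig f))) _ _ _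
  (fun P => exist _ _ (is_gchii P)) _ _);
  intros; apply: ghom_eq => /=.
- exact: trK.
- exact: tr_uniq.
- exact: ev_unit.
- exact: chiiK.
- exact: chiK.
Defined.

End Glueing.

Record biproducts (C : category) := Biproducts {
  zero : C;
  to_zero : forall A : C, hom A zero;
  from_zero : forall A : C, hom zero A;
  to_zero_uniq : forall A (f : hom A zero), f = to_zero A;
  from_zero_uniq : forall A (f : hom zero A), f = from_zero A;
  zerom : forall A B : C, hom A B := fun A B => from_zero B ∘ to_zero A;
  biprod : C -> C -> C;
  inl_ : forall A B, hom A (biprod A B);
  inr_ : forall A B, hom B (biprod A B);
  prl : forall A B, hom (biprod A B) A;
  prr : forall A B, hom (biprod A B) B;
  prl_inl : forall A B, prl A B ∘ inl_ A B = idc A;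
  prr_inr : forall A B, prr A B ∘ inr_ A B = idc B;
  prr_inl : forall A B, prr A B ∘ inl_ A B = zerom A B;
  prl_inr : forall A B, prl A B ∘ inr_ A B = zerom B A;
  pairing : forall A B X (f : hom X A) (g : hom X B),
    exists! h : hom X (biprod A B), prl A B ∘ h = f /\ prr A B ∘ h = g;
  copairing : forall A B X (f : hom A X) (g : hom B X),
    exists! h : hom (biprod A B) X, h ∘ inl_ A B = f /\ h ∘ inr_ A B = g }.

Definition tensor_generated (C : compact_closed) : Prop :=
  forall (A B : C) (f g : hom A B), f <> g ->
    exists h : hom tunit A, f ∘ h <> g ∘ h.

(* [Lit true i] is the positive literal α_i and [Lit false i] is α_i^⊥. *)
Inductive formula (N : nat) :=
| Lit of bool & 'I_N
| Tens of formula N & formula N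
| Par of formula N & formula N.

(* Vertices of the parse forest of a sequent: the number of a formula together
   with the path from its root ([false] = left argument). *)
Definition addr := (nat * seq bool)%type.

Section ProofNets.
Variable N : nat.
Implicit Types (A B : formula N) (G : seq (formula N)) (v w : addr).

Fixpoint subf A (p : seq bool) : option (formula N) :=
  if p is b :: p' then
    match A with
    | Lit _ _ => None
    | Tens A1 A2 | Par A1 A2 => subf (if b then A2 else A1) p'
    end
  else Some A.

Definition occ G v : option (formula N) :=
  if onth G v.1 is Some A then subf A v.2 else None.

Record proof_structure G := ProofStructure {
  (* [link v w]: an axiom link between the positive literal occurrence v and
     the negative literal occurrence w *)
  link : rel addr;
  link_lit : forall v w, link v w -> exists i : 'I_N,
    occ G v = Some (Lit true i) /\ occ G w = Some (Lit false i);
  link_pos : forall v (i : 'I_N), occ G v = Some (Lit true i) ->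
    exists! w, link v w;
  link_neg : forall w (i : 'I_N), occ G w = Some (Lit false i) ->
    exists! v, link v w }.

(* A switching is given by the argument edge that is kept at each ⅋-vertex. *)
Definition kept G (s : addr -> bool) v (b : bool) : bool :=
  match occ G v with
  | Some (Tens _ _) => true
  | Some (Par _ _) => b == s v
  | _ => false
  end.

Definition arg_edge G s : rel addr := fun v w =>
  has (fun b => kept G s v b && (w == (v.1, rcons v.2 b))) [:: false; true].

Definition switching G (th : proof_structure G) s : rel addr := fun v w =>
  [|| arg_edge G s v w, arg_edge G s w v, link th v w | link th w v].

Definition acyclic (e : rel addr) : Prop :=
  forall c : seq addr, 2 < size c -> uniq c -> ~~ cycle e c.

Definition connected (V : addr -> Prop) (e : rel addr) : Prop :=
  forall v w, V v -> V w -> exists2 p, path e v p & last v p = w.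

Definition proof_net G (th : proof_structure G) : Prop :=
  forall s : addr -> bool,
    acyclic (switching th s) /\
    connected (fun v => occ G v <> None) (switching th s).

(* Cut-free derivations of the sequent calculus. *)
Inductive deriv : seq (formula N) -> Type :=
| DAx (i : 'I_N) : deriv [:: Lit true i; Lit false i]
| DTens A B G H : deriv (A :: G) -> deriv (B :: H) ->
    deriv (Tens A B :: G ++ H)
| DPar A B G : deriv (A :: B :: G) -> deriv (Par A B :: G)
| DExch G A B H : deriv (G ++ A :: B :: H) -> deriv (G ++ B :: A :: H).

Definition addr_tensl v : addr :=
  if v.1 is 0 then (0, false :: v.2) else v.
Definition addr_tensr (n : nat) v : addr :=
  if v.1 is k.+1 then (k.+1 + n, v.2) else (0, true :: v.2).
Definition addr_par v : addr :=
  match v.1 with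
  | 0 => (0, false :: v.2)
  | 1 => (0, true :: v.2)
  | k.+2 => (k.+1, v.2)
  end.
Definition addr_exch (n : nat) v : addr :=
  (if v.1 == n then n.+1 else if v.1 == n.+1 then n else v.1, v.2).

Definition map_links (f : addr -> addr) : seq (addr * addr) -> seq (addr * addr) :=
  map (fun l => (f l.1, f l.2)).

(* The axiom links of the proof structure of a derivation. *)
Fixpoint links G (d : deriv G) : seq (addr * addr) :=
  match d with
  | DAx _ => [:: ((0, [::]), (1, [::]))]
  | DTens _ _ G _ d1 d2 =>
      map_links addr_tensl (links d1)
      ++ map_links (addr_tensr (size G)) (links d2)
  | DPar _ _ _ d1 => map_links addr_par (links d1)
  | DExch G _ _ _ d1 => map_links (addr_exch (size G)) (links d1)
  end.

Definition sequentialises G (d : deriv G) (th : proof_structure G) : Prop :=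
  forall v w, link th v w = ((v, w) \in links d).

End ProofNets.

Section Interpretation.
Variables (D : star_autonomous) (N : nat).
Implicit Types (A B : formula N) (G H : seq (formula N)) (R S : 'I_N -> D).

Fixpoint fobj R S A : D :=
  match A with
  | Lit true i => R i
  | Lit false i => (S i)^⊥
  | Tens A1 A2 => fobj R S A1 ⊗ fobj R S A2
  | Par A1 A2 => par (fobj R S A1) (fobj R S A2)
  end.

Fixpoint fmap R R' S S' (f : forall i, hom (R i) (R' i))
    (g : forall i, hom (S' i) (S i)) A : hom (fobj R S A) (fobj R' S' A) :=
  match A with
  | Lit true i => f i
  | Lit false i => dualm (g i)
  | Tens A1 A2 => fmap f g A1 ⊗m fmap f g A2
  | Par A1 A2 => parm (fmap f g A1) (fmap f g A2)
  end.

(* The functor of the sequent A, G; sequents are non-empty. *)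
Fixpoint seqobj R S A G : D :=
  if G is B :: G' then par (fobj R S A) (seqobj R S B G') else fobj R S A.

Fixpoint seqmap R R' S S' (f : forall i, hom (R i) (R' i))
    (g : forall i, hom (S' i) (S i)) A G :
    hom (seqobj R S A G) (seqobj R' S' A G) :=
  match G with
  | [::] => fmap f g A
  | B :: G' => parm (fmap f g A) (seqmap f g B G')
  end.

Definition family A G := forall R, hom tunit (seqobj R R A G).

Definition mll_transformation A G (tau : family A G) : Prop :=
  forall R S (f : forall i, hom (R i) (S i)),
    seqmap f (fun i => idc (R i)) A G ∘ tau R
    = seqmap (fun i => idc (S i)) f A G ∘ tau S.

Section Derivations.
Variable R : 'I_N -> D.
Local Notation "⟦ A ⟧" := (fobj R R A).

(* Derivations are first interpreted with a trailing ⊥, which is then removed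
   by the unit isomorphism of ⅋. *)
Fixpoint ctx G : D := if G is A :: G' then par ⟦A⟧ (ctx G') else bot.

Fixpoint ctx_cat G H : hom (par (ctx G) (ctx H)) (ctx (G ++ H)) :=
  match G with
  | [::] => par_lun (ctx H)
  | A :: G' => parm (idc ⟦A⟧) (ctx_cat G' H) ∘ par_assoc _ _ _
  end.

Fixpoint ctx_exch G A B H :
    hom (ctx (G ++ A :: B :: H)) (ctx (G ++ B :: A :: H)) :=
  match G with
  | [::] =>
      par_assoc _ _ _ ∘ parm (par_braid ⟦A⟧ ⟦B⟧) (idc (ctx H))
      ∘ par_associ _ _ _
  | E :: G' => parm (idc ⟦E⟧) (ctx_exch G' A B H)
  end.

Fixpoint ctx_unbot A G : hom (ctx (A :: G)) (seqobj R R A G) :=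
  match G with
  | [::] => par_run ⟦A⟧
  | B :: G' => parm (idc ⟦A⟧) (ctx_unbot B G')
  end.

(* (I → A ⅋ X) and (I → B ⅋ Y) yield I → (A ⊗ B) ⅋ (X ⅋ Y). *)
Definition tens_rule (A B X Y : D)
    (s : hom tunit (par A X)) (t : hom tunit (par B Y)) :
    hom tunit (par (A ⊗ B) (par X Y)) :=
  name ((coname s ⊗m coname t) ∘ chii (X^⊥ ⊗ Y^⊥)).

Fixpoint interp_ctx G (d : deriv G) : hom tunit (ctx G) :=
  match d in deriv G return hom tunit (ctx G) with
  | DAx i =>
      parm (idc (R i)) (par_runi (R i)^⊥) ∘ name (chii (R i))
  | DTens A B G H d1 d2 =>
      parm (idc (⟦A⟧ ⊗ ⟦B⟧)) (ctx_cat G H)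
      ∘ tens_rule (interp_ctx d1) (interp_ctx d2)
  | DPar A B G d1 => par_associ _ _ _ ∘ interp_ctx d1
  | DExch G A B H d1 => ctx_exch G A B H ∘ interp_ctx d1
  end.

End Derivations.

Definition interp A G (d : deriv (A :: G)) : family A G :=
  fun R => ctx_unbot R A G ∘ interp_ctx R d.

(* A proof net denotes the interpretation of any of its sequentialisations;
   the choice is immaterial, as *-autonomous categories equate derivations
   with the same proof net. *)
Definition interprets A G (th : proof_structure (A :: G)) (tau : family A G) :
    Prop :=
  exists2 d : deriv (A :: G), sequentialises d th &
    forall R, tau R = interp d R.

End Interpretation.

Definition mll_fully_complete (D : star_autonomous) : Prop :=
  forall (N : nat) (A : formula N) (G : seq (formula N)) (tau : family D A G),
    mll_transformation tau ->
    exists2 th : proof_structure (A :: G), proof_net th & interprets th tau.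

(* Main.v *)
(* Arrows I -> F(R,R) are determined by their values on pure tests, made of an
   arrow R_i -> I at each positive and an arrow I -> R_i at each negative literal.
   The value of a dinatural tau is multilinear, and by dinaturality it does not
   depend on the glueing and reduces to scalars c_g, its values at coordinates of a
   biproduct W of copies of I indexed by the literals, where g sends positive to
   negative literals.  Dinaturality along maps between such biproducts shows that
   c_g <> 0 only if g is a bijection respecting the variables, i.e. a set of axiom
   links.  Three glueings then determine tau.
   - On I^2 with one point and one copoint the value of tau at a suitable test is 1,
     which gives some g with c_g <> 0 and with the number of links of a proof net.
   - On W with points and copoints scaled by {0}, {0,1} or all scalars, one sees
     that no valuation of the literals makes the sequent linked by g take the value
     {0} if c_g <> 0; this is the acyclicity of the switchings, and also c_g = 1.
   - On W with the coordinate vectors as points and the 0/1-valued functionals as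
     copoints there are two tests with values c_g and c_g' that are never both 1 if
     g and g' are at minimal distance; hence g is unique.
   Acyclicity and the count of links yield a derivation, by moving pars out of
   tensors until none is left, and its interpretation has the same values as tau. *)

From HB Require Import structures.
Require Import Defs.
From mathcomp Require Import all_boot.
From mathcomp Require Import zify.
From Stdlib Require Import ClassicalEpsilon.
Require Import Defs.

Set Implicit Arguments.
Unset Strict Implicit.
Unset Printing Implicit Defensive.

(** * Sequentialisation of labelled sequents *)

(** The scalars form a commutative semiring, in general without subtraction or cancellation. So no
    value is expanded as a sum over coordinates: a nonzero value is traced to a nonzero coordinate
    by endomorphisms of W that kill coordinates, and linear combinations are replaced by the
    condition that a point annihilated by a family of tests is annihilated by the given test.
    Tensor-generation gives separation by points and, by duality, by tests. Compactness gives I ≅ ⊥,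
    which makes the value of a test a scalar, and the separation of points of A ⊗ B by pure tests.
    The hypothesis 0 ≠ 1 turns the value 1 into a nonzero coefficient. Sequentialisation replaces
    paths by valuations: a path in a switching has VT at one end and VF at the other, and valuations
    on premises without common labels can be glued. Acyclicity alone yields several derivable
    sequents side by side; the count of links leaves only one. The hard step is to undo a linear
    distribution, that is, to push a par back under a tensor in a derivation. *)

Ltac perm_lia :=
  let P := fresh "P" in
  (* Counting under an arbitrary predicate turns a permutation goal into linear arithmetic. *)
  apply/permP => P;
  repeat match goal with
  | H : is_true (perm_eq _ _) |- _ => move/permP/(_ P): H
  end;
  rewrite /= ?(count_cat, size_cat) /= ?count_cat /=; lia.

Section PermLemmas.
Variable T : eqType.
Implicit Types (x : T) (s t : seq T).

Lemma perm_cons2 x y s t : perm_eq (x :: s) (y :: t) ->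
  (y = x /\ perm_eq s t) \/
  exists2 t', perm_eq t (x :: t') & perm_eq s (y :: t').
Proof.
move=> e; have := perm_mem e y; rewrite inE mem_head => /orP[/eqP yx|ys].
  by left; split=> //; move: e; rewrite yx perm_cons.
by right; exists (rem y s); have e2 := perm_to_rem ys; perm_lia.
Qed.

Lemma perm_cat_cons x s1 s2 t : perm_eq (s1 ++ s2) (x :: t) ->
  (exists2 s, perm_eq s1 (x :: s) & perm_eq (s ++ s2) t) \/
  exists2 s, perm_eq s2 (x :: s) & perm_eq (s1 ++ s) t.
Proof.
move=> e; have := perm_mem e x; rewrite mem_cat mem_head => /orP[] xs.
- by left; exists (rem x s1); have e2 := perm_to_rem xs; perm_lia.
- by right; exists (rem x s2); have e2 := perm_to_rem xs; perm_lia.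
Qed.

Lemma perm_cat_split s1 s2 t1 t2 : perm_eq (s1 ++ s2) (t1 ++ t2) ->
  exists a b c d, [/\ perm_eq s1 (a ++ b), perm_eq s2 (c ++ d),
    perm_eq t1 (a ++ c) & perm_eq t2 (b ++ d)].
Proof.
elim: t1 s1 s2 => [|x t1 IH] s1 s2 e.
  by exists [::], s1, [::], s2; rewrite !perm_refl perm_sym.
have [[s e1 e2]|[s e1 e2]] := perm_cat_cons e;
  have [a [b [c [d [h1 h2 h3 h4]]]]] := IH _ _ e2.
- by exists (x :: a), b, c, d; split; perm_lia.
- by exists a, b, (x :: c), d; split; perm_lia.
Qed.

End PermLemmas.

(* Truth values of labelled formulas; in the glued category VF, VO and VT become
   objects whose points are the multiples of a test by 0, by 0 and 1, and by all
   scalars, with the dual restriction on their copoints. *)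
Inductive val3 := VF | VO | VT.

(** With VF < VO < VT these are the operations of the three-element Sugihara monoid: [tens3] returns
    the argument farther from VO and breaks ties downwards, [par3] breaks them upwards. VO is
    neutral for both, which reflects I ≅ ⊥. *)
Definition dual3 x := match x with VF => VT | VO => VO | VT => VF end.
Definition tens3 x y :=
  match x, y with
  | VF, _ | _, VF => VF
  | VO, z | z, VO => z
  | VT, VT => VT
  end.
Definition par3 x y :=
  match x, y with
  | VT, _ | _, VT => VT
  | VO, z | z, VO => z
  | VF, VF => VF
  end.

Lemma par3A : associative par3. Proof. by do 3!case. Qed.
Lemma par3C : commutative par3. Proof. by do 2!case. Qed.
Lemma par3O : left_id VO par3. Proof. by case. Qed.
HB.instance Definition _ := Monoid.isComLaw.Build val3 VO par3 par3A par3C par3O.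
Lemma tens3C : commutative tens3. Proof. by do 2!case. Qed.

(** * Valuations and derivability of labelled sequents *)

Section Labelled.
Variable L : eqType.

Inductive lform :=
| LLit of bool & L
| LTens of lform & lform
| LPar of lform & lform.

Lemma lform_comparable : comparable lform.
Proof.
move=> x y; rewrite /decidable; decide equality; exact: eq_comparable.
Qed.

HB.instance Definition _ := hasDecEq.Build lform (compareP lform_comparable).

Implicit Types (A B C D P X Y Z : lform) (G H K : seq lform) (v : L -> val3).

Fixpoint leaves A : seq (bool * L) :=
  match A with
  | LLit b l => [:: (b, l)]
  | LTens A1 A2 | LPar A1 A2 => leaves A1 ++ leaves A2
  end.

Definition sleaves G := flatten (map leaves G).

Lemma sleaves_cat G H : sleaves (G ++ H) = sleaves G ++ sleaves H.
Proof. by rewrite /sleaves map_cat flatten_cat. Qed.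

Lemma sleaves_cons A G : sleaves (A :: G) = leaves A ++ sleaves G.
Proof. by []. Qed.

Lemma perm_sleaves G H : perm_eq G H -> perm_eq (sleaves G) (sleaves H).
Proof. by move=> e; apply/perm_flatten/perm_map. Qed.

Lemma sleavesP a G : reflect (exists2 A, A \in G & a \in leaves A) (a \in sleaves G).
Proof. exact: flatten_mapP. Qed.

Lemma leaves_gt0 A : exists a, a \in leaves A.
Proof.
elim: A => [b l|A [a ha] B _|A [a ha] B _] /=.
- by exists (b, l); rewrite mem_head.
- by exists a; rewrite mem_cat ha.
- by exists a; rewrite mem_cat ha.
Qed.

Fixpoint val v A :=
  match A with
  | LLit b l => if b then v l else dual3 (v l)
  | LTens A1 A2 => tens3 (val v A1) (val v A2)
  | LPar A1 A2 => par3 (val v A1) (val v A2)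
  end.

Lemma eq_val v v' A :
  (forall b l, (b, l) \in leaves A -> v l = v' l) -> val v A = val v' A.
Proof.
elim: A => [b l|A IA B IB|A IA B IB] /= e; first by rewrite (e b) ?mem_head.
- by rewrite IA ?IB // => b l h; apply: (e b); rewrite mem_cat h ?orbT.
- by rewrite IA ?IB // => b l h; apply: (e b); rewrite mem_cat h ?orbT.
Qed.

Lemma val_O A : val (fun=> VO) A = VO.
Proof. by elim: A => [[] l|A /= -> B ->|A /= -> B ->]. Qed.

Definition vpar v G := \big[par3/VO]_(A <- G) val v A.

Lemma vpar_cons v A G : vpar v (A :: G) = par3 (val v A) (vpar v G).
Proof. by rewrite /vpar big_cons. Qed.

Lemma vpar_cat v G H : vpar v (G ++ H) = par3 (vpar v G) (vpar v H).
Proof. by rewrite /vpar big_cat. Qed.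

Lemma perm_vpar v G H : perm_eq G H -> vpar v G = vpar v H.
Proof. exact: perm_big. Qed.

Lemma vparT v A G : A \in G -> val v A = VT -> vpar v G = VT.
Proof.
elim: G => //= B G IH; rewrite inE vpar_cons => /orP[/eqP <- ->//|h e].
by rewrite IH //; case: (val v B).
Qed.

Lemma vparF v A G : A \in G -> val v A = VF ->
  (forall B, B \in G -> val v B <> VT) -> vpar v G = VF.
Proof.
move=> AG vA; rewrite (perm_vpar _ (perm_to_rem AG)) vpar_cons vA.
move=> h; have {}h B : B \in rem A G -> val v B <> VT by move/mem_rem; exact: h.
elim: (rem A G) h => [|B K IH] h; first by rewrite /vpar big_nil.
rewrite vpar_cons; case e: (val v B) (h B (mem_head _ _)) => // _;
by case: (vpar v K) IH => // IH; apply: IH => C hC; apply: h; rewrite inE hC orbT.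
Qed.

Lemma eq_vpar v v' G :
  (forall A, A \in G -> val v A = val v' A) -> vpar v G = vpar v' G.
Proof. by move=> e; rewrite /vpar; apply: eq_big_seq => A /e. Qed.

Lemma vparO v G : (forall A, A \in G -> val v A = VO) -> vpar v G = VO.
Proof.
move=> h; elim: G h => [|A G IH] h; first by rewrite /vpar big_nil.
by rewrite vpar_cons h ?mem_head // IH // => B hB; apply: h; rewrite inE hB orbT.
Qed.

(** Sequents are taken up to permutation, unlike in [deriv]; this loses nothing because labels, and
    not positions, record the axiom links. *)
Inductive der : seq lform -> Prop :=
| der_ax l : der [:: LLit true l; LLit false l]
| der_tens A B G H : der (A :: G) -> der (B :: H) -> der (LTens A B :: G ++ H)
| der_par A B G : der (A :: B :: G) -> der (LPar A B :: G)
| der_perm G H : perm_eq G H -> der G -> der H.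

(** Together with [linear] this says that each label that occurs does so exactly once with each
    sign: the labels are a set of axiom links. *)
Definition closed_leaves (s : seq (bool * L)) :=
  forall b l, (b, l) \in s -> (~~ b, l) \in s.

Definition closed G := closed_leaves (sleaves G).

Lemma closed_leaves_cat s t :
  closed_leaves s -> closed_leaves t -> closed_leaves (s ++ t).
Proof.
by move=> hs ht b l; rewrite !mem_cat => /orP[/hs|/ht] ->; rewrite ?orbT.
Qed.

Lemma perm_closed_leaves s t :
  perm_eq s t -> closed_leaves s -> closed_leaves t.
Proof. by move=> /perm_mem e h b l; rewrite -!e; apply: h. Qed.

Lemma der_closed G : der G -> closed G.
Proof.
elim=> {G} [l|A B G H _ IA _ IB|A B G _ IA|G H e _ IG].
- move=> b l'; rewrite !inE !xpair_eqE; case: b => /=;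
  by rewrite ?andbF ?orbF => /eqP->; rewrite ?eqxx ?orbT.
- apply: perm_closed_leaves (closed_leaves_cat IA IB).
  by rewrite !sleaves_cons sleaves_cat /=; perm_lia.
- by rewrite /closed sleaves_cons /= -catA.
- exact: perm_closed_leaves (perm_sleaves e) IG.
Qed.

Definition linear G := uniq (sleaves G).

Lemma perm_linear G H : perm_eq G H -> linear G = linear H.
Proof. by move/perm_sleaves/perm_uniq. Qed.

Lemma linear_catl G H : linear (G ++ H) -> linear G.
Proof. by rewrite /linear sleaves_cat cat_uniq => /and3P[]. Qed.

Lemma linear_catr G H : linear (G ++ H) -> linear H.
Proof. by rewrite /linear sleaves_cat cat_uniq => /and3P[]. Qed.

Lemma linear_notin A G : linear (A :: G) -> A \notin G.
Proof.
rewrite /linear sleaves_cons cat_uniq => /and3P[_ h _].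
apply/negP => AG; move/negP: h; apply; have [a ha] := leaves_gt0 A.
by apply/hasP; exists a => //; apply/sleavesP; exists A.
Qed.

Lemma linear_disjoint G H A B : linear (G ++ H) -> A \in G -> B \in H -> A != B.
Proof.
rewrite /linear sleaves_cat cat_uniq => /and3P[_ h _] AG BH.
apply/negP => /eqP e; subst B; move/negP: h; apply.
have [a ha] := leaves_gt0 A.
by apply/hasP; exists a; apply/sleavesP; exists A.
Qed.

(** Used to choose valuations on the two premises of a tensor rule independently. *)
Definition glue_val G v1 v2 : L -> val3 := fun l =>
  if l \in map snd (sleaves G) then v1 l else v2 l.

Lemma glue_val_sub G v1 v2 A : {subset leaves A <= sleaves G} ->
  val (glue_val G v1 v2) A = val v1 A.
Proof.
move=> sub; apply: eq_val => b l h; rewrite /glue_val.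
by case: ifP => // /mapP[]; exists (b, l) => //; apply: sub.
Qed.

Lemma glue_val1 G v1 v2 A : A \in G -> val (glue_val G v1 v2) A = val v1 A.
Proof. by move=> AG; apply: glue_val_sub => a ha; apply/sleavesP; exists A. Qed.

(** A label shared with H would occur in the closed part G with both signs, so that its leaf in H
    would repeat one of G. *)
Lemma glue_val2 G H v1 v2 A : linear (G ++ H) -> closed G -> A \in H ->
  val (glue_val G v1 v2) A = val v2 A.
Proof.
move=> lin cl AH; apply: eq_val => b l h; rewrite /glue_val.
case: ifP => // /mapP[[b' l'] h' /= e]; subst l'.
have h2 : (b, l) \in sleaves H by apply/sleavesP; exists A.
have h1 : (b, l) \in sleaves G.
  by case: (b =P b') => [->//|]; move: h' (cl _ _ h'); case: b b' {h h2} => [] [].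
move: lin; rewrite /linear sleaves_cat cat_uniq => /and3P[_ /hasPn hn _].
by have /negP[] := hn _ h2.
Qed.

(* Acyclicity of the switchings in terms of valuations: a cycle, once oriented,
   gives a valuation that violates this, with VF and VT at the two ends of the
   axiom links it crosses. *)
Definition acyc G := forall v,
  (forall A, A \in G -> val v A <> VT) -> forall A, A \in G -> val v A = VO.

Lemma perm_acyc G H : perm_eq G H -> acyc G -> acyc H.
Proof.
move=> /perm_mem e h v h1 A; rewrite -e; apply: h => B; rewrite e; exact: h1.
Qed.

Lemma linear_tens A B G H :
  linear (LTens A B :: G ++ H) = linear ((A :: G) ++ (B :: H)).
Proof.
rewrite /linear; apply: perm_uniq.
by rewrite sleaves_cat !sleaves_cons sleaves_cat /=; perm_lia.
Qed.

(* A path from Y to X in a switching, oriented towards X, with the value VF at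
   the end of each link it crosses. *)
Definition conn G := forall X Y, X \in G -> Y \in G -> X != Y ->
  exists v, [/\ val v X = VF, val v Y = VT &
    forall Z, Z \in G -> Z != Y -> val v Z <> VT].

(** [Z0] is the tensor with its arguments in either order, so one statement serves both premises. A
    path across the rule joins one between X and A with one between B and Y, and the tensor gets VT
    ⊗ VF = VF. A path inside the first premise is kept, with VO on the other premise so that the
    tensor has the value of A. *)
Lemma conn_tens A B Z0 G H :
  (forall v, val v Z0 = tens3 (val v A) (val v B)) ->
  closed (A :: G) -> linear ((A :: G) ++ (B :: H)) -> Z0 \notin G ++ H ->
  conn (A :: G) -> conn (B :: H) -> forall X Y,
  X \in Z0 :: G -> Y \in Z0 :: G ++ H -> X != Y -> (X = Z0 -> Y \notin H) ->
  exists v, [/\ val v X = VF, val v Y = VT &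
    forall Z, Z \in Z0 :: G ++ H -> Z != Y -> val v Z <> VT].
Proof.
move=> vZ0 cl lin; rewrite mem_cat negb_or => /andP[ZG ZH] cA cB X Y XG YGH XY XZ.
have nA := linear_notin (linear_catl lin).
have nB := linear_notin (linear_catr lin).
have g1 v1 v2 W : W \in A :: G -> val (glue_val (A :: G) v1 v2) W = val v1 W.
  exact: glue_val1.
have g2 v1 v2 W : W \in B :: H -> val (glue_val (A :: G) v1 v2) W = val v2 W.
  exact: glue_val2.
case: (boolP (Y \in H)) => YH.
  have {}XG : X \in G.
    by move: XG; rewrite inE => /orP[/eqP/XZ|//]; rewrite YH.
  have [|||v1 [v1X v1A h1]] := cA X A; rewrite ?inE ?XG ?orbT ?eqxx //.
    by apply: contraNneq nA => <-.
  have [|||v2 [v2B v2Y h2]] := cB B Y; rewrite ?inE ?YH ?orbT ?eqxx //.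
    by apply: contraNneq nB => ->.
  exists (glue_val (A :: G) v1 v2); split.
  - by rewrite g1 // inE XG orbT.
  - by rewrite g2 // inE YH orbT.
  - move=> Z; rewrite inE mem_cat => /or3P[/eqP->|ZG'|ZH'] ZY.
    + by rewrite vZ0 g1 ?mem_head // g2 ?mem_head // v1A v2B.
    + rewrite g1 ?inE ?ZG' ?orbT //; apply: h1; rewrite ?inE ?ZG' ?orbT //.
      by apply: contraNneq nA => <-.
    + by rewrite g2 ?inE ?ZH' ?orbT //; apply: h2; rewrite ?inE ?ZH' ?orbT.
have {}YGH : Y \in Z0 :: G.
  by move: YGH; rewrite !inE mem_cat (negPf YH) orbF.
(* [u] goes back from the conclusion to the first premise. *)
pose u W := if W == Z0 then A else W.
have uG W : W \in Z0 :: G -> u W \in A :: G.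
  by rewrite /u !inE; case: eqP => //= [_ _|_ ->]; rewrite ?eqxx ?orbT.
have uI W W' : W \in Z0 :: G -> W' \in Z0 :: G -> W != W' -> u W != u W'.
  rewrite /u !inE; case: eqP => [->|_] /=; case: eqP => [->|_] //=; rewrite ?eqxx //.
  - by move=> _ WG _; apply: contraNneq nA => ->.
  - by move=> WG _ _; apply: contraNneq nA => <-.
have [v1 [v1X v1Y h1]] := cA _ _ (uG _ XG) (uG _ YGH) (uI _ _ XG YGH XY).
have vu W : W \in Z0 :: G ->
    val (glue_val (A :: G) v1 (fun=> VO)) W = val v1 (u W).
  move=> WG; rewrite /u; case: eqP => [->|ne].
    by rewrite vZ0 g1 ?mem_head // g2 ?mem_head // val_O; case: (val v1 A).
  by rewrite g1 //; move: WG; rewrite !inE => /orP[/eqP//|->]; rewrite orbT.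
exists (glue_val (A :: G) v1 (fun=> VO)); split; rewrite ?vu // => Z.
rewrite inE mem_cat orbA => /orP[ZG' ZY|ZH' _].
  by rewrite vu ?inE //; apply: h1; [apply: uG | apply: uI]; rewrite ?inE.
by rewrite g2 ?inE ?ZH' ?orbT // val_O.
Qed.

(** At a par the path of the premise ends or starts at the argument A. If it ends there, B is VF or
    VO and the par is still VF; if it starts there, the par is VT as well. *)
Lemma der_conn G : der G -> linear G -> conn G.
Proof.
elim=> {G} [l|A B G H dA IA dB IB|A B G d IA|G H e _ IG].
- move=> _ X Y; rewrite !inE => /orP[]/eqP-> /orP[]/eqP->; rewrite ?eqxx // => _.
    by exists (fun=> VF); split=> // Z; rewrite !inE => /orP[]/eqP->; rewrite ?eqxx.
  by exists (fun=> VT); split=> // Z; rewrite !inE => /orP[]/eqP->; rewrite ?eqxx.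
- move=> lin; have nZ := linear_notin lin.
  rewrite linear_tens in lin.
  have {}IA := IA (linear_catl lin); have {}IB := IB (linear_catr lin).
  have lin' : linear ((B :: H) ++ (A :: G)).
    by rewrite (perm_linear (_ : perm_eq _ ((A :: G) ++ (B :: H)))) // perm_catC.
  move=> X Y XG YG XY.
  have [] : (X \in LTens A B :: G /\ (X = LTens A B -> Y \notin H)) \/
         (X \in LTens A B :: H /\ (X = LTens A B -> Y \notin G)).
  + move: XG; rewrite !inE mem_cat => /or3P[/eqP XZ|XG|XH].
    * have [YH|YH] := boolP (Y \in H); last by left; rewrite XZ eqxx.
      right; rewrite XZ eqxx; split=> // _; apply/negP => YG'.
      have := @linear_disjoint _ _ Y Y lin.
      by rewrite !inE YG' YH !orbT eqxx => /(_ isT isT).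
    * left; rewrite XG orbT; split=> // XZ; move: nZ; rewrite -XZ mem_cat XG //.
    * right; rewrite XH orbT; split=> // XZ; move: nZ; rewrite -XZ mem_cat XH orbT //.
  + case=> XG' XZ.
    exact: conn_tens (der_closed dA) lin nZ IA IB _ _ XG' YG XY XZ.
  + case=> XG' XZ.
    have [|||v [h1 h2 h3]] := conn_tens _ (der_closed dB) lin' _ IB IA XG' _ XY XZ.
    * by move=> v; exact: tens3C.
    * by move: nZ; rewrite !mem_cat orbC.
    * by move: YG; rewrite !inE !mem_cat orbCA orbC orbA.
    * exists v; split=> // Z ZG; apply: h3.
      by move: ZG; rewrite !inE !mem_cat [in X in _ || X]orbC.
- move=> lin; have nP := linear_notin lin.
  have {}lin : linear (A :: B :: G).
    by move: lin; rewrite /linear !sleaves_cons /= -catA.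
  have {}IA := IA lin.
  have nA := linear_notin lin; have nB := linear_notin (linear_catr (G := [:: A]) lin).
  move=> X Y; rewrite !inE => /orP[/eqP->|XG] /orP[/eqP->|YG]; rewrite ?eqxx // => XY.
  + have [|||v [h1 h2 h3]] := IA A Y; rewrite ?inE ?eqxx ?YG ?orbT //.
      by apply: contraNneq nA => ->; rewrite inE YG orbT.
    exists v; split=> //=.
      have := h3 B; rewrite !inE eqxx orbT h1; case: (val v B) => // /(_ isT) [] //.
      by apply: contraNneq nB => ->.
    move=> Z; rewrite inE => /orP[/eqP-> _ /=|ZG]; last by apply: h3; rewrite !inE ZG !orbT.
    have := h3 B; rewrite !inE eqxx orbT h1; case: (val v B) => // /(_ isT) [] //.
    by apply: contraNneq nB => ->.
  + have [|||v [h1 h2 h3]] := IA X A; rewrite ?inE ?eqxx ?XG ?orbT //.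
      by apply: contraNneq nA => <-; rewrite inE XG orbT.
    exists v; split=> //=; first by rewrite h2.
    move=> Z; rewrite inE => /orP[/eqP-> /eqP//|ZG _]; apply: h3; rewrite ?inE ?ZG ?orbT //.
    by apply: contraNneq nA => <-; rewrite inE ZG orbT.
  + have [|||v [h1 h2 h3]] := IA X Y; rewrite ?inE ?XG ?YG ?orbT //.
    exists v; split=> //= Z; rewrite inE => /orP[/eqP-> _ /=|ZG]; last by apply: h3; rewrite !inE ZG !orbT.
    have := h3 A; have := h3 B; rewrite !inE !eqxx !orbT.
    have nYA : A != Y by apply: contraNneq nA => ->; rewrite inE YG orbT.
    have nYB : B != Y by apply: contraNneq nB => ->.
    by move=> /(_ isT nYB) + /(_ isT nYA); case: (val v A) (val v B) => [] [].
- rewrite -(perm_linear e) => /IG h X Y; rewrite -!(perm_mem e) => XG YG XY.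
  have [v [h1 h2 h3]] := h X Y XG YG XY.
  by exists v; split=> // Z; rewrite -(perm_mem e); apply: h3.
Qed.

End Labelled.

(** * Splitting a derivation at a tensor *)

Section Splitting.
Variable L : eqType.
Implicit Types (A B C D P X Y Z : lform L) (G H K M : seq (lform L)).
Implicit Types (v : L -> val3) (m : bool).

(** The flag sets the order of the arguments, so that one proof serves the left and the right
    argument of a tensor. *)
Definition stens m A B := if m then LTens A B else LTens B A.

Lemma val_stens m v A B : val v (stens m A B) = tens3 (val v A) (val v B).
Proof. by case: m => //=; rewrite tens3C. Qed.

Lemma der_stens m A B G H :
  der (A :: G) -> der (B :: H) -> der (stens m A B :: G ++ H).
Proof.
case: m => /= dA dB; first exact: der_tens.
by apply: der_perm (der_tens dB dA); rewrite perm_cons perm_catC.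
Qed.

(* Acyclicity of the sequent A ⊗ (⅋ K), G. *)
Definition acyc_tens A K G := forall v,
  tens3 (val v A) (vpar v K) <> VT -> (forall Z, Z \in G -> val v Z <> VT) ->
  tens3 (val v A) (vpar v K) = VO /\ forall Z, Z \in G -> val v Z = VO.

(* Derivability of A ⊗ (⅋ K), G: a derivation in which the premise containing
   the list K may be turned into any premise, with P instead of K and additional
   context H. *)
Definition der_tens_par m A K G := forall P H,
  (forall M, der (K ++ M) -> der (P :: H ++ M)) -> der (stens m A P :: H ++ G).

Lemma perm_acyc_tens A K K' G G' : perm_eq K K' -> perm_eq G G' ->
  acyc_tens A K G -> acyc_tens A K' G'.
Proof.
move=> eK /perm_mem eG h v; rewrite -(perm_vpar _ eK) => vA vG.
have [|h1 h2] := h v vA; first by move=> Z; rewrite eG; apply: vG.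
by split=> // Z; rewrite -eG; apply: h2.
Qed.

Lemma perm_der_tens_par m A K K' G G' : perm_eq K K' -> perm_eq G G' ->
  der_tens_par m A K G -> der_tens_par m A K' G'.
Proof.
move=> eK eG h P H hP; apply: (@der_perm _ (stens m A P :: H ++ G)).
  by rewrite perm_cons perm_cat2l.
apply: h => M d; apply: hP; apply: der_perm d.
by rewrite perm_cat2r.
Qed.

Lemma tens3_eqO x y : tens3 x y = VO -> x = VO /\ y = VO.
Proof. by case: x y => [] []. Qed.

Lemma par3_eqO x y : par3 x y = VO -> x = VO /\ y = VO.
Proof. by case: x y => [] []. Qed.

(** For VF and VT the valuation is a path between Y and one member of K, in the direction that x
    prescribes; for VO it is constant. *)
Lemma conn_val Y K G x : conn (Y :: K ++ G) -> linear (Y :: K ++ G) ->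
  K != [::] -> exists v, [/\ vpar v K = x, val v Y = dual3 x &
    forall Z, Z \in G -> val v Z <> VT].
Proof.
move=> c lin; case: K c lin => // X K c lin _.
have XY : X != Y by apply: contraNneq (linear_notin lin) => <-; rewrite mem_head.
have XY' : Y != X by rewrite eq_sym.
have memX : X \in Y :: (X :: K) ++ G by rewrite !inE eqxx orbT.
have nG Z W : Z \in G -> W \in Y :: X :: K -> Z != W.
  move=> ZG WK; apply: contraTneq WK => <-; apply/negP => ZK.
  by have := @linear_disjoint _ (Y :: X :: K) G Z Z lin ZK ZG; rewrite eqxx.
case: x.
- have [v [h1 h2 h3]] := c X Y memX (mem_head _ _) XY.
  exists v; split=> //.
  + apply: (@vparF _ _ X); rewrite ?mem_head // => B BK; apply: h3.
      by rewrite inE mem_cat BK orbT.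
    by apply: contraNneq (linear_notin lin) => <-; rewrite mem_cat BK.
  + move=> Z ZG; apply: h3; first by rewrite inE mem_cat ZG !orbT.
    by apply: nG; rewrite ?mem_head.
- exists (fun=> VO); split; rewrite ?val_O //.
    by apply: vparO => B _; rewrite val_O.
  by move=> Z _; rewrite val_O.
- have [v [h1 h2 h3]] := c Y X (mem_head _ _) memX XY'.
  exists v; split=> //; first by apply: (@vparT _ _ X); rewrite ?mem_head.
  move=> Z ZG; apply: h3; first by rewrite inE mem_cat ZG !orbT.
  by apply: nG; rewrite ?inE ?eqxx ?orbT.
Qed.

Section TensorStep.
Variables (m : bool) (X Y Z : lform L) (E F : seq (lform L)).
Hypothesis valZ : forall v, val v Z = tens3 (val v X) (val v Y).
Hypothesis derZ : forall G H, der (X :: G) -> der (Y :: H) -> der (Z :: G ++ H).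
Hypothesis derX : der (X :: E).
Hypothesis derY : der (Y :: F).
Hypothesis lin : linear ((X :: E) ++ (Y :: F)).
Hypothesis IH : forall A B K G, perm_eq (X :: E) (stens m A B :: K ++ G) ->
  acyc_tens A (B :: K) G -> der_tens_par m A (B :: K) G.

Section Valuations.
Variables (A B : lform L) (K1 G1 K2 G2 : seq (lform L)) (v v' : L -> val3).
Hypothesis eE : perm_eq (X :: E) (stens m A B :: X :: K1 ++ G1).
Hypothesis eF : perm_eq F (K2 ++ G2).
Let w := glue_val (X :: E) v v'.

Lemma step_val1 W : W \in X :: K1 ++ G1 -> val w W = val v W.
Proof using eE.
by move=> h; apply: glue_val1; rewrite (perm_mem eE) inE h orbT.
Qed.

Lemma step_val2 W : W \in Y :: K2 ++ G2 -> val w W = val v' W.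
Proof using eF derX lin.
move=> h; apply: glue_val2 lin _ _; first exact: der_closed.
by move: h; rewrite !inE (perm_mem eF).
Qed.

Lemma step_vpar : vpar w (B :: K1 ++ K2)
  = par3 (vpar v (B :: K1)) (vpar v' K2).
Proof using eE eF derX lin.
rewrite -cat_cons vpar_cat !vpar_cons; congr par3; last first.
  by apply: eq_vpar => C hC; rewrite step_val2 // inE mem_cat hC orbT.
congr par3; last first.
  by apply: eq_vpar => C hC; rewrite step_val1 // inE mem_cat hC orbT.
apply: glue_val_sub => a ha; apply/sleavesP; exists (stens m A B).
  by rewrite (perm_mem eE) mem_head.
by case: (m); rewrite /= mem_cat ha ?orbT.
Qed.

Lemma step_valA : val w A = val v A.
Proof using eE.
apply: glue_val_sub => a ha; apply/sleavesP; exists (stens m A B).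
  by rewrite (perm_mem eE) mem_head.
by case: (m); rewrite /= mem_cat ha ?orbT.
Qed.

Lemma step_valZ : val w Z = tens3 (val v X) (val v' Y).
Proof using eE eF derX lin valZ.
by rewrite valZ step_val1 ?step_val2 ?mem_head.
Qed.

End Valuations.

(** The last rule introduces Z = X ⊗ Y in the context, and A ⊗ B lies in the premise of X. If all of
    K lies there too, X stays in the context. Otherwise the rest of K is reached through X, which
    joins K in the premise. *)
Lemma tens_step_ctx A B E' K G :
  perm_eq E (stens m A B :: E') -> perm_eq (E' ++ F) (K ++ G) ->
  acyc_tens A (B :: K) (Z :: G) -> der_tens_par m A (B :: K) (Z :: G).
Proof using valZ derZ derX derY lin IH.
move=> eE /perm_cat_split[K1 [G1 [K2 [G2 [e1 e2 e3 e4]]]]] ac.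
have eXE : perm_eq (X :: E) (stens m A B :: X :: K1 ++ G1) by perm_lia.
have {}ac : acyc_tens A (B :: K1 ++ K2) (Z :: G1 ++ G2).
  by apply: perm_acyc_tens ac; rewrite perm_cons.
apply: (@perm_der_tens_par _ _ (B :: K1 ++ K2) _ (Z :: G1 ++ G2)).
- by rewrite perm_cons perm_sym.
- by rewrite perm_cons perm_sym.
have [K20|K20] := eqVneq K2 [::].
  have {}ac : acyc_tens A (B :: K1) (X :: G1).
    move=> v vA vG; pose w := glue_val (X :: E) v (fun=> VO).
    have wK : vpar w (B :: K1 ++ K2) = vpar v (B :: K1).
      rewrite (step_vpar _ _ eXE e2) K20 {2}/vpar big_nil.
      by case: (vpar v _).
    have wZ : val w Z = val v X.
      by rewrite (step_valZ _ _ eXE e2) val_O; case: (val v X).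
    have [||h1 h2] := ac w; rewrite ?wK ?(step_valA _ _ eXE) //.
      move=> W; rewrite inE mem_cat => /or3P[/eqP->|h|h].
      + by rewrite wZ; apply: vG; rewrite mem_head.
      + rewrite (step_val1 _ _ eXE) ?inE ?mem_cat ?h ?orbT //.
        by apply: vG; rewrite inE h orbT.
      + by rewrite (step_val2 _ _ e2) ?val_O // inE mem_cat h !orbT.
    rewrite wK (step_valA _ _ eXE) in h1; split=> // W WG.
    move: WG; rewrite inE => /orP[/eqP->|h]; first by rewrite -wZ h2 ?mem_head.
    rewrite -(h2 W) ?inE ?mem_cat ?h ?orbT // (step_val1 _ _ eXE) //.
    by rewrite inE mem_cat h !orbT.
  have h : der_tens_par m A (B :: K1) (X :: G1) by apply: IH => //; perm_lia.
  move=> P H hP; rewrite K20 cats0 in hP.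
  have d1 : der (X :: stens m A P :: H ++ G1).
    by apply: der_perm (h P H hP); perm_lia.
  by apply: der_perm (derZ d1 derY); rewrite K20 in e2 *; perm_lia.
have {}ac : acyc_tens A (B :: X :: K1) G1.
  move=> v vA vG.
  have lin2 : linear (Y :: K2 ++ G2).
    rewrite -(perm_linear (_ : perm_eq (Y :: F) _)) ?perm_cons //.
    exact: linear_catr lin.
  have c2 : conn (Y :: K2 ++ G2).
    apply: der_conn lin2; apply: der_perm derY; by rewrite perm_cons.
  (* The part of K in the other premise gets the value of X, while Z gets that value tensored with
     its dual, which is never VT. *)
  have [v' [h1 h2 h3]] := conn_val (val v X) c2 lin2 K20.
  pose w := glue_val (X :: E) v v'.
  have wK : vpar w (B :: K1 ++ K2) = vpar v (B :: X :: K1).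
    rewrite (step_vpar _ _ eXE e2) h1 !vpar_cons -par3A; congr par3.
    by rewrite par3C.
  have [||k1 k2] := ac w; rewrite ?wK ?(step_valA _ _ eXE) //.
    move=> W; rewrite inE mem_cat => /or3P[/eqP->|h|h].
    + by rewrite (step_valZ _ _ eXE e2) h2; case: (val v X).
    + rewrite (step_val1 _ _ eXE) ?inE ?mem_cat ?h ?orbT //.
      exact: vG.
    + rewrite (step_val2 _ _ e2) ?inE ?mem_cat ?h ?orbT //.
      exact: h3.
  rewrite wK (step_valA _ _ eXE) in k1; split=> // W WG.
  rewrite -(k2 W) ?inE ?mem_cat ?WG ?orbT // (step_val1 _ _ eXE) //.
  by rewrite inE mem_cat WG !orbT.
have h : der_tens_par m A (B :: X :: K1) G1 by apply: IH => //; perm_lia.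
move=> P H hP.
(* The additional context of [der_tens_par] carries Z and the part of G in the other premise. *)
have {}h := h P (H ++ Z :: G2).
apply: der_perm (h _); first perm_lia.
move=> M d.
have d1 : der (X :: B :: K1 ++ M) by apply: der_perm d; perm_lia.
have d2 := hP (Z :: G2 ++ M).
apply: der_perm (d2 _); first perm_lia.
by apply: der_perm (derZ d1 derY); perm_lia.
Qed.

(** Here Z itself belongs to the par, and X takes its place in the premise; with VO on the other
    premise Z has the value of X. *)
Lemma tens_step_par A B E' K G :
  perm_eq E (stens m A B :: E') -> perm_eq (E' ++ F) (K ++ G) ->
  acyc_tens A (B :: Z :: K) G -> der_tens_par m A (B :: Z :: K) G.
Proof using valZ derZ derX derY lin IH.
move=> eE /perm_cat_split[K1 [G1 [K2 [G2 [e1 e2 e3 e4]]]]] ac.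
have eXE : perm_eq (X :: E) (stens m A B :: X :: K1 ++ G1) by perm_lia.
have eZ : perm_eq (B :: Z :: K) (Z :: B :: K1 ++ K2) by perm_lia.
have {}ac := perm_acyc_tens eZ e4 ac.
apply: (@perm_der_tens_par _ _ (Z :: B :: K1 ++ K2) _ (G1 ++ G2)).
- by rewrite perm_sym.
- by rewrite perm_sym.
have {}ac : acyc_tens A (B :: X :: K1) G1.
  move=> v vA vG; pose w := glue_val (X :: E) v (fun=> VO).
  have wK : vpar w (Z :: B :: K1 ++ K2) = vpar v (B :: X :: K1).
    rewrite vpar_cons (step_vpar _ _ eXE e2) (step_valZ _ _ eXE e2) val_O.
    rewrite [vpar _ K2]vparO; last by move=> C _; rewrite val_O.
    by rewrite !vpar_cons; case: (val v X) (val v B) (vpar v K1) => [] [] [].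
  have [||k1 k2] := ac w; rewrite ?wK ?(step_valA _ _ eXE) //.
    move=> W; rewrite mem_cat => /orP[h|h].
    + rewrite (step_val1 _ _ eXE) ?inE ?mem_cat ?h ?orbT //.
      exact: vG.
    + by rewrite (step_val2 _ _ e2) ?val_O ?inE ?mem_cat ?h ?orbT.
  rewrite wK (step_valA _ _ eXE) in k1; split=> // W WG.
  rewrite -(k2 W) ?mem_cat ?WG // (step_val1 _ _ eXE) //.
  by rewrite inE mem_cat WG !orbT.
have h : der_tens_par m A (B :: X :: K1) G1 by apply: IH => //; perm_lia.
move=> P H hP.
apply: der_perm (h P (H ++ G2) _); first perm_lia.
move=> M d.
have d1 : der (X :: B :: K1 ++ M) by apply: der_perm d; perm_lia.
apply: der_perm (hP (G2 ++ M) _); first perm_lia.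
by apply: der_perm (derZ d1 derY); perm_lia.
Qed.

End TensorStep.

(** The last rule introduces A ⊗ B, so K must lie in the premise of B, which is then replaced by one
    for P. A member Y of K in the premise of A would close a cycle: the path between Y and A makes
    A, hence the tensor, VF while no member of G is VT. *)
Lemma principal_step m A B E F K G : der (A :: E) -> der (B :: F) ->
  linear ((A :: E) ++ (B :: F)) -> perm_eq (E ++ F) (K ++ G) ->
  acyc_tens A (B :: K) G -> der_tens_par m A (B :: K) G.
Proof.
move=> dA dB lin /perm_cat_split[K1 [G1 [K2 [G2 [e1 e2 e3 e4]]]]] ac.
have [K10|K10] := eqVneq K1 [::].
  move=> P H hP.
  have d1 : der (P :: H ++ G2).
    by apply: hP; apply: der_perm dB; rewrite K10 in e3; perm_lia.
  by apply: der_perm (der_stens m dA d1); rewrite K10 in e1; perm_lia.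
exfalso.
have {e3}[Y YK1] : exists Y, Y \in K1.
  by case: (K1) K10 => // Y M _; exists Y; rewrite mem_head.
have linA := linear_catl lin.
have YE : Y \in E by rewrite (perm_mem e1) mem_cat YK1.
have [|||v [h1 h2 h3]] := der_conn dA linA (X := A) (Y := Y); rewrite ?mem_head //.
- by rewrite inE YE orbT.
- by apply: contraNneq (linear_notin linA) => ->.
pose w := glue_val (A :: E) v (fun=> VO).
have w1 W : W \in A :: E -> val w W = val v W by exact: glue_val1.
have w2 W : W \in B :: F -> val w W = VO.
  by move=> h; rewrite (glue_val2 _ _ lin) ?val_O //; apply: der_closed.
have [||k1 k2] := ac w.
- by rewrite w1 ?mem_head // h1; case: (vpar _ _).
- move=> W WG.
  have WEF : W \in E ++ F.
    by rewrite mem_cat (perm_mem e1) (perm_mem e2) !mem_cat -!orbA; 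
       move: WG; rewrite (perm_mem e4) mem_cat => /orP[]->; rewrite ?orbT.
  have [WE|WE] := boolP (W \in E).
    rewrite w1 ?inE ?WE ?orbT //; apply: h3; rewrite ?inE ?WE ?orbT //.
    apply: contraTneq WG => ->; apply/negP => YG.
    have linE : linear (E ++ F).
      move: lin; rewrite -linear_tens; exact: (@linear_catr _ [:: _]).
    move: YG; rewrite (perm_mem e4) mem_cat => /orP[YG1|YG2].
      move: (linear_catl linE); rewrite (perm_linear e1) => linK.
      by have := linear_disjoint linK YK1 YG1; rewrite eqxx.
    have YF : Y \in F by rewrite (perm_mem e2) mem_cat YG2 orbT.
    by have := linear_disjoint linE YE YF; rewrite eqxx.
  have WF : W \in F by move: WEF; rewrite mem_cat (negPf WE).
  by rewrite w2 ?inE ?WF ?orbT.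
- by move: k1; rewrite w1 ?mem_head // h1; case: (vpar _ _).
Qed.

Lemma stensE m A B C D : stens m A B = LTens C D ->
  (m /\ A = C /\ B = D) \/ (~~ m /\ A = D /\ B = C).
Proof. by case: m => -[-> ->]; [left|right]. Qed.

(** The induction needs a list K and an arbitrary replacement P: a premise may contain only a part
    of K, together with arguments X that stand for the part left behind in another premise. *)
Lemma der_split m G0 : der G0 -> linear G0 -> forall A B K G,
  perm_eq G0 (stens m A B :: K ++ G) -> acyc_tens A (B :: K) G ->
  der_tens_par m A (B :: K) G.
Proof.
elim=> {G0} [l|X Y E F dX IX dY IY|X Y E d IH|G0 H e _ IG] lin A B K G eG ac.
- have := perm_mem eG (stens m A B); rewrite mem_head !inE.
  by case: (m) => /= /orP[]/eqP.
- have linXY : linear ((X :: E) ++ (Y :: F)) by rewrite -linear_tens.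
  have linYX : linear ((Y :: F) ++ (X :: E)).
    by rewrite (perm_linear (_ : perm_eq _ ((X :: E) ++ (Y :: F)))) // perm_catC.
  have {}IX := IX (linear_catl linXY); have {}IY := IY (linear_catr linXY).
  have derYX G1 G2 : der (Y :: G1) -> der (X :: G2) ->
      der (LTens X Y :: G1 ++ G2).
    by move=> d1 d2; apply: der_perm (der_tens d2 d1); perm_lia.
  have valYX v : val v (LTens X Y) = tens3 (val v Y) (val v X) by exact: tens3C.
  have valXY v : val v (LTens X Y) = tens3 (val v X) (val v Y) by [].
  have [[/stensE[[_ [? ?]]|[_ [? ?]]] e]|[t et eEF]] := perm_cons2 eG.
  + by subst; apply: principal_step dX dY linXY e ac.
  + by subst; apply: principal_step dY dX linYX _ ac; perm_lia.
  + have [[E' eE eE2]|[F' eF eF2]] := perm_cat_cons eEF;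
      have [[K' eK eK2]|[G' eG' eG2]] := perm_cat_cons et.
    * apply: (@perm_der_tens_par m A (B :: LTens X Y :: K') _ G) => //.
        by rewrite perm_cons perm_sym.
      apply: (tens_step_par valXY (@der_tens _ X Y) dX dY linXY IX eE).
        by apply: perm_trans eE2 _; rewrite perm_sym.
      by apply: perm_acyc_tens ac; rewrite ?perm_cons.
    * apply: (@perm_der_tens_par m A (B :: K) _ (LTens X Y :: G')) => //.
        by rewrite perm_sym.
      apply: (tens_step_ctx valXY (@der_tens _ X Y) dX dY linXY IX eE).
        by apply: perm_trans eE2 _; rewrite perm_sym.
      exact: perm_acyc_tens ac.
    * apply: (@perm_der_tens_par m A (B :: LTens X Y :: K') _ G) => //.
        by rewrite perm_cons perm_sym.
      apply: (tens_step_par valYX derYX dY dX linYX IY eF); first perm_lia.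
      by apply: perm_acyc_tens ac; rewrite ?perm_cons.
    * apply: (@perm_der_tens_par m A (B :: K) _ (LTens X Y :: G')) => //.
        by rewrite perm_sym.
      apply: (tens_step_ctx valYX derYX dY dX linYX IY eF); first perm_lia.
      exact: perm_acyc_tens ac.
- have {}IH := IH _ A B.
  have linXY : linear (X :: Y :: E) by move: lin; rewrite /linear !sleaves_cons /= -catA.
  have {}IH := IH linXY.
  have [[st _]|[t et eE]] := perm_cons2 eG; first by move: st; case: (m).
  have [[K' eK eK2]|[G' eG' eG2]] := perm_cat_cons et.
  + have eKs : perm_eq (B :: K) (LPar X Y :: B :: K') by perm_lia.
    have h : der_tens_par m A (B :: X :: Y :: K') G.
      apply: IH; first perm_lia.
      move=> v vA vG; suff e : vpar v (B :: X :: Y :: K') = vpar v (B :: K).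
        by rewrite e in vA *; apply: ac.
      rewrite (perm_vpar _ eKs) !vpar_cons /=.
      by rewrite ![par3 (val v B) _]par3C -!par3A.
    move=> P H hP; apply: h => M dM; apply: hP.
    apply: (@der_perm _ (LPar X Y :: B :: K' ++ M)); first perm_lia.
    by apply: der_par; apply: der_perm dM; perm_lia.
  + have h : der_tens_par m A (B :: K) (X :: Y :: G').
      apply: IH; first perm_lia.
      move=> v vA vG; have [||h1 h2] := ac v => //.
        move=> Z; rewrite (perm_mem eG') inE => /orP[/eqP->|ZG] /=; last first.
          by apply: vG; rewrite !inE ZG !orbT.
        have := vG X (mem_head _ _); have := vG Y; rewrite !inE eqxx orbT.
        by move/(_ isT); case: (val v X) (val v Y) => [] [].
      split=> // Z; have := h2 (LPar X Y); rewrite (perm_mem eG') mem_head /=.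
      move=> /(_ isT)/par3_eqO[hX hY]; rewrite !inE => /or3P[/eqP->//|/eqP->//|ZG].
      by apply: h2; rewrite (perm_mem eG') inE ZG orbT.
    move=> P H hP; have {}h := h P H hP.
    apply: (@der_perm _ (LPar X Y :: stens m A P :: H ++ G')); first perm_lia.
    by apply: der_par; apply: der_perm h; perm_lia.
- apply: IG => //; first by rewrite (perm_linear e).
  exact: perm_trans eG.
Qed.

End Splitting.

(** * Undoing a linear distribution in a derivation *)

Section Sequentialisation.
Variable L : eqType.
Implicit Types (A B C D P X Y Z : lform L) (E F G H K M : seq (lform L)).
Implicit Types (v : L -> val3) (m : bool).

(* [dist A A']: A is obtained from A' by a linear distribution below tensors. *)
Inductive dist : lform L -> lform L -> Prop :=
| dist_here m A B C : dist (LPar (stens m A B) C) (stens m A (LPar B C))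
| dist_tens m A A' B : dist A A' -> dist (stens m A B) (stens m A' B).

(** Linear distribution is an inequality A ⊗ (B ⅋ C) ≤ (A ⊗ B) ⅋ C of truth values, and a compound
    value is VO only if both arguments are; hence acyclicity passes from A' to A. *)
Lemma dist_val A A' v : dist A A' ->
  (val v A' = VT -> val v A = VT) /\ (val v A' = VO -> val v A = VO).
Proof.
elim=> {A A'} [m A B C|m A A' B _ [h1 h2]]; rewrite /= !val_stens /=.
  by case: (val v A) (val v B) (val v C) => [] [] [].
by case: (val v A') (val v A) (val v B) h1 h2 => [] [] [] // h1 h2;
  first [by have := h1 erefl | by have := h2 erefl].
Qed.

Lemma leaves_stens m A B : perm_eq (leaves (stens m A B)) (leaves A ++ leaves B).
Proof. by case: m => //=; rewrite perm_catC. Qed.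

Lemma dist_leaves A A' : dist A A' -> perm_eq (leaves A) (leaves A').
Proof.
elim=> {A A'} [m A B C|m A A' B _ e] /=.
  have e1 := leaves_stens m A B; have := leaves_stens m A (LPar B C) => /= e2.
  perm_lia.
have e1 := leaves_stens m A B; have e2 := leaves_stens m A' B; perm_lia.
Qed.

Lemma dist_acyc A A' G : dist A A' -> acyc (A' :: G) -> acyc (A :: G).
Proof.
move=> d h v vG; have [hT hO] := dist_val v d.
have h' : forall Z, Z \in A' :: G -> val v Z = VO.
  apply: h => Z; rewrite inE => /orP[/eqP-> /hT|ZG]; first by apply: vG; rewrite mem_head.
  by apply: vG; rewrite inE ZG orbT.
move=> Z; rewrite inE => /orP[/eqP->|ZG]; last by apply: h'; rewrite inE ZG orbT.
by apply: hO; apply: h'; rewrite mem_head.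
Qed.

Lemma dist_par A B P : dist (LPar A B) P ->
  exists m C D, A = stens m C D /\ P = stens m C (LPar D B).
Proof.
move e : (LPar A B) => S d; case: d e => [m' C D E0|m' C C' D _].
  by case=> -> ->; exists m', C, D.
by case: m'.
Qed.

Lemma dist_lit b l P : ~ dist (LLit b l) P.
Proof.
move e : (LLit b l) => S d; case: d e => [m' C D E0|m' C C' D _] //.
by case: m'.
Qed.

Lemma dist_tensE A B P : dist (LTens A B) P ->
  exists m C C' D, [/\ dist C C', P = stens m C' D & LTens A B = stens m C D].
Proof.
move e : (LTens A B) => S d; case: d e => [m' C D E0|m' C C' D d] // e.
by exists m', C, C', D.
Qed.

(** VO on the other premise gives Z the value of X. Only the leaves of G matter, because X :: K is
    the premise G with one formula changed by a distribution. *)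
Lemma acyc_premise G X Y Z F K : closed G -> linear (G ++ (Y :: F)) ->
  (forall W, W \in X :: K -> {subset leaves W <= sleaves G}) ->
  (forall v, val v Z = tens3 (val v X) (val v Y)) ->
  acyc (Z :: K ++ F) -> acyc (X :: K).
Proof.
move=> cl lin sub valZ ac v vG; pose w := glue_val G v (fun=> VO).
have w1 W : W \in X :: K -> val w W = val v W by move=> h; apply/glue_val_sub/sub.
have w2 W : W \in Y :: F -> val w W = VO by move=> h; rewrite (glue_val2 _ _ lin) ?val_O.
have wZ : val w Z = val v X.
  by rewrite valZ w1 ?mem_head // w2 ?mem_head //; case: (val v X).
have {}ac : forall W, W \in Z :: K ++ F -> val w W = VO.
  apply: ac => W; rewrite inE mem_cat => /or3P[/eqP->|h|h].
  - by rewrite wZ; apply: vG; rewrite mem_head.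
  - by rewrite w1 ?inE ?h ?orbT //; apply: vG; rewrite inE h orbT.
  - by rewrite w2 // inE h orbT.
move=> W; rewrite inE => /orP[/eqP->|h]; first by rewrite -wZ ac ?mem_head.
by rewrite -w1 ?inE ?h ?orbT // ac // inE mem_cat h orbT.
Qed.

Lemma acyc_par X Y K : acyc (LPar X Y :: K) -> acyc (X :: Y :: K).
Proof.
move=> ac v vG; have {}ac : forall W, W \in LPar X Y :: K -> val v W = VO.
  apply: ac => W; rewrite inE => /orP[/eqP-> /=|h]; last by apply: vG; rewrite !inE h !orbT.
  have := vG X (mem_head _ _); have := vG Y; rewrite !inE eqxx orbT => /(_ isT).
  by case: (val v X) (val v Y) => [] [].
have /par3_eqO[hX hY] := ac _ (mem_head _ _).
by move=> W; rewrite !inE => /or3P[/eqP->//|/eqP->//|h]; apply: ac; rewrite inE h orbT.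
Qed.

Lemma sub_sleaves W G : W \in G -> {subset leaves W <= sleaves G}.
Proof. by move=> h a ha; apply/sleavesP; exists W. Qed.

Lemma linearC G H : linear (G ++ H) = linear (H ++ G).
Proof. by apply: perm_linear; rewrite perm_catC. Qed.

Lemma der_dist_tens_ctx X Y Z E F A A' E' G :
  (forall v, val v Z = tens3 (val v X) (val v Y)) ->
  (forall G H, der (X :: G) -> der (Y :: H) -> der (Z :: G ++ H)) ->
  der (X :: E) -> der (Y :: F) -> linear ((X :: E) ++ (Y :: F)) ->
  (forall A A' G, perm_eq (X :: E) (A :: G) -> dist A A' -> acyc (A' :: G) ->
    der (A' :: G)) ->
  perm_eq E (A :: E') -> perm_eq (Z :: E' ++ F) G -> dist A A' ->
  acyc (A' :: G) -> der (A' :: G).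
Proof.
move=> valZ derZ dX dY lin IH eE eG d ac.
have {}ac : acyc (Z :: (A' :: E') ++ F) by apply: perm_acyc ac; perm_lia.
have h : der (A' :: X :: E').
  apply: (IH A) => //; first perm_lia.
  suff : acyc (X :: A' :: E') by apply: perm_acyc; perm_lia.
  apply: acyc_premise (der_closed dX) lin _ valZ ac => W.
  rewrite !inE => /or3P[/eqP->|/eqP->|h].
  - by apply: sub_sleaves; rewrite mem_head.
  - move=> a; rewrite -(perm_mem (dist_leaves d)); apply: sub_sleaves.
    by rewrite inE (perm_mem eE) mem_head orbT.
  - by apply: sub_sleaves; rewrite inE (perm_mem eE) inE h !orbT.
have {}h : der (X :: A' :: E') by apply: der_perm h; perm_lia.
by apply: der_perm (derZ _ _ h dY); perm_lia.
Qed.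

Lemma der_dist_tens_here X Y X' Z' E F A G :
  (forall v, val v Z' = tens3 (val v X') (val v Y)) ->
  (forall G H, der (X' :: G) -> der (Y :: H) -> der (Z' :: G ++ H)) ->
  der (X :: E) -> der (Y :: F) -> linear ((X :: E) ++ (Y :: F)) ->
  (forall A A' G, perm_eq (X :: E) (A :: G) -> dist A A' -> acyc (A' :: G) ->
    der (A' :: G)) ->
  perm_eq (E ++ F) G -> dist X X' -> acyc (Z' :: G) -> der (Z' :: G).
Proof.
move=> valZ derZ dX dY lin IH eG d ac.
have {}ac : acyc (Z' :: E ++ F) by apply: perm_acyc ac; perm_lia.
have h : der (X' :: E).
  apply: (IH X) => //; apply: acyc_premise (der_closed dX) lin _ valZ ac => W.
  rewrite inE => /orP[/eqP->|h].
    move=> a; rewrite -(perm_mem (dist_leaves d)); apply: sub_sleaves.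
    by rewrite mem_head.
  by apply: sub_sleaves; rewrite inE h orbT.
by apply: der_perm (derZ _ _ h dY); perm_lia.
Qed.

(** The distribution commutes with every rule except the one that introduces the par it has moved
    outwards; there [der_split] is needed. *)
Lemma der_dist G0 : der G0 -> linear G0 -> forall A A' G,
  perm_eq G0 (A :: G) -> dist A A' -> acyc (A' :: G) -> der (A' :: G).
Proof.
elim=> {G0} [l|X Y E F dX IX dY IY|X Y E d IH|G0 H e _ IG] lin A A' G eG dA ac.
- have := perm_mem eG A; rewrite mem_head !inE.
  by move=> /orP[]/eqP e; move: dA; rewrite e => /dist_lit.
- have linXY : linear ((X :: E) ++ (Y :: F)) by rewrite -linear_tens.
  have linYX : linear ((Y :: F) ++ (X :: E)) by rewrite linearC.
  have {}IX := IX (linear_catl linXY); have {}IY := IY (linear_catr linXY).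
  have derYX G1 G2 : der (Y :: G1) -> der (X :: G2) ->
      der (LTens X Y :: G1 ++ G2).
    by move=> d1 d2; apply: der_perm (der_tens d2 d1); perm_lia.
  have [[eA eEF]|[t et eEF]] := perm_cons2 eG.
  + rewrite eA in dA; have [m [C [C' [D [dC eA' eXY]]]]] := dist_tensE dA.
    case: m eA' eXY => /= ? [? ?]; subst.
    * apply: (@der_dist_tens_here C D C' _ E F) => //; exact: der_tens.
    * apply: (@der_dist_tens_here C D C' _ F E) => //.
      - by move=> v /=; rewrite tens3C.
      - by move=> G1 G2 d1 d2; apply: der_perm (der_tens d2 d1); perm_lia.
      - perm_lia.
  + have [[E' eE eE2]|[F' eF eF2]] := perm_cat_cons eEF.
    * apply: (@der_dist_tens_ctx X Y (LTens X Y) E F A A' E') => //.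
        exact: der_tens.
      perm_lia.
    * apply: (@der_dist_tens_ctx Y X (LTens X Y) F E A A' F') => //.
        by move=> v /=; rewrite tens3C.
      perm_lia.
- have linXY : linear (X :: Y :: E).
    by move: lin; rewrite /linear !sleaves_cons /= -catA.
  have {}IH := IH linXY.
  have [[eA eE]|[t et eE]] := perm_cons2 eG.
  + rewrite eA in dA; have [m [C [D [eX eA']]]] := dist_par dA; subst.
    (* Later instantiated with P = D ⅋ Y, whose par rule is exactly the required replacement of the
       premise. *)
    have h : der_tens_par m C [:: D; Y] E.
      apply: (der_split d linXY) => // v vA vG.
      have vE : vpar v [:: D; Y] = val v (LPar D Y).
        by rewrite !vpar_cons /vpar big_nil /=; case: (val v D) (val v Y) => [] [].
      rewrite vE -(val_stens m) in vA *.
      have {}ac : forall Z, Z \in stens m C (LPar D Y) :: G -> val v Z = VO.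
        apply: ac => Z; rewrite inE => /orP[/eqP->//|h].
        by apply: vG; rewrite (perm_mem eE).
      split; first by apply: ac; rewrite mem_head.
      by move=> Z ZE; apply: ac; rewrite inE -(perm_mem eE) ZE orbT.
    have := h (LPar D Y) [::] (fun M => @der_par _ D Y M).
    by apply: der_perm; rewrite perm_cons.
  + have {}ac : acyc (A' :: X :: Y :: t).
      suff : acyc (X :: Y :: A' :: t) by apply: perm_acyc; perm_lia.
      by apply: acyc_par; apply: perm_acyc ac; perm_lia.
    have h : der (A' :: X :: Y :: t) by apply: (IH A) => //; perm_lia.
    have {}h : der (X :: Y :: A' :: t) by apply: der_perm h; perm_lia.
    by apply: der_perm (der_par h); perm_lia.
- apply: IG dA ac; first by rewrite (perm_linear e).
  exact: perm_trans eG.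
Qed.

End Sequentialisation.

(** * Sequentialisation by counting tensors *)

Section Main.
Variable L : eqType.
Implicit Types (A B C D P X Y Z : lform L) (E F G H K M : seq (lform L)).

Fixpoint ntens A : nat :=
  match A with
  | LLit _ _ => 0
  | LTens A B => (ntens A + ntens B).+1
  | LPar A B => ntens A + ntens B
  end.

Fixpoint npar A : nat :=
  match A with
  | LLit _ _ => 0
  | LTens A B => npar A + npar B
  | LPar A B => (npar A + npar B).+1
  end.

(* The number of pairs formed by a tensor and a par inside one of its arguments:
   it decreases when a par is moved out of a tensor. *)
Fixpoint nbelow A : nat :=
  match A with
  | LLit _ _ => 0
  | LTens A B => nbelow A + nbelow B + npar A + npar B
  | LPar A B => nbelow A + nbelow B
  end.

Definition total (f : lform L -> nat) G := sumn (map f G).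

Lemma perm_total f G H : perm_eq G H -> total f G = total f H.
Proof. by move=> e; apply/perm_sumn/perm_map. Qed.

Lemma total_cat f G H : total f (G ++ H) = total f G + total f H.
Proof. by rewrite /total map_cat sumn_cat. Qed.

(** Derivability with the mix rule, where n counts the derivations put side by side. *)
Inductive forest : nat -> seq (lform L) -> Prop :=
| forest0 : forest 0 [::]
| forestS n G H : der G -> forest n H -> forest n.+1 (G ++ H)
| forest_perm n G H : perm_eq G H -> forest n G -> forest n H.

Lemma forest_pick n G A : forest n G -> A \in G -> exists n' H K,
  [/\ n = n'.+1, der (A :: H), forest n' K & perm_eq G (A :: H ++ K)].
Proof.
move=> f; elim: f => {n G} [//|n G H d f IH|n G H e f IH].
  rewrite mem_cat; case: (boolP (A \in G)) => [AG _|_ /= /IH].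
    have e := perm_to_rem AG.
    by exists n, (rem A G), H; split=> //; [apply: der_perm d|perm_lia].
  move=> [n' [H' [K [-> d' f' e]]]].
  exists n'.+1, H', (G ++ K); split=> //; last perm_lia.
  exact: forestS.
rewrite -(perm_mem e) => /IH[n' [H' [K [-> d' f' e']]]].
by exists n', H', K; split=> //; perm_lia.
Qed.

(** An axiom brings two literals, and each tensor rule merges two derivations into one, so there is
    one axiom more than there are tensors. *)
Lemma der_size G : der G -> size (sleaves G) = (total ntens G).+1.*2.
Proof.
elim=> {G} [//|A B G H _ IA _ IB|A B G _ IA|G H e _ IG].
- move: IA IB; rewrite !sleaves_cons sleaves_cat /total /= map_cat sumn_cat.
  by rewrite !size_cat; lia.
- by move: IA; rewrite !sleaves_cons /total /= !size_cat; lia.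
- by rewrite -(perm_total _ e) -(perm_size (perm_sleaves e)) IG.
Qed.

Lemma forest_size n G : forest n G ->
  size (sleaves G) = (total ntens G + n).*2.
Proof.
elim=> {n G} [//|n G H d _ IH|n G H e _ IH].
  by rewrite sleaves_cat size_cat total_cat IH (der_size d); lia.
by rewrite -(perm_total _ e) -(perm_size (perm_sleaves e)) IH.
Qed.

Lemma forest1_der G : forest 1 G -> der G.
Proof.
move e : 1 => n f; elim: f e => {n G} [//|n G H d f _ [n0]|n G H e _ IH /IH].
  move: f; rewrite -n0 => f.
  have -> : H = [::]; last by rewrite cats0.
  case: H f => // A H /forest_pick/(_ (mem_head _ _))[n' [? [? []]]] //.
exact: der_perm.
Qed.

Lemma literals_forest G : (forall A, A \in G -> exists b l, A = LLit b l) ->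
  linear G -> closed G -> exists n, forest n G.
Proof.
have [s] := ubnP (size G); elim: s G => // s IH [|A G] szG lits lin cl.
  by exists 0; exact: forest0.
have [b [l eA]] := lits A (mem_head _ _); subst.
have : (~~ b, l) \in sleaves (LLit b l :: G) by apply: cl; rewrite sleaves_cons mem_head.
rewrite sleaves_cons mem_cat inE xpair_eqE eqxx andbT => /orP[|].
  by case: (b).
move/sleavesP => [B BG]; have [|b' [l' eB]] := lits B; first by rewrite inE BG orbT.
rewrite eB inE => /eqP[eb el]; move: BG; rewrite {}eB -{}eb -{}el {B b' l'} => BG.
have e := perm_to_rem BG; set G' := rem _ G in e.
have eG : perm_eq (LLit b l :: G) ([:: LLit b l; LLit (~~ b) l] ++ G') by perm_lia.
have lin' := lin; rewrite (perm_linear eG) in lin'.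
have [||||n f] := IH G'.
- by move: szG (perm_size e); rewrite /=; lia.
- by move=> A AG; apply: lits; rewrite (perm_mem eG) mem_cat AG orbT.
- exact: linear_catr lin'.
- move=> c k ck; have : (~~ c, k) \in sleaves (LLit b l :: G).
    apply: cl; rewrite (perm_mem (perm_sleaves eG)) sleaves_cat mem_cat ck.
    by rewrite orbT.
  rewrite (perm_mem (perm_sleaves eG)) sleaves_cat mem_cat => /orP[|//].
  move: lin'; rewrite /linear sleaves_cat cat_uniq => /and3P[_ /hasPn hn _].
  have := hn _ ck; rewrite !inE !xpair_eqE.
  by case: (k == l); rewrite ?andbF ?andbT //=; case: (c) (b) => [] [].
exists n.+1.
apply: (@forest_perm _ ([:: LLit b l; LLit (~~ b) l] ++ G')); first by rewrite perm_sym.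
apply: forestS => //; case: (b); first exact: der_ax.
by apply: der_perm (der_ax l); perm_lia.
Qed.

(** Replacing a tensor by its two arguments keeps acyclicity, so A and B lie in derivable parts by
    induction. The parts are different, since a path between A and B inside one of them would be a
    cycle through the tensor; the tensor rule merges them. *)
Lemma par_free_forest G : (forall A, A \in G -> npar A = 0) ->
  linear G -> closed G -> acyc G -> exists n, forest n G.
Proof.
have [s] := ubnP (total ntens G); elim: s G => // s IH G szG pf lin cl ac.
have [/hasP[A AG tA]|] := boolP (has (fun A => 0 < ntens A) G); last first.
  move/hasPn => noT; apply: literals_forest => // A AG.
  have := noT _ AG; have := pf _ AG; case: (A) => [b l|? ?|? ?] //= _ _.
  by exists b, l.
case: A tA AG (pf _ AG) => //= A B _ AG /eqP.
rewrite addn_eq0 => /andP[/eqP pA /eqP pB].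
have e := perm_to_rem AG; set G' := rem _ G in e.
have eL : perm_eq (sleaves G) (sleaves (A :: B :: G')).
  by have := perm_sleaves e; rewrite !sleaves_cons /= => e'; perm_lia.
have linAB : linear (A :: B :: G') by rewrite /linear -(perm_uniq eL).
have [|||||n f] := IH (A :: B :: G').
- by move: szG; rewrite (perm_total _ e) /total /=; lia.
- move=> C; rewrite !inE => /or3P[/eqP->//|/eqP->//|h]; apply: pf.
  by rewrite (perm_mem e) inE h orbT.
- exact: linAB.
- exact: perm_closed_leaves eL cl.
- have {}ac : acyc (LTens A B :: G') by apply: perm_acyc ac.
  move=> v vG; have {}ac : forall W, W \in LTens A B :: G' -> val v W = VO.
    apply: ac => W; rewrite inE => /orP[/eqP-> /=|h]; last by apply: vG; rewrite !inE h !orbT.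
    have := vG A (mem_head _ _); have := vG B; rewrite !inE eqxx orbT => /(_ isT).
    by case: (val v A) (val v B) => [] [].
  have /tens3_eqO[hA hB] := ac _ (mem_head _ _).
  by move=> W; rewrite !inE => /or3P[/eqP->//|/eqP->//|h]; apply: ac; rewrite inE h orbT.
have [n' [H [K [nn' dA fK eK]]]] := forest_pick f (mem_head _ _).
have eBG : perm_eq (B :: G') (H ++ K) by perm_lia.
have : B \in H ++ K by rewrite -(perm_mem eBG) mem_head.
rewrite mem_cat => /orP[BH|/(forest_pick fK)[n2 [H2 [K2 [_ dB fK2 eK2]]]]].
  (* A and B in the same part: the path given by [der_conn] makes A ⊗ B VF with no VT elsewhere,
     against acyclicity. *)
  exfalso; have linAH : linear (A :: H).
    by move: linAB; rewrite (perm_linear eK); exact: (@linear_catl _ (A :: H)).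
  have BA : A != B.
    by apply: contraNneq (linear_notin linAH) => ->.
  have [||v [h1 h2 h3]] := der_conn dA linAH _ _ BA; rewrite ?mem_head ?inE ?BH ?orbT //.
  pose w := glue_val (A :: H) v (fun=> VO).
  have linAHK : linear ((A :: H) ++ K) by move: linAB; rewrite (perm_linear eK).
  have w1 W : W \in A :: H -> val w W = val v W by exact: glue_val1.
  have w2 W : W \in K -> val w W = VO.
    by move=> h; rewrite (glue_val2 _ _ linAHK) ?val_O //; apply: der_closed.
  have wT : val w (LTens A B) = VF by rewrite /= w1 ?mem_head // h1.
  suff : val w (LTens A B) = VO by rewrite wT.
  apply: ac => // W; rewrite (perm_mem e) inE => /orP[/eqP->|WG]; first by rewrite wT.
  have nB : W != B.
    by apply: contraTneq WG => ->; have := linear_notin (@linear_catr _ [:: A] _ linAB).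
  have : W \in H ++ K by rewrite -(perm_mem eBG) inE WG orbT.
  rewrite mem_cat => /orP[WH|/w2->//].
  by rewrite w1 ?inE ?WH ?orbT //; apply: h3; rewrite ?inE ?WH ?orbT.
exists n2.+1; apply: (@forest_perm _ ((LTens A B :: H ++ H2) ++ K2)); last first.
  by apply: forestS => //; apply: der_tens.
perm_lia.
Qed.

Lemma par_dist A : 0 < npar A ->
  (exists B C, A = LPar B C) \/ exists A', dist A' A.
Proof.
elim: A => [//|A IA B IB|A _ B _ _]; last by left; exists A, B.
rewrite /= addn_gt0 => /orP[/IA|/IB] [[C [D ->]]|[A' d]]; right.
- by exists (LPar (stens false B C) D); apply: (dist_here false).
- by exists (stens true A' B); apply: (dist_tens true).
- by exists (LPar (stens true A C) D); apply: (dist_here true).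
- by exists (stens false A' A); apply: (dist_tens false).
Qed.

Lemma stens_count m A B :
  [/\ ntens (stens m A B) = (ntens A + ntens B).+1,
      npar (stens m A B) = npar A + npar B &
      nbelow (stens m A B) = nbelow A + nbelow B + npar A + npar B].
Proof. by case: m => /=; split; lia. Qed.

Lemma dist_count A A' : dist A A' ->
  [/\ ntens A = ntens A', npar A = npar A' & nbelow A < nbelow A'].
Proof.
elim=> {A A'} [m A B C|m A A' B _ [h1 h2 h3]] /=;
  rewrite !(fun m A B => let: And3 e _ _ := stens_count m A B in e)
    !(fun m A B => let: And3 _ e _ := stens_count m A B in e)
    !(fun m A B => let: And3 _ _ e := stens_count m A B in e) /=; split; lia.
Qed.

(** A par at a root is removed by its rule. One below a tensor is moved one step outwards, which
    decreases [nbelow], and [der_dist] puts it back. Without pars the sequent is a forest, and the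
    number of leaves makes it a single derivation. *)
Theorem sequentialisation G : linear G -> closed G -> acyc G ->
  size (sleaves G) = (total ntens G).+1.*2 -> der G.
Proof.
have [s] := ubnP (total (fun A => nbelow A + npar A) G).
elim: s G => // s IH G szG lin cl ac cnt.
have [/hasP[A AG pA]|] := boolP (has (fun A => 0 < npar A) G); last first.
  move/hasPn => noP; have [|n f] := par_free_forest _ lin cl ac.
    by move=> A /noP; lia.
  move: cnt (forest_size f) => -> e; apply: forest1_der.
  by have -> : 1 = n by lia.
have e := perm_to_rem AG; set G' := rem _ G in e.
have [[B [C eA]]|[A' d]] := par_dist pA.
  subst; apply: der_perm (_ : perm_eq (LPar B C :: G') G) _; first by rewrite perm_sym.
  have eL : perm_eq (sleaves G) (sleaves (B :: C :: G')).
    by have := perm_sleaves e; rewrite !sleaves_cons /= => e'; perm_lia.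
  apply: der_par; apply: IH.
  - by move: szG; rewrite (perm_total _ e) /total /=; lia.
  - by rewrite /linear -(perm_uniq eL).
  - exact: perm_closed_leaves eL cl.
  - by apply: acyc_par; apply: perm_acyc ac.
  - by rewrite -(perm_size eL) cnt (perm_total _ e) /total /= addnA.
have [h1 h2 h3] := dist_count d; have eA := dist_leaves d.
have eL : perm_eq (sleaves G) (sleaves (A' :: G')).
  by have := perm_sleaves e; rewrite !sleaves_cons /= => e'; perm_lia.
have linA' : linear (A' :: G') by rewrite /linear -(perm_uniq eL).
have acA : acyc (A :: G') by apply: perm_acyc ac.
have dA' : der (A' :: G').
  apply: IH => //.
  - by move: szG; rewrite (perm_total _ e) /total /=; lia.
  - exact: perm_closed_leaves eL cl.
  - exact: dist_acyc d acA.
  - by rewrite -(perm_size eL) cnt (perm_total _ e) /total /= h1.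
apply: der_perm (_ : perm_eq (A :: G') G) _; first by rewrite perm_sym.
exact: der_dist dA' linA' _ _ _ (perm_refl _) d acA.
Qed.

End Main.

(** * Derivations and their proof nets *)

Section LookUp.
Variables (F X : Type) (sub : F -> seq bool -> option X).
Implicit Types (v w : addr) (G H : seq F).

(** [sub] is abstract so that the renamings of addresses are studied once for formulas, where this
    is [occ], and for labelled formulas, where it is [leaf_at]. *)
Definition look G v : option X := if onth G v.1 is Some A then sub A v.2 else None.

Lemma look_size G v : look G v -> v.1 < size G.
Proof. by rewrite /look -onthTE; case: onth. Qed.

Variables (A B C : F).
Hypothesis subl : forall p, sub C (false :: p) = sub A p.
Hypothesis subr : forall p, sub C (true :: p) = sub B p.

Lemma look_tensl G H v : v.1 <= size G ->
  look (C :: G ++ H) (addr_tensl v) = look (A :: G) v.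
Proof.
by case: v => [[|k] p] kG; rewrite /look /addr_tensl /= ?subl // onth_cat kG.
Qed.

Lemma look_tensr G H v :
  look (C :: G ++ H) (addr_tensr (size G) v) = look (B :: H) v.
Proof.
case: v => [[|k] p]; rewrite /look /addr_tensr /= ?subr // onth_cat.
by rewrite ltnNge leq_addl addnK.
Qed.

Lemma look_par G v : look (C :: G) (addr_par v) = look (A :: B :: G) v.
Proof. by case: v => [[|[|k]] p]; rewrite /look /addr_par /= ?subl ?subr. Qed.

Lemma look_tens_cases G H v : look (C :: G ++ H) v -> [\/ v = (0, [::]),
  exists2 u, v = addr_tensl u & look (A :: G) u = look (C :: G ++ H) v
           /\ u.1 <= size G |
  exists2 u, v = addr_tensr (size G) u & look (B :: H) u = look (C :: G ++ H) v].
Proof.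
case: v => [[|k] [|b p]] hv; [by constructor 1| |..].
- case: b hv => hv; [constructor 3; exists (0, p)|constructor 2; exists (0, p)] => //.
    by rewrite -(look_tensr G).
  by rewrite -(@look_tensl G H).
all: have [kG|Gk] := ltnP k (size G).
- by constructor 2; exists (k.+1, [::]); rewrite // -(@look_tensl G H).
- constructor 3; exists ((k - size G).+1, [::]); first by congr pair; rewrite /=; lia.
  by rewrite -(look_tensr G) /addr_tensr /= addSn subnK.
- by constructor 2; exists (k.+1, b :: p); rewrite // -(@look_tensl G H).
- constructor 3; exists ((k - size G).+1, b :: p); first by congr pair; rewrite /=; lia.
  by rewrite -(look_tensr G) /addr_tensr /= addSn subnK.
Qed.

Lemma look_par_cases G v : look (C :: G) v -> v = (0, [::]) \/
  exists2 u, v = addr_par u & look (A :: B :: G) u = look (C :: G) v.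
Proof.
case: v => [[|k] p] hv.
  case: p hv => [|b p] hv; [by left | right].
  case: b hv => hv; [exists (1, p)|exists (0, p)] => //; by rewrite -(look_par G).
by right; exists (k.+2, p).
Qed.

End LookUp.

Lemma addr_exchK n : involutive (addr_exch n).
Proof.
case=> [k p]; rewrite /addr_exch /=; congr pair.
by case: (eqVneq k n) => [->|kn]; [rewrite eqxx; case: eqP => //; lia|];
  case: (eqVneq k n.+1) => [->|kn']; rewrite ?eqxx // (negPf kn) (negPf kn').
Qed.

Lemma look_exch F X (sub : F -> seq bool -> option X) G A B H v :
  look sub (G ++ B :: A :: H) (addr_exch (size G) v) = look sub (G ++ A :: B :: H) v.
Proof.
case: v => k p; rewrite /look /addr_exch /=.
suff -> : onth (G ++ B :: A :: H)
   (if k == size G then (size G).+1 else if k == (size G).+1 then size G else k)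
   = onth (G ++ A :: B :: H) k by [].
rewrite !onth_cat; have [kG|Gk] := ltnP k (size G).
  have -> : (k == size G) = false by lia.
  have -> : (k == (size G).+1) = false by lia.
  by rewrite kG.
case: eqP => [->|kG]; first by rewrite ltnNge leqnSn subSnn subnn.
case: eqP => [->|kG']; first by rewrite ltnn subSnn subnn.
rewrite ltnNge Gk /=; have -> : k - size G = (k - (size G).+2).+2 by lia.
by [].
Qed.

Section Derivations.
Variable N : nat.
Implicit Types (A B : formula N) (G H : seq (formula N)).
Local Notation L := ('I_N * nat)%type.
Implicit Types (E F : lform L) (K M : seq (lform L)).

Fixpoint erase E : formula N :=
  match E with
  | LLit b l => Lit b l.1
  | LTens E1 E2 => Tens (erase E1) (erase E2)
  | LPar E1 E2 => Par (erase E1) (erase E2)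
  end.

Fixpoint lleaf E (p : seq bool) : option (bool * L) :=
  match E, p with
  | LLit b l, [::] => Some (b, l)
  | LTens E1 E2, c :: p' | LPar E1 E2, c :: p' => lleaf (if c then E2 else E1) p'
  | _, _ => None
  end.

Definition leaf_at K v := look lleaf K v.

Definition linked K v w :=
  match leaf_at K v, leaf_at K w with
  | Some (true, l), Some (false, l') => l == l'
  | _, _ => false
  end.

Lemma linkedP K v w : reflect (exists2 l, leaf_at K v = Some (true, l) &
  leaf_at K w = Some (false, l)) (linked K v w).
Proof.
rewrite /linked; case: (leaf_at K v) => [[[] l]|]; last 1 first.
- by constructor; case.
- case: (leaf_at K w) => [[[] l']|]; try by constructor; case=> ? ? ?.
  apply: (iffP eqP) => [<-|[k [->] [->]]//]; by exists l.
- by constructor; case.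
Qed.

Lemma lleaf_leaves E p a : lleaf E p = Some a -> a \in leaves E.
Proof.
elim: E p => [b l|E1 I1 E2 I2|E1 I1 E2 I2] [|c p] //=.
- by case=> <-; rewrite mem_head.
- by case: c => [/I2|/I1] h; rewrite mem_cat h ?orbT.
- by case: c => [/I2|/I1] h; rewrite mem_cat h ?orbT.
Qed.

Lemma leaf_at_mem K v a : leaf_at K v = Some a -> a \in sleaves K.
Proof.
rewrite /leaf_at /look; case e: (onth K v.1) => [E|//] /lleaf_leaves h.
by apply/sleavesP; exists E => //; apply/onthP; exists v.1.
Qed.

Lemma mem_map_links f (s : seq (addr * addr)) v w :
  reflect (exists u u', [/\ (u, u') \in s, v = f u & w = f u'])
    ((v, w) \in map_links f s).
Proof.
apply: (iffP mapP) => [[[u u'] h [-> ->]]|[u [u' [h -> ->]]]]; first by exists u, u'.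
by exists (u, u').
Qed.

Definition has_deriv K := exists d : deriv (map erase K),
  forall v w, (v, w) \in links d = linked K v w.

Lemma has_deriv_ax l : has_deriv [:: LLit true l; LLit false l].
Proof.
exists (DAx l.1) => v w; rewrite /= inE xpair_eqE /linked /leaf_at /look.
case: v => [[|[|k]] [|b p]] //=; case: w => [[|[|k']] [|b' p']] //=;
by rewrite ?eqxx ?onth0n.
Qed.

Lemma linear_leaves_disjoint K M a :
  linear (K ++ M) -> a \in sleaves K -> a \in sleaves M -> False.
Proof.
rewrite /linear sleaves_cat cat_uniq => /and3P[_ /hasPn h _] aK aM.
by have /negP := h a aM.
Qed.

(** Both premises are closed and share no label, so no pair of dual leaves runs across them, just as
    no link of a tensor rule does. *)
Lemma has_deriv_tens E F K M : closed (E :: K) -> closed (F :: M) ->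
  linear (LTens E F :: K ++ M) ->
  has_deriv (E :: K) -> has_deriv (F :: M) -> has_deriv (LTens E F :: K ++ M).
Proof.
rewrite linear_tens => clE clF lin [d1 h1] [d2 h2].
rewrite /has_deriv /= map_cat; exists (@DTens _ (erase E) (erase F) (map erase K) (map erase M) d1 d2) => v w.
have lookl u a : leaf_at (E :: K) u = Some a ->
    leaf_at (LTens E F :: K ++ M) (addr_tensl u) = Some a.
  move=> ua; rewrite /leaf_at (look_tensl (A := E)) //.
  by have /look_size : look lleaf (E :: K) u by move: ua; rewrite /leaf_at => ->.
have lookr u : leaf_at (LTens E F :: K ++ M) (addr_tensr (size K) u)
    = leaf_at (F :: M) u.
  by rewrite /leaf_at (look_tensr (B := F)).
have disj b b' l : (b, l) \in sleaves (E :: K) -> (b', l) \in sleaves (F :: M) -> False.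
  move=> hE hF; apply: (linear_leaves_disjoint lin) hF.
  by case: (b =P b') hE => [->//|ne hE]; have := clE _ _ hE; case: (b) (b') ne => [] [].
rewrite /= size_map mem_cat; apply/orP/linkedP => [[]/mem_map_links[u [u' [h -> ->]]]|].
- move: h; rewrite h1 => /linkedP[l ul u'l]; exists l; exact: lookl.
- by move: h; rewrite h2 => /linkedP[l ul u'l]; exists l; rewrite lookr.
have cases x b l : leaf_at (LTens E F :: K ++ M) x = Some (b, l) ->
    (exists2 u, x = addr_tensl u & leaf_at (E :: K) u = Some (b, l)) \/
    (exists2 u, x = addr_tensr (size K) u & leaf_at (F :: M) u = Some (b, l)).
  move=> xl; have xx : look lleaf (LTens E F :: K ++ M) x by rewrite -/(leaf_at _ _) xl.
  have [x0|[u xu [ul _]]|[u xu ul]] :=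
    @look_tens_cases _ _ lleaf E F (LTens E F) (fun=> erefl) (fun=> erefl) _ _ _ xx.
  - by move: xl; rewrite x0.
  - by left; exists u => //; rewrite /leaf_at ul.
  - by right; exists u => //; rewrite /leaf_at ul.
move=> [l /cases vl /cases wl].
case: vl wl => [[u -> ul]|[u -> ul]] [[u' -> u'l]|[u' -> u'l]].
- left; apply/mem_map_links; exists u, u'; rewrite h1; split=> //.
  by apply/linkedP; exists l.
- by case: (disj _ _ _ (leaf_at_mem ul) (leaf_at_mem u'l)).
- by case: (disj _ _ _ (leaf_at_mem u'l) (leaf_at_mem ul)).
- right; apply/mem_map_links; exists u, u'; rewrite h2; split=> //.
  by apply/linkedP; exists l.
Qed.

Lemma has_deriv_par E F K : has_deriv (E :: F :: K) -> has_deriv (LPar E F :: K).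
Proof.
move=> [d h]; exists (@DPar _ (erase E) (erase F) (map erase K) d) => v w.
have look_p u : leaf_at (LPar E F :: K) (addr_par u) = leaf_at (E :: F :: K) u.
  by rewrite /leaf_at (look_par (A := E) (B := F)).
have cases x b l : leaf_at (LPar E F :: K) x = Some (b, l) ->
    exists2 u, x = addr_par u & leaf_at (E :: F :: K) u = Some (b, l).
  move=> xl; have xx : look lleaf (LPar E F :: K) x by rewrite -/(leaf_at _ _) xl.
  have [x0|[u xu ul]] := @look_par_cases _ _ lleaf E F (LPar E F) (fun=> erefl) (fun=> erefl) _ _ xx.
    by move: xl; rewrite x0.
  by exists u => //; rewrite /leaf_at ul.
apply/mem_map_links/linkedP => [[u [u' [uu' -> ->]]]|[l /cases[u -> ul] /cases[u' -> u'l]]].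
  by move: uu'; rewrite h => /linkedP[l ul u'l]; exists l; rewrite look_p.
by exists u, u'; rewrite h; split=> //; apply/linkedP; exists l.
Qed.

Lemma has_deriv_exch K E F M :
  has_deriv (K ++ E :: F :: M) -> has_deriv (K ++ F :: E :: M).
Proof.
rewrite /has_deriv !map_cat /= => -[d h]; exists (DExch d) => v w.
have look_e u : leaf_at (K ++ F :: E :: M) u
    = leaf_at (K ++ E :: F :: M) (addr_exch (size K) u).
  by rewrite -{1}(addr_exchK (size K) u) /leaf_at look_exch.
rewrite /= size_map /linked !look_e -/(linked _ _ _) -h.
apply/mem_map_links/idP => [[u [u' [uu' -> ->]]]|vw]; first by rewrite !addr_exchK.
by exists (addr_exch (size K) v), (addr_exch (size K) w); rewrite !addr_exchK.
Qed.

(** [deriv] exchanges neighbours only: the head of t is moved to the front of s step by step. *)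
Lemma perm_adjacent (T : eqType) (Q : seq T -> Prop) :
  (forall s x y t, Q (s ++ x :: y :: t) -> Q (s ++ y :: x :: t)) ->
  forall s t, perm_eq s t -> Q s -> Q t.
Proof.
move=> sw; suff h s t r : perm_eq s t -> Q (r ++ s) -> Q (r ++ t) by move=> s t; apply: (h _ _ [::]).
elim: t s r => [|x t IH] s r; first by move/perm_nilP->.
move=> e; have xs : x \in s by rewrite (perm_mem e) mem_head.
case/splitPr: xs e => s1 s2 e.
have {}e : perm_eq (s1 ++ s2) t by perm_lia.
move=> h; have : Q (r ++ x :: s1 ++ s2).
  elim/last_ind: s1 s2 h {e} => //= s1 y IHs s2; rewrite cat_rcons => h.
  rewrite cat_rcons; apply: IHs.
  by have := sw (r ++ s1) y x s2; rewrite -!catA; apply.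
by rewrite -!cat_rcons; apply: IH.
Qed.

Lemma der_has_deriv K : der K -> linear K -> has_deriv K.
Proof.
elim=> {K} [l _|E F K M dE IE dF IF lin|E F K d IE lin|K M e d IK lin].
- exact: has_deriv_ax.
- have lin' := lin; rewrite linear_tens in lin'.
  apply: has_deriv_tens => //; try exact: der_closed.
    exact/IE/(linear_catl lin').
  exact/IF/(linear_catr lin').
- apply/has_deriv_par/IE.
  by move: lin; rewrite /linear !sleaves_cons /= -catA.
- apply: (perm_adjacent has_deriv_exch e); apply: IK.
  by rewrite (perm_linear e).
Qed.

End Derivations.

(** * Trees and their union along an edge *)

Section Trees.
Variable T : eqType.
Implicit Types (V : pred T) (e : rel T) (c p : seq T) (a b v w : T).

(** Relative to a vertex set, so that several parts of one switching can be treated inside the same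
    graph. *)
Definition tree V e :=
  (forall c, 2 < size c -> uniq c -> all V c -> ~~ cycle e c) /\
  (forall v w, V v -> V w -> exists2 p, path e v p && all V p & last v p = w).

Lemma tree1 a e : tree (pred1 a) e.
Proof.
split=> [[|x [|y c]] // _ /= /andP[xc _] /and3P[/eqP xa /eqP ya _]|v w /eqP-> /eqP->].
  by move: xc; rewrite xa ya inE eqxx.
by exists [::].
Qed.

Lemma tree_image (f : T -> T) V V' e e' : injective f ->
  (forall v, V' v <-> exists2 u, V u & v = f u) ->
  {in V &, forall v w, e' (f v) (f w) = e v w} -> tree V e -> tree V' e'.
Proof.
move=> f_inj V'P ee [ac co].
have pE v p : V v -> all V p -> path e' (f v) (map f p) = path e v p.
  by elim: p v => //= w p IH v Vv /andP[Vw Vp]; rewrite ee // IH.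
split.
  move=> c c2 uc Vc; have [c0 ec Vc0] : exists2 c0, c = map f c0 & all V c0.
    elim: c Vc {c2 uc} => [|x c IH] /=; first by exists [::].
    move=> /andP[/V'P[u Vu ->] /IH[c0 -> Vc0]]; exists (u :: c0) => //=.
    by rewrite Vu.
  move: c2 uc; rewrite ec size_map (map_inj_uniq f_inj) => c2 uc.
  have := ac _ c2 uc Vc0; case: c0 Vc0 {Vc ec c2 uc} => //= x c0 /andP[Vx Vc].
  by rewrite -map_rcons pE // all_rcons Vx.
move=> v w /V'P[u Vu ->] /V'P[u' Vu' ->]; have [p /andP[ep Vp] <-] := co u u' Vu Vu'.
exists (map f p); last by rewrite last_map.
rewrite pE // ep all_map; apply/allP => x /(allP Vp) Vx.
by apply/V'P; exists x.
Qed.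

Lemma path_crossing (V1 V2 V : pred T) (e : rel T) a b x q :
  (forall v, V v = V1 v || V2 v) ->
  (forall v w, V1 v -> V2 w -> e v w -> v = a /\ w = b) ->
  path e x q -> V1 x -> all V q -> has V2 q ->
  exists q1 q2, q = q1 ++ b :: q2 /\ last x q1 = a.
Proof.
move=> VE e12; elim: q x => //= y q IH x /andP[exy eq] V1x /andP[Vy Vq].
have [V2y _|V2y /= hq] := boolP (V2 y).
  by have [-> ->] := e12 _ _ V1x V2y exy; exists [::], q.
have V1y : V1 y by move: Vy; rewrite VE (negPf V2y) orbF.
have [q1 [q2 [-> <-]]] := IH y eq V1y Vq hq.
by exists (y :: q1), q2.
Qed.

(** A cycle that meets both sides crosses from V1 to V2 along the edge from a to b and returns along
    the same edge; as no vertex is repeated, it has length two. *)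
Lemma tree_join V1 V2 V e a b : V1 a -> V2 b -> (forall v, V1 v -> ~~ V2 v) ->
  symmetric e -> (forall v, V v = V1 v || V2 v) ->
  (forall v w, V1 v -> V2 w -> e v w = (v == a) && (w == b)) ->
  tree V1 e -> tree V2 e -> tree V e.
Proof.
move=> V1a V2b dis sy VE e12 [ac1 co1] [ac2 co2]; split; last first.
  have eab : e a b by rewrite e12 ?eqxx.
  have sub1 p : all V1 p -> all V p by apply: sub_all => v; rewrite VE => ->.
  have sub2 p : all V2 p -> all V p.
    by apply: sub_all => v; rewrite VE => ->; rewrite orbT.
  move=> v w; rewrite !VE => /orP[v1|v2] /orP[w1|w2].
  - have [p /andP[ep Vp] lp] := co1 v w v1 w1.
    by exists p; rewrite // ep sub1.
  - have [p /andP[ep Vp] lp] := co1 v a v1 V1a.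
    have [q /andP[eq Vq] lq] := co2 b w V2b w2.
    exists (p ++ b :: q); last by rewrite last_cat.
    by rewrite cat_path all_cat ep lp /= eab eq (sub1 _ Vp) (sub2 _ Vq) VE V2b orbT.
  - have [p /andP[ep Vp] lp] := co2 v b v2 V2b.
    have [q /andP[eq Vq] lq] := co1 a w V1a w1.
    exists (p ++ a :: q); last by rewrite last_cat.
    by rewrite cat_path all_cat ep lp /= sy eab eq (sub2 _ Vp) (sub1 _ Vq) VE V1a.
  - have [p /andP[ep Vp] lp] := co2 v w v2 w2.
    by exists p; rewrite // ep sub2.
move=> c c2 uc Vc; apply/negP => cy.
have [al1|nal1] := boolP (all V1 c); first by have /negP := ac1 c c2 uc al1.
have [al2|nal2] := boolP (all V2 c); first by have /negP := ac2 c c2 uc al2.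
have /hasP[x xc V1x] : has V1 c.
  move: nal2; rewrite -has_predC => /hasP[x xc /= V2x]; apply/hasP; exists x => //.
  by move: (allP Vc _ xc); rewrite VE (negPf V2x) orbF.
have hasV2 : has V2 c.
  move: nal1; rewrite -has_predC => /hasP[y yc /= V1y]; apply/hasP; exists y => //.
  by move: (allP Vc _ yc); rewrite VE (negPf V1y).
have [i p er] := rot_to xc.
have uq : uniq (rcons p x) by rewrite rcons_uniq -cons_uniq -er rot_uniq.
have eq : path e x (rcons p x) by move: cy; rewrite -(rot_cycle i) er.
have mq y : y \in rcons p x = (y \in c) by rewrite mem_rcons -er mem_rot.
have Vq : all V (rcons p x) by apply/allP => y; rewrite mq; apply: allP Vc _.
have V2q : has V2 (rcons p x).
  by case/hasP: hasV2 => y yc V2y; apply/hasP; exists y; rewrite ?mq.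
have szq : size (rcons p x) = size c by rewrite size_rcons -(size_rot i c) er.
have [q1 [q2 [q12 lq1]]] : exists q1 q2, rcons p x = q1 ++ b :: q2 /\ last x q1 = a.
  apply: path_crossing eq V1x Vq V2q => // v w v1 w2.
  by rewrite e12 // => /andP[/eqP-> /eqP->].
have lq2 : last b q2 = x by have := last_rcons x p x; rewrite q12 last_cat.
move: eq Vq; rewrite q12 cat_path all_cat /= => /and3P[_ _ eq2] /and3P[_ _ Vq2].
have V1q2 : has V1 q2.
  apply/hasP; exists x => //; have := mem_last b q2; rewrite lq2 inE => /orP[/eqP xb|//].
  by move: (dis _ V1x); rewrite xb V2b.
have [r1 [r2 [r12 lr1]]] : exists r1 r2, q2 = r1 ++ a :: r2 /\ last b r1 = b.
  apply: (@path_crossing V2 V1 V e b a b q2) => // [v|v w v2 w1].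
    by rewrite VE orbC.
  by rewrite sy e12 // => /andP[/eqP-> /eqP->].
move: uq lq2; rewrite q12 r12 => uq lq2.
have r1E : r1 = [::].
  case/lastP: r1 lr1 uq {r12 lq2} => // r1 y; rewrite last_rcons => ->.
  rewrite cat_uniq /= => /and4P[_ _ + _].
  by rewrite mem_cat mem_rcons inE eqxx.
rewrite {}r1E /= in uq lq2 r12.
have q1E : q1 = [::].
  case/lastP: q1 lq1 uq {q12} => // q1 y; rewrite last_rcons => ->.
  rewrite cat_uniq => /and3P[_ /hasPn h _]; have := h a.
  by rewrite /= mem_rcons !inE eqxx orbT => /(_ isT).
rewrite {}q1E /= in lq1 uq q12; subst a.
have r2E : r2 = [::].
  case: r2 lq2 uq {r12} => // y r2 /= lq2 /and4P[_ /negP h _ _]; case: h.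
  by rewrite -lq2 mem_last.
by move: c2; rewrite -szq q12 r12 r2E.
Qed.

End Trees.

(** * The switchings of a derivation are trees *)

Section Correctness.
Variable N : nat.
Implicit Types (A B : formula N) (G H : seq (formula N)).
Implicit Types (v w : addr) (s : addr -> bool) (ls : seq (addr * addr)).

Definition sw G ls s : rel addr := fun v w =>
  [|| arg_edge G s v w, arg_edge G s w v, (v, w) \in ls | (w, v) \in ls].

Definition vertex G : pred addr := fun v => occ G v.

Lemma sw_sym G ls s : symmetric (sw G ls s).
Proof.
by move=> v w; rewrite /sw orbCA; do 2!congr (_ || _); rewrite orbC.
Qed.

Lemma arg_edgeP G s v w : reflect
  (exists2 b, kept G s v b & w = (v.1, rcons v.2 b)) (arg_edge G s v w).
Proof.
apply: (iffP hasP) => [[b _ /andP[k /eqP->]]|[b k ->]]; first by exists b.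
by exists b; [case: (b) | rewrite k eqxx].
Qed.

Definition child_morph (f : addr -> addr) :=
  forall v b, f (v.1, rcons v.2 b) = ((f v).1, rcons (f v).2 b).

Lemma arg_edge_image G G' s f v w : child_morph f -> injective f ->
  occ G' (f v) = occ G v -> arg_edge G' s (f v) (f w) = arg_edge G (s \o f) v w.
Proof.
move=> fc fi ov; rewrite /arg_edge; apply: eq_has => b.
by rewrite /kept ov -fc (inj_eq fi).
Qed.

Lemma mem_map_links_inj f ls v w : injective f ->
  ((f v, f w) \in map_links f ls) = ((v, w) \in ls).
Proof.
move=> fi; apply/mem_map_links/idP => [[u [u' [h /fi-> /fi->]]]//|h].
by exists v, w.
Qed.

Lemma tensl_inj : injective addr_tensl.
Proof. by case=> [[|k] p] [[|k'] p'] // [] -> // ->. Qed.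

Lemma tensr_inj n : injective (addr_tensr n).
Proof. by case=> [[|k] p] [[|k'] p'] // [] => [->//|/addIn-> ->]. Qed.

Lemma par_inj : injective addr_par.
Proof. by case=> [[|[|k]] p] [[|[|k']] p'] // [] -> // ->. Qed.

Lemma exch_inj n : injective (addr_exch n).
Proof. exact: inv_inj (addr_exchK n). Qed.

Lemma tensl_child : child_morph addr_tensl. Proof. by case=> [[|k] p]. Qed.
Lemma tensr_child n : child_morph (addr_tensr n). Proof. by case=> [[|k] p]. Qed.
Lemma par_child : child_morph addr_par. Proof. by case=> [[|[|k]] p]. Qed.
Lemma exch_child n : child_morph (addr_exch n). Proof. by []. Qed.

Lemma occ_tensl A B G H v : vertex (A :: G) v ->
  occ (Tens A B :: G ++ H) (addr_tensl v) = occ (A :: G) v.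
Proof. by move/look_size => /= h; apply: (look_tensl (A := A)). Qed.

Lemma occ_tensr A B G H v :
  occ (Tens A B :: G ++ H) (addr_tensr (size G) v) = occ (B :: H) v.
Proof. exact: (look_tensr (B := B)). Qed.

Lemma occ_par A B G v : occ (Par A B :: G) (addr_par v) = occ (A :: B :: G) v.
Proof. exact: (look_par (A := A) (B := B)). Qed.

Lemma occ_exch G A B H v :
  occ (G ++ B :: A :: H) (addr_exch (size G) v) = occ (G ++ A :: B :: H) v.
Proof. exact: look_exch. Qed.

Lemma links_occ G (d : deriv G) v w : (v, w) \in links d ->
  exists i, occ G v = Some (Lit true i) /\ occ G w = Some (Lit false i).
Proof.
elim: d v w => {G} [i|A B G H d1 I1 d2 I2|A B G d I|G A B H d I] v w /=.
- by rewrite inE xpair_eqE => /andP[/eqP-> /eqP->]; exists i.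
- rewrite mem_cat => /orP[]/mem_map_links[u [u' [h -> ->]]].
  + have [i [h1 h2]] := I1 _ _ h; exists i.
    by rewrite !occ_tensl // /vertex ?h1 ?h2.
  + by have [i [h1 h2]] := I2 _ _ h; exists i; rewrite !occ_tensr.
- move=> /mem_map_links[u [u' [h -> ->]]]; have [i [h1 h2]] := I _ _ h.
  by exists i; rewrite !occ_par.
- move=> /mem_map_links[u [u' [h -> ->]]]; have [i [h1 h2]] := I _ _ h.
  by exists i; rewrite !occ_exch.
Qed.

Lemma links_vertex G (d : deriv G) v w : (v, w) \in links d -> vertex G v /\ vertex G w.
Proof. by move/links_occ => [i [h1 h2]]; rewrite /vertex h1 h2. Qed.

Lemma root_vertex A G : vertex (A :: G) (0, [::]).
Proof. by rewrite /vertex /occ /=; case: A. Qed.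

(* The part of the conclusion of a tensor rule where an address lies: 0 for the
   principal formula, 1 and 2 for the premises. *)
Definition side n v : nat :=
  match v with
  | (k.+1, _) => if k < n then 1 else 2
  | (0, [::]) => 0
  | (0, b :: _) => if b then 2 else 1
  end.

Lemma side_child n v b : v != (0, [::]) -> side n (v.1, rcons v.2 b) = side n v.
Proof. by case: v => [[|k] [|c p]]. Qed.

Lemma side_tensl A G v : vertex (A :: G) v -> side (size G) (addr_tensl v) = 1.
Proof. by move=> /look_size; case: v => [[|k] p] //= kG; rewrite ltnS in kG; rewrite kG. Qed.

Lemma side_tensr n v : side n (addr_tensr n v) = 2.
Proof. by case: v => [[|k] p] //=; rewrite ltnNge leq_addl. Qed.

Lemma side0 n v : side n v = 0 -> v = (0, [::]).
Proof. by case: v => [[|k] [|[] p]] //=; case: ifP. Qed.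

Lemma tens_vertex A B G H v : vertex (Tens A B :: G ++ H) v -> [\/ v = (0, [::]),
  exists2 u, v = addr_tensl u & vertex (A :: G) u |
  exists2 u, v = addr_tensr (size G) u & vertex (B :: H) u].
Proof.
move=> hv; have [->|[u eu [e _]]|[u eu e]] :=
  @look_tens_cases _ _ (@subf N) A B (Tens A B) (fun=> erefl) (fun=> erefl) G H v hv.
- by constructor 1.
- by constructor 2; exists u; rewrite // /vertex [occ _ _]e.
- by constructor 3; exists u; rewrite // /vertex [occ _ _]e.
Qed.

(** The tensor vertex is joined by one edge to each of the trees of the premises, and [side] shows
    that no other edge runs between the three parts. *)
Lemma tree_tens A B G H (d1 : deriv (A :: G)) (d2 : deriv (B :: H)) s :
  (forall s, tree (vertex (A :: G)) (sw (A :: G) (links d1) s)) ->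
  (forall s, tree (vertex (B :: H)) (sw (B :: H) (links d2) s)) ->
  tree (vertex (Tens A B :: G ++ H)) (sw (Tens A B :: G ++ H) (links (DTens d1 d2)) s).
Proof.
move=> t1 t2; set K := Tens A B :: G ++ H; set ls := links _.
set e := sw K ls s; set r : addr := (0, [::]); pose n := size G.
have ls_side v w : (v, w) \in ls -> side n v = side n w /\ side n v != 0.
  rewrite /ls /= mem_cat => /orP[]/mem_map_links[u [u' [h -> ->]]].
    by have [hu hu'] := links_vertex h; rewrite !(side_tensl (A := A)).
  by rewrite !side_tensr.
have arg_side v w : arg_edge K s v w -> v != r -> side n w = side n v.
  by move=> /arg_edgeP[b _ ->] vr; rewrite side_child.
have arg_r w : arg_edge K s r w = (w == (0, [:: false])) || (w == (0, [:: true])).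
  by rewrite /arg_edge /kept /= orbF.
have no_arg_r w : arg_edge K s w r = false.
  by apply/negP => /arg_edgeP[b _ []] _; case: (w.2).
have e_r v : v != r -> e v r = (v == (0, [:: false])) || (v == (0, [:: true])).
  move=> vr; rewrite /e /sw no_arg_r arg_r /=.
  have -> : ((v, r) \in ls) = false by apply/negP => /ls_side[->].
  have -> : ((r, v) \in ls) = false by apply/negP => /ls_side[].
  by rewrite !orbF.
have e_side v w : e v w -> v != r -> w != r -> side n v = side n w.
  by case/or4P => [h vr _|h _ wr|/ls_side[]//|/ls_side[]//];
    [rewrite (arg_side _ _ h)|rewrite (arg_side _ _ h)].
have tl : tree [pred v | vertex K v && (side n v == 1)] e.
  apply: tree_image tensl_inj _ _ (t1 (s \o addr_tensl)) => [v|v w hv hw].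
    rewrite /=; split=> [/andP[/tens_vertex[->//|[u -> hu]|[u -> hu]] sv]|[u hu ->]].
    - by exists u.
    - by rewrite side_tensr in sv.
    - by rewrite (side_tensl hu) /vertex occ_tensl // andbT.
  rewrite /e /sw !(arg_edge_image _ _ tensl_child tensl_inj (occ_tensl _ _ _)) //.
  have lsE v1 w1 : vertex (A :: G) v1 ->
      ((addr_tensl v1, addr_tensl w1) \in ls) = ((v1, w1) \in links d1).
    move=> hv1; rewrite /ls /= mem_cat mem_map_links_inj; last exact: tensl_inj.
    rewrite orbC; case: mem_map_links => // -[u [u' [_ e1 _]]].
    by have := side_tensl hv1; rewrite e1 side_tensr.
  by rewrite !lsE.
have tr : tree [pred v | vertex K v && (side n v == 2)] e.
  apply: tree_image (@tensr_inj n) _ _ (t2 (s \o addr_tensr n)) => [v|v w hv hw].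
    rewrite /=; split=> [/andP[/tens_vertex[->//|[u -> hu]|[u -> hu]] sv]|[u hu ->]].
    - by rewrite (side_tensl hu) in sv.
    - by exists u.
    - by rewrite side_tensr /vertex occ_tensr andbT.
  rewrite /e /sw !(arg_edge_image _ _ (@tensr_child n) (@tensr_inj n) (occ_tensr _ _ _ _ _)).
  have lsE v1 w1 : ((addr_tensr n v1, addr_tensr n w1) \in ls) = ((v1, w1) \in links d2).
    rewrite /ls /= mem_cat mem_map_links_inj; last exact: tensr_inj.
    case: mem_map_links => // -[u [u' [/links_vertex[hu _] e1 _]]].
    by have := side_tensl hu; rewrite -e1 side_tensr.
  by rewrite !lsE.
have e_sym : symmetric e by exact: sw_sym.
have Kr : vertex K r by [].
have Kl : vertex K (0, [:: false]) by rewrite /vertex [occ _ _](@occ_tensl A B G H (0, [::])); apply: root_vertex.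
have Kr' : vertex K (0, [:: true]) by rewrite /vertex [occ _ _](@occ_tensr A B G H (0, [::])); apply: root_vertex.
have tlr : tree [pred v | vertex K v && (side n v <= 1)] e.
  apply: (@tree_join _ [pred v | vertex K v && (side n v == 1)] (pred1 r) _ e (0, [:: false]) r) => //=.
  - by rewrite Kl.
  - by move=> v /andP[_ sv]; apply: contraL sv => /eqP->.
  - move=> v; have [->//|vr] := eqVneq v r; rewrite orbF.
    by case: (side n v) (@side0 n v) => [/(_ erefl) e0|[|m]//]; rewrite e0 eqxx in vr.
  - move=> v w /andP[_ sv] /eqP->; have vr : v != r by apply: contraL sv => /eqP->.
    rewrite e_r // eqxx andbT; case: (v =P (0, [:: true])) => [ve|]; last by rewrite orbF.
    by rewrite ve in sv.
  - exact: tree1.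
apply: (@tree_join _ [pred v | vertex K v && (side n v <= 1)]
  [pred v | vertex K v && (side n v == 2)] _ e r (0, [:: true])) => //=.
- by rewrite Kr'.
- by move=> v /andP[_]; case: (side n v) => [|[|]] //; rewrite andbF.
- move=> v; rewrite -andb_orr; case hv: (vertex K v) => //=.
  by case: v hv => [[|k] [|[] p]] //= _; case: ifP.
- move=> v w /andP[_ sv] /andP[_ sw2]; have wr : w != r by apply: contraL sw2 => /eqP->.
  have [->|vr] := eqVneq v r.
    rewrite e_sym e_r //; case: (w =P (0, [:: false])) => [we|//].
    by rewrite we in sw2.
  by apply/negP => /e_side/(_ vr wr) svw; move: sv; rewrite svw (eqP sw2).
Qed.

(** A switching keeps one edge at the par, whose vertex is thus a leaf attached to the tree of the
    premise. *)
Lemma tree_par A B G (d : deriv (A :: B :: G)) s :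
  (forall s, tree (vertex (A :: B :: G)) (sw (A :: B :: G) (links d) s)) ->
  tree (vertex (Par A B :: G)) (sw (Par A B :: G) (links (DPar d)) s).
Proof.
move=> t; set K := Par A B :: G; set ls := links _.
set e := sw K ls s; set r : addr := (0, [::]).
have Ki v : vertex K v -> v != r ->
    exists2 u, v = addr_par u & vertex (A :: B :: G) u.
  move=> hv vr; have [e0|[u eu e1]] :=
    @look_par_cases _ _ (@subf N) A B (Par A B) (fun=> erefl) (fun=> erefl) G v hv.
    by rewrite e0 eqxx in vr.
  by exists u; rewrite // /vertex [occ _ _]e1.
have par_r u : addr_par u != r by case: u => [[|[|k]] p].
have lsr v : ((v, r) \in ls) = false.
  by apply/negP => /links_occ[i []].
have lsr' v : ((r, v) \in ls) = false.
  by apply/negP => /links_occ[i []].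
have e_r v : e v r = (v == (0, [:: s r])).
  rewrite /e /sw lsr lsr' /= !orbF.
  have -> : arg_edge K s v r = false.
    by apply/negP => /arg_edgeP[b _ []] _; case: (v.2).
  rewrite /arg_edge /kept /= orbF.
  by case: (s r); rewrite /= ?orbF.
have tp : tree [pred v | vertex K v && (v != r)] e.
  apply: tree_image par_inj _ _ (t (s \o addr_par)) => [v|v w hv hw].
    rewrite /=; split=> [/andP[/Ki h /h[u ? ?]]|[u hu ->]]; first by exists u.
    by rewrite par_r andbT /vertex [occ _ _](occ_par A B G).
  rewrite /e /sw !(arg_edge_image _ _ par_child par_inj (occ_par _ _ _ _)).
  by rewrite !(mem_map_links_inj _ _ _ par_inj).
have Kc b : vertex K (0, [:: b]).
    case: b; first by rewrite /vertex [occ _ _](@occ_par A B G (1, [::])) /occ /=; case: (B).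
  by rewrite /vertex [occ _ _](@occ_par A B G (0, [::])); apply: root_vertex.
apply: (@tree_join _ [pred v | vertex K v && (v != r)] (pred1 r) _ e (0, [:: s r]) r) => //=.
- by rewrite Kc.
- by move=> v /andP[].
- exact: sw_sym.
- by move=> v; have [->|] := eqVneq v r; rewrite ?orbF ?andbT ?orbT.
- by move=> v w _ /eqP->; rewrite e_r eqxx andbT.
- exact: tree1.
Qed.

Lemma deriv_tree G (d : deriv G) s : tree (vertex G) (sw G (links d) s).
Proof.
elim: d s => {G} [i|A B G H d1 I1 d2 I2|A B G d I|G A B H d I] s.
- set e := sw _ _ s; set a : addr := (0, [::]); set b : addr := (1, [::]).
  apply: (@tree_join _ (pred1 a) (pred1 b) _ e a b) => //=.
  + by move=> v /eqP->.
  + exact: sw_sym.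
  + by case=> [[|[|k]] [|c p]]; rewrite /vertex /occ //= onth0n.
  + by move=> v w /eqP-> /eqP->; rewrite !eqxx.
  + exact: tree1.
  + exact: tree1.
- exact: tree_tens.
- exact: tree_par.
- apply: tree_image (@exch_inj (size G)) _ _ (I (s \o addr_exch (size G))) => [v|v w hv hw].
    split=> [hv|[u hu ->]]; last by rewrite /vertex occ_exch.
    exists (addr_exch (size G) v); last by rewrite addr_exchK.
    by rewrite /vertex -occ_exch addr_exchK.
  rewrite /sw !(arg_edge_image _ _ (@exch_child _) (@exch_inj _) (occ_exch _ _ _ _ _)).
  by rewrite !(mem_map_links_inj _ _ _ (@exch_inj _)).
Qed.

Lemma kept_child G s v b : kept G s v b -> vertex G (v.1, rcons v.2 b).
Proof.
rewrite /kept /vertex /occ /=; case: (onth G v.1) => // A.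
elim: v.2 A => [|c p IH] A /=.
  by case: A => // A1 A2; case: b => _ /=; case: (A1) (A2) => [? ?|? ?|? ?] [? ?|? ?|? ?].
case: A => // A1 A2; exact: IH.
Qed.

Lemma sw_vertex G (d : deriv G) s v w : sw G (links d) s v w -> vertex G v.
Proof.
case/or4P=> [/arg_edgeP[b]|/arg_edgeP[b k ->]|/links_vertex[]//|/links_vertex[]//].
  by rewrite /kept /vertex; case: occ.
exact: kept_child k.
Qed.

Lemma deriv_proof_net G (d : deriv G) (th : proof_structure G) :
  sequentialises d th -> proof_net th.
Proof.
move=> sq s.
have ee : switching th s =2 sw G (links d) s by move=> v w; rewrite /switching !sq.
have [ac co] := deriv_tree d s; split.
  move=> c c2 uc; rewrite (eq_cycle ee); apply/negP => cy.
  (* Cycles range over all addresses, but every edge of a switching joins vertices of the parse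
     forest. *)
  have Vc : all (vertex G) c by apply/allP => v /(next_cycle cy)/sw_vertex.
  by move/negP: (ac c c2 uc Vc).
move=> v w hv hw; have [||p /andP[ep _] lp] := co v w.
- by rewrite /vertex; case: occ hv.
- by rewrite /vertex; case: occ hw.
by exists p; rewrite // (eq_path ee).
Qed.

End Correctness.

Local Open Scope cat_scope.

(** * Tests in a star-autonomous category *)

Section Scalars.
Variable S : smcat.
Implicit Types (a b : hom (tunit : S) tunit).

(** Up to the unit isomorphisms both composites are the tensor of a and b, as λ and ρ agree at I. *)
Lemma scalC a b : a ∘ b = b ∘ a.
Proof.
have ea : a = lun _ ∘ (idc _ ⊗m a) ∘ luni _ by rewrite lun_nat compA luniK compf1.
have eb : b = lun _ ∘ (b ⊗m idc _) ∘ luni _.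
  by rewrite lun_run run_nat compA luni_runi runiK compf1.
have key f g : lun _ ∘ f ∘ luni _ ∘ (lun _ ∘ g ∘ luni _)
    = lun tunit ∘ (f ∘ g) ∘ luni tunit :> hom (tunit : S) tunit.
  by rewrite !compA (pre _ (lunK _)) comp1f.
by rewrite ea eb !key tens_lr tens_rl.
Qed.

End Scalars.

Section Tests.
Variable D : star_autonomous.
Variables (iota : hom (tunit : D) bot) (iotai : hom (bot : D) tunit).
Hypothesis iotaiK : iotai ∘ iota = idc _.
Hypothesis iotaK : iota ∘ iotai = idc _.
Implicit Types (A B X Y : D).

(* Arrows A → I are called tests on A.  The tests on A ⊗ B, A^⊥ and A ⅋ B are
   built from tests on A and B, and from points of A. *)
Definition tens_test A B (t : hom A tunit) (s : hom B tunit) : hom (A ⊗ B) tunit :=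
  lun _ ∘ (t ⊗m s).
Definition dual_test A (a : hom tunit A) : hom A^⊥ tunit := iotai ∘ dualm a.
Definition dual_point A (t : hom A tunit) : hom tunit A^⊥ :=
  dualm (iota ∘ t) ∘ chi tunit.
Definition par_test A B (t : hom A tunit) (s : hom B tunit) : hom (par A B) tunit :=
  iotai ∘ dualm ((dual_point t ⊗m dual_point s) ∘ luni tunit).

Lemma tens_test_point A B (t : hom A tunit) (s : hom B tunit)
    (a : hom tunit A) (b : hom tunit B) :
  tens_test t s ∘ ((a ⊗m b) ∘ luni _) = (t ∘ a) ∘ (s ∘ b).
Proof.
rewrite /tens_test compA (pre _ (esym (tensmD _ _ _ _))) -(tens_lr (t ∘ a)).
rewrite lun_run !compA (pre _ (run_nat _)) compA -lun_run (pre _ (lun_nat _)).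
by rewrite !compA luniK compf1.
Qed.

Lemma tens_test_r A B (t : hom A tunit) (s : hom B tunit)
    (v : hom tunit B) :
  tens_test t s ∘ (idc A ⊗m v) ∘ runi A = (s ∘ v) ∘ t.
Proof.
rewrite /tens_test !compA (pre _ (esym (tensmD _ _ _ _))) compf1.
rewrite -(tens_rl t) !compA (pre _ (lun_nat _)) !compA lun_run.
by rewrite (pre _ (run_nat _)) !compA runiK compf1.
Qed.

Lemma tens_test_l A B (t : hom A tunit) (s : hom B tunit)
    (u : hom tunit A) :
  tens_test t s ∘ (u ⊗m idc B) ∘ luni B = (t ∘ u) ∘ s.
Proof.
rewrite /tens_test !compA (pre _ (esym (tensmD _ _ _ _))) compf1.
rewrite -(tens_lr (t ∘ u)) lun_run !compA (pre _ (run_nat _)) !compA -lun_run.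
by rewrite (pre _ (lun_nat _)) !compA luniK compf1.
Qed.

Lemma dualm_scal (z : hom tunit (bot : D)) : dualm z ∘ chi tunit = z.
Proof.
rewrite dualm_point !compA runi_nat (pre _ (tens_rl _ _)) -(tens_lr (chi tunit)).
rewrite !compA (pre _ (ev_bot_chi _)) (pre _ (lun_nat _)) !compA.
by rewrite -luni_runi luniK compf1.
Qed.

Lemma dual_test_point A (a : hom tunit A) (t : hom A tunit) :
  dual_test a ∘ dual_point t = t ∘ a.
Proof.
rewrite /dual_test /dual_point compA (pre _ (esym (dualmD _ _))) compA.
rewrite dualm_scal.
by rewrite -!compA iotaiK comp1f.
Qed.

Lemma dual_point_surj A (w : hom tunit A^⊥) : exists t, w = dual_point t.
Proof.
exists (iotai ∘ (dualm w ∘ chi A)); rewrite /dual_point -compA iotaK comp1f.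
rewrite dualmD compA.
have -> : dualm (dualm w) ∘ chi tunit = chi _ ∘ w by rewrite chi_nat.
by rewrite -compA dualm_chi comp1f.
Qed.

Lemma dual_point_comp A B (f : hom A B) (t : hom B tunit) :
  dual_point (t ∘ f) = dualm f ∘ dual_point t.
Proof. by rewrite /dual_point -compA dualmD compA. Qed.

Lemma tens_test_comp A A' B B' (t : hom A' tunit) (s : hom B' tunit)
    (f : hom A A') (g : hom B B') :
  tens_test t s ∘ (f ⊗m g) = tens_test (t ∘ f) (s ∘ g).
Proof. by rewrite /tens_test compA -tensmD. Qed.

Lemma par_test_comp A A' B B' (t : hom A' tunit) (s : hom B' tunit)
    (f : hom A A') (g : hom B B') :
  par_test t s ∘ parm f g = par_test (t ∘ f) (s ∘ g).
Proof.
rewrite /par_test /parm compA -dualmD (pre _ (esym (tensmD _ _ _ _))).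
by rewrite !dual_point_comp.
Qed.

Lemma dual_test_comp A B (g : hom A B) (a : hom tunit A) :
  dual_test a ∘ dualm g = dual_test (g ∘ a).
Proof. by rewrite /dual_test compA -dualmD. Qed.

Lemma par_test_braid A B (t : hom A tunit) (s : hom B tunit) :
  par_test t s ∘ par_braid B A = par_test s t.
Proof.
rewrite /par_test /par_braid compA -dualmD -!compA braid_nat !compA.
by rewrite runi_braid luni_runi.
Qed.

Lemma dualm_pairing A (m : hom tunit A) (w : hom tunit A^⊥) :
  dualm m ∘ w = ev A ∘ (w ⊗m m) ∘ luni _.
Proof.
by rewrite dualm_point !compA runi_nat (pre _ (tens_rl _ _)) luni_runi.
Qed.

Lemma par_test_name A X (t : hom A tunit) (s : hom X tunit) (g : hom X^⊥ A) :
  par_test t s ∘ name g = t ∘ (g ∘ dual_point s).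
Proof.
rewrite /par_test compA dualm_pairing /name -(tens_lr (tr _)) !compA.
rewrite (pre _ (trK _)) !compA -luni_nat (pre _ (luniK _)) comp1f.
rewrite (pre _ (esym (tensmD _ _ _ _))) comp1f -(tens_lr (dual_point t)) !compA.
rewrite (pre _ (ev_copoint _)) !compA (pre _ (lun_nat _)) !compA luniK compf1.
by rewrite (pre _ iotaiK) comp1f.
Qed.

Lemma ev_chii A X (k : hom X A^⊥^⊥) :
  ev A ∘ (idc A^⊥ ⊗m (chii A ∘ k)) = ev A^⊥ ∘ (k ⊗m idc A^⊥) ∘ braid A^⊥ X.
Proof.
have {2}-> : k = chi A ∘ (chii A ∘ k) by rewrite -compA chiiK comp1f.
by rewrite tensD1 !compA (pre _ (ev_chi _)) !compA -braid_nat (pre _ (braidK _ _)) comp1f.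
Qed.

Lemma name_coname A X (w : hom tunit (par A X)) : name (coname w) = w.
Proof.
rewrite /name /coname ev_chii trK !compA (pre _ (braidK _ _)) comp1f.
by rewrite lunK compf1 tr_uniq.
Qed.

Lemma coname_inj A X (w w' : hom tunit (par A X)) : coname w = coname w' -> w = w'.
Proof. by move=> e; rewrite -(name_coname w) e name_coname. Qed.

Lemma par_test_coname A X (t : hom A tunit) (s : hom X tunit)
    (w : hom tunit (par A X)) :
  par_test t s ∘ w = t ∘ (coname w ∘ dual_point s).
Proof. by rewrite -{1}(name_coname w) par_test_name. Qed.

(** The form in which multilinearity is used throughout: with one argument of the test fixed, a
    point of A ⅋ X acts as a point of A. *)
Lemma par_contract_r A X (w : hom tunit (par A X)) (s : hom X tunit) :
  exists u, forall t, par_test t s ∘ w = t ∘ u.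
Proof. by exists (coname w ∘ dual_point s) => t; exact: par_test_coname. Qed.

Lemma par_contract_l A X (w : hom tunit (par A X)) (t : hom A tunit) :
  exists u, forall s, par_test t s ∘ w = s ∘ u.
Proof.
have [u hu] := par_contract_r (par_braid A X ∘ w) t; exists u => s.
by rewrite -hu -compA par_test_braid.
Qed.

Lemma tens_contract_r A X (w : hom tunit (A ⊗ X)) (s : hom X tunit) :
  exists u, forall t, tens_test t s ∘ w = t ∘ u.
Proof.
exists (run _ ∘ (idc A ⊗m s) ∘ w) => t.
by rewrite /tens_test -(tens_lr t) lun_run !compA (pre _ (run_nat _)) !compA.
Qed.

Lemma tens_contract_l A X (w : hom tunit (A ⊗ X)) (t : hom A tunit) :
  exists u, forall s, tens_test t s ∘ w = s ∘ u.
Proof.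
exists (lun _ ∘ (t ⊗m idc X) ∘ w) => s.
by rewrite /tens_test -(tens_rl t) !compA (pre _ (lun_nat _)) !compA.
Qed.


Hypothesis points_sep : forall A B (f g : hom A B),
  (forall h : hom tunit A, f ∘ h = g ∘ h) -> f = g.
Hypothesis tens_tests_sep : forall A B (w w' : hom tunit (A ⊗ B)),
  (forall t s, tens_test t s ∘ w = tens_test t s ∘ w') -> w = w'.

Lemma dualm_inj A B (f g : hom A B) : dualm f = dualm g -> f = g.
Proof. by move=> e; apply: (split_mono (chiK _)); rewrite !chi_nat e. Qed.

(** The duals of a and a' are arrows out of A^⊥, which are separated by points, and points of A^⊥
    are tests on A. *)
Lemma tests_sep A (a a' : hom tunit A) :
  (forall t : hom A tunit, t ∘ a = t ∘ a') -> a = a'.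
Proof.
move=> h; apply: dualm_inj; apply: points_sep => w.
have [t ->] := dual_point_surj w.
apply: (split_mono iotaK).
by have := h t; rewrite -(dual_test_point a) -(dual_test_point a') /dual_test !compA.
Qed.

Definition separating A (T : hom A tunit -> Prop) :=
  forall a a' : hom tunit A, (forall t, T t -> t ∘ a = t ∘ a') -> a = a'.

Lemma dual_tests_separating A : separating (fun t => exists a, t = dual_test (A := A) a).
Proof.
move=> w w'; have [t ->] := dual_point_surj w; have [t' ->] := dual_point_surj w'.
move=> h; congr dual_point; apply: points_sep => a.
by rewrite -(dual_test_point a t) -(dual_test_point a t'); apply: h; exists a.
Qed.

Section Separation.
Variables (A B X : D) (test : hom A tunit -> hom B tunit -> hom X tunit).
Hypothesis contract_r : forall (w : hom tunit X) s, exists u, forall t, test t s ∘ w = t ∘ u.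
Hypothesis contract_l : forall (w : hom tunit X) t, exists u, forall s, test t s ∘ w = s ∘ u.

(** One argument of the test is replaced at a time, the other being contracted with the point. *)
Lemma separating_all T S (w w' : hom tunit X) : separating T -> separating S ->
  (forall t s, T t -> S s -> test t s ∘ w = test t s ∘ w') ->
  forall t s, test t s ∘ w = test t s ∘ w'.
Proof using contract_l contract_r.
move=> sT sS h t s.
have {}h t0 s0 : S s0 -> test t0 s0 ∘ w = test t0 s0 ∘ w'.
  move=> Ss0; have [u hu] := contract_r w s0; have [u' hu'] := contract_r w' s0.
  by rewrite hu hu'; congr (_ ∘ _); apply: sT => t1 Tt1; rewrite -hu -hu'; apply: h.
have [u hu] := contract_l w t; have [u' hu'] := contract_l w' t.
by rewrite hu hu'; congr (_ ∘ _); apply: sS => s1 Ss1; rewrite -hu -hu'; apply: h.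
Qed.

End Separation.

Lemma par_separating A B T S : separating T -> separating S ->
  separating (fun z => exists t s, [/\ T t, S s & z = par_test (A := A) (B := B) t s]).
Proof.
move=> sT sS w w' h; apply: coname_inj; apply: points_sep => p.
have [s ->] := dual_point_surj p; apply: tests_sep => t.
rewrite -!par_test_coname; apply: separating_all sT sS _ t s.
- exact: par_contract_r.
- exact: par_contract_l.
- by move=> t s Tt Ss; apply: h; exists t, s.
Qed.

Lemma tens_separating A B T S : separating T -> separating S ->
  separating (fun z => exists t s, [/\ T t, S s & z = tens_test (A := A) (B := B) t s]).
Proof.
move=> sT sS w w' h; apply: tens_tests_sep.
apply: separating_all sT sS _.
- exact: tens_contract_r.
- exact: tens_contract_l.
- by move=> t s Tt Ss; apply: h; exists t, s.
Qed.

End Tests.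

(** * Points of a tensor product in a compact closed category *)

Section CompactSeparation.
Variables (S : smcat) (A B L : S) (eta : hom tunit (L ⊗ B)) (eps : hom (B ⊗ L) tunit).
Hypothesis zag : (eps ⊗m idc B) ∘ associ _ _ _ ∘ (idc B ⊗m eta) = luni B ∘ run B.

(** The transpose of w is an arrow out of L; bending it back gives w by the triangle identity
    [zag]. *)
Lemma point_transpose (w : hom tunit (A ⊗ B)) :
  (run A ⊗m idc B) ∘ (((idc A ⊗m eps) ∘ assoc _ _ _ ∘ (w ⊗m idc L)) ⊗m idc B)
    ∘ associ _ _ _ ∘ (idc tunit ⊗m eta) ∘ runi tunit = w.
Proof using zag.
have p : (assoc A B L ⊗m idc B) ∘ associ (A ⊗ B) L B
    = associ A (B ⊗ L) B ∘ (idc A ⊗m associ B L B) ∘ assoc A B (L ⊗ B).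
  apply: (split_epi (associK _ _ _)); rewrite !compA assocK compf1 pentagon.
  rewrite (pre _ (esym (tens1D _ _ _))) assocK tensm1 comp1f.
  by rewrite (pre _ (assocK _ _ _)) comp1f.
have q : (run A ⊗m idc B) ∘ associ A tunit B = idc A ⊗m lun B.
  by rewrite -triangle compA associK compf1.
rewrite !tensD1 !compA (pre _ (esym (associ_nat _ _ _))) tensm1 !compA.
rewrite (pre _ (tens_lr _ _)) -(tens_rl w) !compA -runi_nat.
rewrite (pre _ p) !compA -tensm1 (pre _ (assoc_nat _ _ _)) !compA.
rewrite (pre _ (esym (associ_nat _ _ _))) !compA (pre _ q).
rewrite 3!(pre _ (esym (tens1D _ _ _))).
move: zag; rewrite !compA => ->; rewrite (pre _ (luniK _)) comp1f.
by rewrite (pre _ (runM _ _)) (pre _ (runiK _)) comp1f.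
Qed.

Lemma transpose_point (w : hom tunit (A ⊗ B)) (l : hom tunit L) :
  (run A ∘ ((idc A ⊗m eps) ∘ assoc _ _ _ ∘ (w ⊗m idc L))) ∘ (luni L ∘ l)
  = run A ∘ (idc A ⊗m (eps ∘ (idc B ⊗m l) ∘ runi B)) ∘ w.
Proof using.
rewrite !tens1D !compA -runiM !compA runi_nat luni_nat luni_runi.
rewrite (pre _ (tens_lr _ _)) -(tens_rl w) !compA -tensm1.
by rewrite (pre _ (assoc_nat _ _ _)) !compA.
Qed.

End CompactSeparation.

(** The transposes of w and w' are arrows out of [cdual B], so it is enough to compare them at
    points l; there they are w and w' contracted with the test on B that l induces. *)
Lemma compact_tens_tests_sep (C : compact_closed) :
  (forall (A B : C) (f g : hom A B),
    (forall h : hom tunit A, f ∘ h = g ∘ h) -> f = g) ->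
  (forall (A : C) (a a' : hom tunit A),
    (forall t : hom A tunit, t ∘ a = t ∘ a') -> a = a') ->
  forall (A B : C) (w w' : hom tunit (A ⊗ B)),
  (forall (t : hom A tunit) (s : hom B tunit),
    lun _ ∘ (t ⊗m s) ∘ w = lun _ ∘ (t ⊗m s) ∘ w') -> w = w'.
Proof.
move=> gen sep A B w w' h; have zag := dual_pair_sym_zag (zigzag B).
rewrite -(point_transpose zag w) -(point_transpose zag w').
suff -> : (idc A ⊗m (counit B ∘ braid B (cdual B))) ∘ assoc A B (cdual B) ∘ (w ⊗m idc _)
  = (idc A ⊗m (counit B ∘ braid B (cdual B))) ∘ assoc A B (cdual B) ∘ (w' ⊗m idc _) by [].
apply: (split_mono (runK A)); apply: gen => l.
have {l}[l ->] : exists l', l = luni _ ∘ l'.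
  by exists (lun _ ∘ l); rewrite -compA lunK comp1f.
rewrite !transpose_point; apply: sep => t.
move: (h t (counit B ∘ braid B (cdual B) ∘ (idc B ⊗m l) ∘ runi B)).
by rewrite -(tens_lr t) lun_run !compA !(pre _ (run_nat _)) !compA.
Qed.

Section ParTests.
Variable D : star_autonomous.
Variables (iota : hom (tunit : D) bot) (iotai : hom (bot : D) tunit).
Hypothesis iotaiK : iotai ∘ iota = idc _.
Hypothesis iotaK : iota ∘ iotai = idc _.
Implicit Types (A B X Y : D).
Local Notation par_test := (par_test iota iotai).
Local Notation dual_test := (dual_test iotai).
Local Notation dual_point := (dual_point iota).

Lemma chii_chi A B (f : hom B A) : chii A ∘ (chi A ∘ f) = f.
Proof. by rewrite -compA (chiK A : chii A ∘ chi A = _) comp1f. Qed.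

Lemma iotaiotai A (f : hom A bot) : iota ∘ (iotai ∘ f) = f.
Proof. by rewrite -compA iotaK comp1f. Qed.

Lemma par_testE A B (t : hom A tunit) (s : hom B tunit) :
  par_test t s = iotai ∘ dualm ((dual_point t ⊗m dual_point s) ∘ luni tunit).
Proof. by []. Qed.

Lemma dual_test_dualm A B (f : hom A B) (a : hom tunit A) :
  iotai ∘ dualm a ∘ dualm f = iotai ∘ dualm (f ∘ a).
Proof. by rewrite dualmD compA. Qed.

Lemma dual_testE A (a : hom tunit A) : dual_test a = iotai ∘ dualm a.
Proof. by []. Qed.

Lemma dual_pointE A (t : hom A tunit) : dual_point t = dualm (iota ∘ t) ∘ chi tunit.
Proof. by []. Qed.

Lemma dual_point_par_test A B (t : hom A tunit) (s : hom B tunit) :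
  dual_point (par_test t s)
  = chi _ ∘ ((dual_point t ⊗m dual_point s) ∘ luni _).
Proof. by rewrite dual_pointE par_testE iotaiotai chi_nat. Qed.

Lemma dual_point_dual_test A (a : hom tunit A) :
  dual_point (dual_test a) = chi _ ∘ a.
Proof. by rewrite dual_pointE iotaiotai chi_nat. Qed.

Lemma dual_point_iotai : dual_point iotai = chi tunit.
Proof. by rewrite dual_pointE iotaK dualm1 comp1f. Qed.

Lemma par_test_assoc A B X (t : hom A tunit) (s : hom B tunit) (r : hom X tunit) :
  par_test t (par_test s r) ∘ par_assoc A B X = par_test (par_test t s) r.
Proof.
rewrite (par_testE t (par_test s r)) (par_testE (par_test t s) r) /par_assoc dual_test_dualm; congr (_ ∘ dualm _).
rewrite !dual_point_par_test !compA (pre _ (esym (tensmD _ _ _ _))).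
rewrite comp1f chii_chi -assoc_pts.
rewrite (pre _ (assocK _ _ _)) comp1f (pre _ (esym (tensmD _ _ _ _))) comp1f.
by rewrite -compA.
Qed.

Lemma par_test_associ A B X (t : hom A tunit) (s : hom B tunit) (r : hom X tunit) :
  par_test (par_test t s) r ∘ par_associ A B X = par_test t (par_test s r).
Proof.
rewrite (par_testE t (par_test s r)) (par_testE (par_test t s) r) /par_associ dual_test_dualm; congr (_ ∘ dualm _).
rewrite !dual_point_par_test !compA (pre _ (esym (tensmD _ _ _ _))).
rewrite comp1f chii_chi assoc_pts.
by rewrite (pre _ (esym (tensmD _ _ _ _))) comp1f -compA.
Qed.

Lemma par_test_exch A B X (t : hom A tunit) (s : hom B tunit) (r : hom X tunit) :
  par_test s (par_test t r)
    ∘ (par_assoc B A X ∘ parm (par_braid A B) (idc X) ∘ par_associ A B X)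
  = par_test t (par_test s r).
Proof.
rewrite -2!compA par_test_assoc par_test_comp compf1 par_test_braid.
exact: par_test_associ.
Qed.

Lemma dual_test_dual_point A (t : hom A tunit) :
  dual_test (dual_point t) = t ∘ chii A.
Proof.
rewrite dual_testE dual_pointE dualmD.
have -> : dualm (dualm (iota ∘ t)) = chi _ ∘ (iota ∘ t ∘ chii A).
  by rewrite -compA chi_nat compA (chiiK A : chi A ∘ chii A = _) compf1.
by rewrite -(compA _ (chi _)) dualm_chi comp1f -!compA iotaiK comp1f.
Qed.

Lemma test_par_run A (t : hom A tunit) : t ∘ par_run A = par_test t iotai.
Proof.
rewrite /par_run -compA -dual_test_dual_point dual_test_dualm.
rewrite par_testE dual_point_iotai !compA runi_nat (pre _ (tens_rl _ _)).
by rewrite luni_runi.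
Qed.

Lemma par_test_runi A (t : hom A tunit) : par_test t iotai ∘ par_runi A = t.
Proof.
rewrite /par_runi par_testE dual_point_iotai -compA dual_test_dualm.
rewrite !compA (pre _ (esym (tensmD _ _ _ _))) comp1f (chiK tunit : chii _ ∘ chi _ = _).
rewrite (pre _ (run_nat _)) luni_runi !compA runiK compf1.
by rewrite -compA -dual_testE dual_test_dual_point compA (chiK A : chii _ ∘ chi _ = _) compf1.
Qed.

Lemma test_par_lun A (t : hom A tunit) : t ∘ par_lun A = par_test iotai t.
Proof. by rewrite /par_lun -compA test_par_run par_test_braid. Qed.

Lemma tens_rule_test A B X Y (t : hom A tunit) (s : hom B tunit)
    (p : hom X tunit) (q : hom Y tunit) u v :
  par_test (tens_test t s) (par_test p q) ∘ tens_rule u v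
  = (par_test t p ∘ u) ∘ (par_test s q ∘ v).
Proof.
rewrite /tens_rule par_test_name // dual_point_par_test.
rewrite (compA (coname u ⊗m coname v)) chii_chi -(compA (coname u ⊗m coname v)).
rewrite -tensmD tens_test_point.
by rewrite !par_test_coname.
Qed.

Lemma axiom_test A (t : hom A tunit) (a : hom tunit A) :
  par_test t (dual_test a) ∘ name (chii A) = t ∘ a.
Proof. by rewrite par_test_name // dual_point_dual_test chii_chi. Qed.

End ParTests.

(** * Tests on formulas and sequents *)

Section FormulaTests.
Variable D : star_autonomous.
Variables (iota : hom (tunit : D) bot) (iotai : hom (bot : D) tunit).
Hypothesis iotaiK : iotai ∘ iota = idc _.
Hypothesis iotaK : iota ∘ iotai = idc _.
Local Notation par_test := (par_test iota iotai).
Local Notation dual_test := (dual_test iotai).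
Local Notation dual_point := (dual_point iota).
Variable N : nat.
Implicit Types (R S : 'I_N -> glue D) (A B : formula N) (G H : seq (formula N)).

Definition car (P : glue D) : D := @gcar D P.
Definition und (P Q : glue D) (f : hom P Q) : hom (car P) (car Q) := proj1_sig f.

Lemma und_comp (P Q T : glue D) (g : hom Q T) (f : hom P Q) :
  und (g ∘ f) = und g ∘ und f.
Proof. by []. Qed.

Lemma und_parm (P P' Q Q' : glue D) (f : hom P P') (g : hom Q Q') :
  und (parm f g) = parm (und f) (und g).
Proof. by []. Qed.

(* Assignments of tests to the positive literals and of points to the negative
   ones, for paths in a formula and for addresses in a sequent. *)
Definition tests R (T : Type) := T -> forall i, hom (car (R i)) tunit.
Definition points R (T : Type) := T -> forall i, hom tunit (car (R i)).

Fixpoint ftest R S A (x : tests R (seq bool)) (y : points S (seq bool)) :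
    hom (car (fobj R S A)) tunit :=
  match A with
  | Lit true i => x [::] i
  | Lit false i => dual_test (y [::] i)
  | Tens A B => tens_test
      (ftest A (fun p => x (false :: p)) (fun p => y (false :: p)))
      (ftest B (fun p => x (true :: p)) (fun p => y (true :: p)))
  | Par A B => par_test
      (ftest A (fun p => x (false :: p)) (fun p => y (false :: p)))
      (ftest B (fun p => x (true :: p)) (fun p => y (true :: p)))
  end.

Definition hd_tests R (x : tests R addr) : tests R (seq bool) := fun p => x (0, p).
Definition tl_tests R (x : tests R addr) : tests R addr := fun v => x (v.1.+1, v.2).
Definition hd_points R (x : points R addr) : points R (seq bool) := fun p => x (0, p).
Definition tl_points R (x : points R addr) : points R addr := fun v => x (v.1.+1, v.2).

Fixpoint stest R S A G (x : tests R addr) (y : points S addr) :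
    hom (car (seqobj R S A G)) tunit :=
  match G with
  | [::] => ftest A (hd_tests x) (hd_points y)
  | B :: G' => par_test (ftest A (hd_tests x) (hd_points y))
      (stest B G' (tl_tests x) (tl_points y))
  end.

Lemma ftest_fmap R R' S S' (f : forall i, hom (R i) (R' i))
    (g : forall i, hom (S' i) (S i)) A x y :
  ftest A x y ∘ und (fmap f g A)
  = ftest A (fun p i => x p i ∘ und (f i)) (fun p i => und (g i) ∘ y p i).
Proof.
elim: A x y => [[] i|A IA B IB|A IA B IB] x y /=.
- by [].
- exact: dual_test_comp.
- by rewrite -IA -IB -tens_test_comp.
- by rewrite -IA -IB -par_test_comp.
Qed.

Lemma stest_seqmap R R' S S' (f : forall i, hom (R i) (R' i))
    (g : forall i, hom (S' i) (S i)) A G x y :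
  stest A G x y ∘ und (seqmap f g A G)
  = stest A G (fun p i => x p i ∘ und (f i)) (fun p i => und (g i) ∘ y p i).
Proof.
elim: G A x y => [|B G IH] A x y /=; first exact: ftest_fmap.
apply: etrans (par_test_comp _ _ _ _ _ _) _; congr par_test.
  exact: ftest_fmap.
exact: IH.
Qed.

Definition agree R S A (x x' : tests R (seq bool)) (y y' : points S (seq bool)) :=
  forall p i, (subf A p = Some (Lit true i) -> x p i = x' p i) /\
              (subf A p = Some (Lit false i) -> y p i = y' p i).
Definition sagree R S G (x x' : tests R addr) (y y' : points S addr) :=
  forall v i, (occ G v = Some (Lit true i) -> x v i = x' v i) /\
              (occ G v = Some (Lit false i) -> y v i = y' v i).

Lemma eq_ftest R S A (x x' : tests R (seq bool)) (y y' : points S (seq bool)) :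
  agree A x x' y y' -> ftest A x y = ftest A x' y'.
Proof.
elim: A x x' y y' => [[] i|A IA B IB|A IA B IB] x x' y y' e /=.
- by case: (e [::] i) => -> .
- by congr dual_test; case: (e [::] i) => _ ->.
- by congr tens_test; [apply: IA => p i; apply: (e (false :: p))
    |apply: IB => p i; apply: (e (true :: p))].
- by congr par_test; [apply: IA => p i; apply: (e (false :: p))
    |apply: IB => p i; apply: (e (true :: p))].
Qed.

Lemma eq_stest R S A G (x x' : tests R addr) (y y' : points S addr) :
  sagree (A :: G) x x' y y' -> stest A G x y = stest A G x' y'.
Proof.
elim: G A x x' y y' => [|B G IH] A x x' y y' e /=.
  by apply: eq_ftest => p i; apply: (e (0, p)).
congr par_test; first by apply: eq_ftest => p i; apply: (e (0, p)).
by apply: IH => v i; apply: (e (v.1.+1, v.2)).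
Qed.

(* For fixed values at the other literals, tests are linear in each literal. *)
Definition agree_but R S A q (x x' : tests R (seq bool)) (y y' : points S (seq bool)) :=
  forall p i, p <> q -> (subf A p = Some (Lit true i) -> x p i = x' p i) /\
              (subf A p = Some (Lit false i) -> y p i = y' p i).
Definition sagree_but R S G w (x x' : tests R addr) (y y' : points S addr) :=
  forall v i, v <> w -> (occ G v = Some (Lit true i) -> x v i = x' v i) /\
              (occ G v = Some (Lit false i) -> y v i = y' v i).

Definition flinear R S A := forall q (x : tests R (seq bool)) (y : points S (seq bool))
    (w : hom tunit (car (fobj R S A))),
  (forall i, subf A q = Some (Lit true i) -> exists u, forall x' y',
    agree_but A q x x' y y' -> ftest A x' y' ∘ w = x' q i ∘ u) /\
  (forall i, subf A q = Some (Lit false i) -> exists t, forall x' y',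
    agree_but A q x x' y y' -> ftest A x' y' ∘ w = t ∘ y' q i).

Lemma flinear_step R S A B F (X : D)
    (test : hom (car (fobj R S A)) tunit -> hom (car (fobj R S B)) tunit -> hom X tunit) :
  (forall (w : hom tunit X) s, exists u, forall t, test t s ∘ w = t ∘ u) ->
  (forall (w : hom tunit X) t, exists u, forall s, test t s ∘ w = s ∘ u) ->
  (forall c p, subf F (c :: p) = subf (if c then B else A) p) ->
  flinear R S A -> flinear R S B ->
  forall c q (x : tests R (seq bool)) (y : points S (seq bool)) (w : hom tunit X),
  let ft x' y' := test (ftest A (fun p => x' (false :: p)) (fun p => y' (false :: p)))
                       (ftest B (fun p => x' (true :: p)) (fun p => y' (true :: p))) in
  (forall i, subf F (c :: q) = Some (Lit true i) -> exists u, forall x' y',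
    agree_but F (c :: q) x x' y y' -> ft x' y' ∘ w = x' (c :: q) i ∘ u) /\
  (forall i, subf F (c :: q) = Some (Lit false i) -> exists t, forall x' y',
    agree_but F (c :: q) x x' y y' -> ft x' y' ∘ w = t ∘ y' (c :: q) i).
Proof.
move=> cr cl subF lA lB c q x y w; cbv zeta.
have agc x' y' b p i : agree_but F (c :: q) x x' y y' -> b :: p <> c :: q ->
    (subf (if b then B else A) p = Some (Lit true i) -> x (b :: p) i = x' (b :: p) i) /\
    (subf (if b then B else A) p = Some (Lit false i) -> y (b :: p) i = y' (b :: p) i).
  by move=> e ne; have := e (b :: p) i ne; rewrite subF.
rewrite subF; case: c agc => agc.
- have [u hu] := cl w (ftest A (fun p => x (false :: p)) (fun p => y (false :: p))).
  have [I1 I2] := lB q (fun p => x (true :: p)) (fun p => y (true :: p)) u.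
  have key x' y' : agree_but F (true :: q) x x' y y' ->
      test (ftest A (fun p => x' (false :: p)) (fun p => y' (false :: p)))
        (ftest B (fun p => x' (true :: p)) (fun p => y' (true :: p))) ∘ w
      = ftest B (fun p => x' (true :: p)) (fun p => y' (true :: p)) ∘ u.
    move=> e; rewrite -hu; congr (test _ _ ∘ _); apply: eq_ftest => p i.
    by have [//|h1 h2] := agc _ _ false p i e; split=> h; rewrite ?h1 ?h2.
  have key2 x' y' : agree_but F (true :: q) x x' y y' ->
      agree_but B q (fun p => x (true :: p)) (fun p => x' (true :: p))
        (fun p => y (true :: p)) (fun p => y' (true :: p)).
    by move=> e p i pq; apply: (agc _ _ true p i e) => -[].
  split=> i hi; [have [v hv] := I1 i hi|have [v hv] := I2 i hi]; exists v => x' y' e;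
  exact: etrans (key _ _ e) (hv _ _ (key2 _ _ e)).
- have [u hu] := cr w (ftest B (fun p => x (true :: p)) (fun p => y (true :: p))).
  have [I1 I2] := lA q (fun p => x (false :: p)) (fun p => y (false :: p)) u.
  have key x' y' : agree_but F (false :: q) x x' y y' ->
      test (ftest A (fun p => x' (false :: p)) (fun p => y' (false :: p)))
        (ftest B (fun p => x' (true :: p)) (fun p => y' (true :: p))) ∘ w
      = ftest A (fun p => x' (false :: p)) (fun p => y' (false :: p)) ∘ u.
    move=> e; rewrite -hu; congr (test _ _ ∘ _); apply: eq_ftest => p i.
    by have [//|h1 h2] := agc _ _ true p i e; split=> h; rewrite ?h1 ?h2.
  have key2 x' y' : agree_but F (false :: q) x x' y y' ->
      agree_but A q (fun p => x (false :: p)) (fun p => x' (false :: p))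
        (fun p => y (false :: p)) (fun p => y' (false :: p)).
    by move=> e p i pq; apply: (agc _ _ false p i e) => -[].
  split=> i hi; [have [v hv] := I1 i hi|have [v hv] := I2 i hi]; exists v => x' y' e;
  exact: etrans (key _ _ e) (hv _ _ (key2 _ _ e)).
Qed.

Lemma ftest_linear R S A : flinear R S A.
Proof.
elim: A => [b i|A IA B IB|A IA B IB] [|c q] x y w; try by split.
- case: b w => w; split=> j //= [<-]; first by exists w.
  have [t et] := dual_point_surj iotaK w.
  by exists t => x' y' _; rewrite et dual_test_point.
- apply: (flinear_step (test := @tens_test _ _ _)) => //.
  + by move=> w' s; apply: tens_contract_r.
  + by move=> w' s; apply: tens_contract_l.
- apply: (flinear_step (test := fun t s => par_test t s)) => //.
  + by move=> w' s; apply: par_contract_r.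
  + by move=> w' s; apply: par_contract_l.
Qed.

Lemma stest_linear R S A G q (x : tests R addr) (y : points S addr)
    (w : hom tunit (car (seqobj R S A G))) :
  (forall i, occ (A :: G) q = Some (Lit true i) -> exists u, forall x' y',
    sagree_but (A :: G) q x x' y y' -> stest A G x' y' ∘ w = x' q i ∘ u) /\
  (forall i, occ (A :: G) q = Some (Lit false i) -> exists t, forall x' y',
    sagree_but (A :: G) q x x' y y' -> stest A G x' y' ∘ w = t ∘ y' q i).
Proof.
elim: G A q x y w => [|B G IH] A [k p] x y w.
  case: k => [|k]; last by rewrite /occ /= onth0n; split.
  have [I1 I2] := @ftest_linear R S A p (hd_tests x) (hd_points y) w.
  have key x' y' : sagree_but [:: A] (0, p) x x' y y' ->
      agree_but A p (hd_tests x) (hd_tests x') (hd_points y) (hd_points y').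
    by move=> e p' i pp; apply: (e (0, p')) => -[].
  split=> i hi; [have [v hv] := I1 i hi|have [v hv] := I2 i hi]; exists v => x' y' e;
  by apply: hv; apply: key.
case: k => [|k].
  have [u hu] := par_contract_r iotaiK w (stest B G (tl_tests x) (tl_points y)).
  have [I1 I2] := @ftest_linear R S A p (hd_tests x) (hd_points y) u.
  have key x' y' : sagree_but [:: A, B & G] (0, p) x x' y y' ->
      agree_but A p (hd_tests x) (hd_tests x') (hd_points y) (hd_points y').
    by move=> e p' i pp; apply: (e (0, p')) => -[].
  have key2 x' y' : sagree_but [:: A, B & G] (0, p) x x' y y' ->
      stest A (B :: G) x' y' ∘ w = ftest A (hd_tests x') (hd_points y') ∘ u.
    move=> e; refine (etrans _ (hu _)); congr (comp (par_test _ _) w).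
    apply: eq_stest => v i.
    by have [//|h1 h2] := e (v.1.+1, v.2) i; split=> h; [exact: esym (h1 h)|exact: esym (h2 h)].
  split=> i hi; [have [v hv] := I1 i hi|have [v hv] := I2 i hi]; exists v => x' y' e;
  exact: etrans (key2 _ _ e) (hv _ _ (key _ _ e)).
have [u hu] := par_contract_l iotaiK w (ftest A (hd_tests x) (hd_points y)).
have [I1 I2] := IH B (k, p) (tl_tests x) (tl_points y) u.
have key x' y' : sagree_but [:: A, B & G] (k.+1, p) x x' y y' ->
    sagree_but (B :: G) (k, p) (tl_tests x) (tl_tests x') (tl_points y) (tl_points y').
  by move=> e [k' p'] i pp; apply: (e (k'.+1, p')) => -[? ?]; subst.
have key2 x' y' : sagree_but [:: A, B & G] (k.+1, p) x x' y y' ->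
    stest A (B :: G) x' y' ∘ w = stest B G (tl_tests x') (tl_points y') ∘ u.
  move=> e; refine (etrans _ (hu _)); congr (comp (par_test _ _) w).
  apply: eq_ftest => v i.
  by have [//|h1 h2] := e (0, v) i; split=> h; [exact: esym (h1 h)|exact: esym (h2 h)].
split=> i hi; [have [v hv] := I1 i hi|have [v hv] := I2 i hi]; exists v => x' y' e;
exact: etrans (key2 _ _ e) (hv _ _ (key _ _ e)).
Qed.

End FormulaTests.

(** * Values of the interpretation of a derivation *)

Section Interp.
Variable D : star_autonomous.
Variables (iota : hom (tunit : D) bot) (iotai : hom (bot : D) tunit).
Hypothesis iotaiK : iotai ∘ iota = idc _.
Hypothesis iotaK : iota ∘ iotai = idc _.
Local Notation par_test := (par_test iota iotai).
Local Notation dual_test := (dual_test iotai).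
Local Notation ftest := (ftest iota iotai).
Local Notation stest := (stest iota iotai).
Variable N : nat.
Variable R : 'I_N -> glue D.
Implicit Types (A B E : formula N) (G H : seq (formula N)).
Implicit Types (x : tests R addr) (y : points R addr).

(** The trailing ⊥ of a context is tested by [iotai], the neutral test for ⅋. *)
Fixpoint ctest G x y : hom (car (ctx R G)) tunit :=
  match G with
  | [::] => iotai
  | A :: G' => par_test (ftest A (hd_tests x) (hd_points y))
      (ctest G' (tl_tests x) (tl_points y))
  end.

Lemma eq_ctest G x x' y y' : x =1 x' -> y =1 y' -> ctest G x y = ctest G x' y'.
Proof.
elim: G x x' y y' => //= A G IH x x' y y' ex ey; congr par_test.
  by apply: eq_ftest => p i; rewrite /hd_tests ex /hd_points ey.
by apply: IH => v; [exact: ex|exact: ey].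
Qed.

Definition drop_addr n v : addr := (v.1 + n, v.2).

Lemma ctest_cat G H x y :
  ctest (G ++ H) x y ∘ und (ctx_cat R G H)
  = par_test (ctest G x y)
      (ctest H (fun v => x (drop_addr (size G) v)) (fun v => y (drop_addr (size G) v))).
Proof.
elim: G x y => [|A G IH] x y /=.
  apply: etrans (test_par_lun iotaiK iotaK _) _; congr par_test.
  by apply: eq_ctest => v; rewrite /drop_addr addn0; case: v.
apply: etrans (par_test_assoc iotaK _ _ _); rewrite -[LHS]compA.
congr (_ ∘ _); apply: etrans (par_test_comp _ _ _ _ _ _) _.
rewrite compf1 [X in par_test _ X]IH; congr (par_test _ (par_test _ _)).
by apply: eq_ctest => v; rewrite /tl_tests /tl_points /drop_addr /= addnS.
Qed.

Lemma ctest_exch G A B H x y :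
  ctest (G ++ B :: A :: H) x y ∘ und (ctx_exch R G A B H)
  = ctest (G ++ A :: B :: H) (fun v => x (addr_exch (size G) v))
      (fun v => y (addr_exch (size G) v)).
Proof.
elim: G x y => [|E G IH] x y /=; last first.
  apply: etrans (par_test_comp _ _ _ _ _ _) _; rewrite compf1 [X in par_test _ X]IH.
  congr par_test; apply: eq_ctest => -[k p];
  by rewrite /tl_tests /tl_points /addr_exch /= !eqSS; case: (k == size G); case: (k == (size G).+1).
apply: etrans (par_test_exch iotaK _ _ _) _; congr (par_test _ (par_test _ _)).
Qed.

Lemma stest_unbot A G x y :
  stest A G x y ∘ und (ctx_unbot R A G) = ctest (A :: G) x y.
Proof.
elim: G A x y => [|B G IH] A x y; first exact: test_par_run.
apply: etrans (par_test_comp _ _ _ _ _ _) _; rewrite compf1.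
by rewrite [X in par_test _ X]IH.
Qed.

Fixpoint link_prod G (d : deriv G) x y : hom (tunit : D) tunit :=
  match d with
  | DAx i => x (0, [::]) i ∘ y (1, [::]) i
  | DTens _ _ G _ d1 d2 =>
      link_prod d1 (fun v => x (addr_tensl v)) (fun v => y (addr_tensl v))
      ∘ link_prod d2 (fun v => x (addr_tensr (size G) v)) (fun v => y (addr_tensr (size G) v))
  | DPar _ _ _ d1 => link_prod d1 (fun v => x (addr_par v)) (fun v => y (addr_par v))
  | DExch G _ _ _ d1 =>
      link_prod d1 (fun v => x (addr_exch (size G) v)) (fun v => y (addr_exch (size G) v))
  end.

Lemma test_tens_rule (P Q X Y Z : glue D) (c : hom (par X Y) Z)
    (u : hom tunit (par P X)) (v : hom tunit (par Q Y))
    (t : hom (car P) tunit) (s : hom (car Q) tunit)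
    (p : hom (car X) tunit) (q : hom (car Y) tunit) (z : hom (car Z) tunit) :
  z ∘ und c = par_test p q ->
  par_test (tens_test t s) z ∘ und (parm (idc (P ⊗ Q)) c ∘ tens_rule u v)
  = (par_test t p ∘ und u) ∘ (par_test s q ∘ und v).
Proof.
move=> zc; rewrite und_comp -compA und_parm par_test_comp compf1 zc.
exact: tens_rule_test.
Qed.

Lemma test_par_rule (P Q X : glue D) (u : hom tunit (par P (par Q X)))
    (t : hom (car P) tunit) (s : hom (car Q) tunit) (r : hom (car X) tunit) :
  par_test (par_test t s) r ∘ und (par_associ P Q X ∘ u)
  = par_test t (par_test s r) ∘ und u.
Proof. by rewrite und_comp -compA; congr comp; apply: par_test_associ. Qed.

Lemma test_axiom (P : glue D) (t : hom (car P) tunit) (a : hom tunit (car P)) :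
  par_test t (par_test (dual_test a) iotai)
    ∘ und (parm (idc P) (par_runi P^⊥) ∘ name (chii P)) = t ∘ a.
Proof.
rewrite und_comp -compA und_parm par_test_comp compf1.
have -> : par_test (dual_test a) iotai ∘ und (par_runi P^⊥) = dual_test a.
  exact: par_test_runi.
exact: axiom_test.
Qed.

Lemma test_comp (P Q : glue D) (c : hom P Q) (u : hom tunit P)
    (t : hom (car P) tunit) (s : hom (car Q) tunit) :
  s ∘ und c = t -> s ∘ und (c ∘ u) = t ∘ und u.
Proof. by move=> <-; rewrite und_comp compA. Qed.

(** At pure tests a derivation is the product of its axiom links: the tensor rule multiplies, the
    other rules only rename addresses. *)
Lemma ctest_interp G (d : deriv G) x y :
  ctest G x y ∘ und (interp_ctx R d) = link_prod d x y.
Proof.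
elim: d x y => {G} [i|A B G H d1 I1 d2 I2|A B G d I|G A B H d I] x y.
- exact: (@test_axiom (R i)).
- pose xl v := x (addr_tensl v); pose yl v := y (addr_tensl v).
  pose xr v := x (addr_tensr (size G) v); pose yr v := y (addr_tensr (size G) v).
  refine (etrans _ (congr2 _ (I1 xl yl) (I2 xr yr))).
  apply: (@test_tens_rule (fobj R R A) (fobj R R B) (ctx R G) (ctx R H) (ctx R (G ++ H))).
  rewrite ctest_cat; congr (par_test _ _); apply: eq_ctest => v //;
  by rewrite /tl_tests /tl_points /drop_addr /xr /yr /addr_tensr /= addSn.
- refine (etrans _ (I _ _)).
  exact: (@test_par_rule (fobj R R A) (fobj R R B) (ctx R G)).
- refine (etrans _ (I _ _)).
  by apply: (@test_comp (ctx R (G ++ A :: B :: H)) (ctx R (G ++ B :: A :: H)));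
    apply: ctest_exch.
Qed.

Lemma stest_interp A G (d : deriv (A :: G)) x y :
  stest A G x y ∘ und (interp d R) = link_prod d x y.
Proof.
refine (etrans _ (ctest_interp _ _ _)).
apply: (@test_comp (ctx R (A :: G)) (seqobj R R A G)); exact: stest_unbot.
Qed.

End Interp.

Section Separating.
Variable D : star_autonomous.
Variables (iota : hom (tunit : D) bot) (iotai : hom (bot : D) tunit).
Hypothesis iotaiK : iotai ∘ iota = idc _.
Hypothesis iotaK : iota ∘ iotai = idc _.
Hypothesis points_sep : forall (A B : D) (f g : hom A B),
  (forall h : hom tunit A, f ∘ h = g ∘ h) -> f = g.
Hypothesis tens_tests_sep : forall (A B : D) (w w' : hom tunit (A ⊗ B)),
  (forall t s, tens_test t s ∘ w = tens_test t s ∘ w') -> w = w'.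
Local Notation par_test := (par_test iota iotai).
Local Notation dual_test := (dual_test iotai).
Local Notation ftest := (ftest iota iotai).
Local Notation stest := (stest iota iotai).
Variable N : nat.
Variables R S : 'I_N -> glue D.
Variables (x0 : forall i, hom (car (R i)) tunit) (y0 : forall i, hom tunit (car (S i))).
Implicit Types (A B : formula N) (G : seq (formula N)).

Definition update (T : 'I_N -> Type) (z : forall i, T i) i (t : T i) : forall j, T j :=
  fun j => if i =P j is ReflectT e then ecast k (T k) e t else z j.

Lemma update_same (T : 'I_N -> Type) (z : forall i, T i) i (t : T i) : update z t i = t.
Proof. by rewrite /update; case: eqP => // e; rewrite eq_axiomK. Qed.

Definition join_tests T (x x' : seq bool -> T) (p0 : T) : seq bool -> T := fun p =>
  match p with [::] => p0 | c :: p' => if c then x' p' else x p' end.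

Lemma ftest_separating A : separating (fun t => exists (x : tests R _) (y : points S _), t = ftest A x y).
Proof using x0 y0 iotaiK iotaK points_sep tens_tests_sep.
elim: A => [b i|A IA B IB|A IA B IB].
- case: b => a a' h /=.
    apply: (tests_sep iotaiK iotaK points_sep) => t; apply: h.
    (* Only the entry at i is read; x0 and y0 fill the entries of the other variables. *)
    exists (fun _ => update x0 t), (fun _ => y0); exact: esym (update_same _ _).
  apply: (dual_tests_separating iotaiK iotaK points_sep) => t [b ->]; apply: h.
  by exists (fun _ => x0), (fun _ => update y0 b); rewrite /= update_same.
- move=> a a' h; apply: (tens_separating tens_tests_sep IA IB) => _ [_ [_ [[x [y ->]] [x' [y' ->]] ->]]].
  apply: h; exists (join_tests x x' x0), (join_tests y y' y0).
  by congr tens_test; apply: eq_ftest => p i.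
- move=> a a' h; apply: (par_separating iotaiK iotaK points_sep IA IB) => _ [_ [_ [[x [y ->]] [x' [y' ->]] ->]]].
  apply: h; exists (join_tests x x' x0), (join_tests y y' y0).
  by congr par_test; apply: eq_ftest => p i.
Qed.

Lemma stest_separating A G :
  separating (fun t => exists (x : tests R _) (y : points S _), t = stest A G x y).
Proof using x0 y0 iotaiK iotaK points_sep tens_tests_sep.
elim: G A => [|B G IH] A.
  move=> a a' h; apply: (@ftest_separating A) => _ [x [y ->]]; apply: h.
  by exists (fun v => x v.2), (fun v => y v.2).
move=> a a' h; apply: (par_separating iotaiK iotaK points_sep (@ftest_separating A) (IH B)).
move=> _ [_ [_ [[x [y ->]] [x' [y' ->]] ->]]]; apply: h.
exists (fun v => if v.1 is k.+1 then x' (k, v.2) else x v.2),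
  (fun v => if v.1 is k.+1 then y' (k, v.2) else y v.2).
by congr par_test; apply: eq_stest => -[k p].
Qed.

End Separating.

(** * Biproducts *)

Section Additive.
Variables (K : category) (bp : biproducts K).
Implicit Types (A B X Y : K).
Local Notation "0" := (zerom bp _ _) : cat_scope.

Lemma precomp A B X Y (g : hom B X) (f : hom A B) (k : hom A X) (x : hom Y A) :
  g ∘ f = k -> g ∘ (f ∘ x) = k ∘ x.
Proof. by move=> <-; rewrite compA. Qed.

Lemma comp0f A B X (f : hom A B) : (0 : hom B X) ∘ f = 0.
Proof. by rewrite /zerom compA (to_zero_uniq (to_zero bp B ∘ f)). Qed.

Lemma compf0 A B X (f : hom B X) : f ∘ (0 : hom A B) = 0.
Proof. by rewrite /zerom -compA (from_zero_uniq (f ∘ from_zero bp B)). Qed.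

Definition biprod_pair A B X (f : hom X A) (g : hom X B) : hom X (biprod bp A B) :=
  proj1_sig (constructive_indefinite_description _ (pairing bp f g)).
Definition biprod_copair A B X (f : hom A X) (g : hom B X) : hom (biprod bp A B) X :=
  proj1_sig (constructive_indefinite_description _ (copairing bp f g)).

Lemma prl_pair A B X (f : hom X A) (g : hom X B) : prl bp A B ∘ biprod_pair f g = f.
Proof. by rewrite /biprod_pair; case: constructive_indefinite_description => h [[]]. Qed.
Lemma prr_pair A B X (f : hom X A) (g : hom X B) : prr bp A B ∘ biprod_pair f g = g.
Proof. by rewrite /biprod_pair; case: constructive_indefinite_description => h [[]]. Qed.
Lemma copair_inl A B X (f : hom A X) (g : hom B X) : biprod_copair f g ∘ inl_ bp A B = f.
Proof. by rewrite /biprod_copair; case: constructive_indefinite_description => h [[]]. Qed.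
Lemma copair_inr A B X (f : hom A X) (g : hom B X) : biprod_copair f g ∘ inr_ bp A B = g.
Proof. by rewrite /biprod_copair; case: constructive_indefinite_description => h [[]]. Qed.

Lemma pair_ext A B X (f g : hom X (biprod bp A B)) :
  prl _ _ _ ∘ f = prl _ _ _ ∘ g -> prr _ _ _ ∘ f = prr _ _ _ ∘ g -> f = g.
Proof.
move=> hl hr; have [h [_ u]] := pairing bp (prl _ _ _ ∘ g) (prr _ _ _ ∘ g).
by rewrite -(u f) ?(u g).
Qed.

Lemma copair_ext A B X (f g : hom (biprod bp A B) X) :
  f ∘ inl_ _ _ _ = g ∘ inl_ _ _ _ -> f ∘ inr_ _ _ _ = g ∘ inr_ _ _ _ -> f = g.
Proof.
move=> hl hr; have [h [_ u]] := copairing bp (g ∘ inl_ _ _ _) (g ∘ inr_ _ _ _).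
by rewrite -(u f) ?(u g).
Qed.

(** The addition induced by biproducts; opposites need not exist. *)
Definition add A B (f g : hom A B) : hom A B := biprod_copair f g ∘ biprod_pair (idc A) (idc A).

Lemma compDr A B X (k : hom B X) (f g : hom A B) : k ∘ add f g = add (k ∘ f) (k ∘ g).
Proof.
rewrite /add -compA; congr (_ ∘ _).
by apply: copair_ext; rewrite !compA ?copair_inl ?copair_inr.
Qed.

Lemma compDl A B X (f g : hom B X) (h : hom A B) : add f g ∘ h = add (f ∘ h) (g ∘ h).
Proof.
(* [hh] is h ⊕ h, and the claim is the naturality of the diagonal with respect to h. *)
pose hh := biprod_copair (inl_ bp _ _ ∘ h) (inr_ bp _ _ ∘ h); rewrite /add.
have -> : biprod_copair (f ∘ h) (g ∘ h) = biprod_copair f g ∘ hh.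
  apply: copair_ext; rewrite !compA ?copair_inl ?copair_inr.
    by rewrite (precomp _ (copair_inl _ _)).
  by rewrite (precomp _ (copair_inr _ _)).
rewrite !compA; congr (_ ∘ _); apply: pair_ext; rewrite -!compA.
  rewrite prl_pair comp1f.
  have -> : prl _ _ _ ∘ hh = h ∘ prl bp _ _.
    apply: copair_ext; rewrite !compA ?copair_inl ?copair_inr.
      by rewrite (precomp _ (prl_inl _ _ _)) prl_inl comp1f compf1.
    by rewrite (precomp _ (prl_inr _ _ _)) prl_inr compf0 comp0f.
  by rewrite compA prl_pair compf1.
rewrite prr_pair comp1f.
have -> : prr _ _ _ ∘ hh = h ∘ prr bp _ _.
  apply: copair_ext; rewrite !compA ?copair_inl ?copair_inr.
    by rewrite (precomp _ (prr_inl _ _ _)) prr_inl compf0 comp0f.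
  by rewrite (precomp _ (prr_inr _ _ _)) prr_inr comp1f compf1.
by rewrite compA prr_pair compf1.
Qed.

Lemma addf0 A B (f : hom A B) : add f 0 = f.
Proof.
rewrite /add; have -> : biprod_copair f (0 : hom A B) = f ∘ prl bp A A.
  apply: copair_ext; rewrite ?copair_inl ?copair_inr compA.
    by rewrite prl_inl compf1.
  by rewrite prl_inr compf0.
by rewrite compA prl_pair compf1.
Qed.

Lemma add0f A B (f : hom A B) : add 0 f = f.
Proof.
rewrite /add; have -> : biprod_copair (0 : hom A B) f = f ∘ prr bp A A.
  apply: copair_ext; rewrite ?copair_inl ?copair_inr compA.
    by rewrite prr_inl compf0.
  by rewrite prr_inr compf1.
by rewrite compA prr_pair compf1.
Qed.

Variable I : K.

(* The n-fold biproduct of I; its injections and projections are 0 for k >= n. *)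
Fixpoint bpow n : K := if n is n'.+1 then biprod bp I (bpow n') else zero bp.

Fixpoint binj n k : hom I (bpow n) :=
  match n with
  | 0 => 0
  | n'.+1 => if k is k'.+1 then inr_ bp _ _ ∘ binj n' k' else inl_ bp _ _
  end.

Fixpoint bprj n k : hom (bpow n) I :=
  match n with
  | 0 => 0
  | n'.+1 => if k is k'.+1 then bprj n' k' ∘ prr bp _ _ else prl bp _ _
  end.

Lemma bprj_inj n k l : l < n ->
  bprj n k ∘ binj n l = if k == l then idc I else 0.
Proof.
elim: n k l => [//|n IH] [|k] [|l] /= ln.
- exact: prl_inl.
- by rewrite -compA prl_inr comp0f.
- by rewrite compA prr_inl compf0.
- by rewrite compA (precomp _ (prr_inr _ _ _)) comp1f IH.
Qed.

Lemma bpow_epi n X (f g : hom (bpow n) X) :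
  (forall k, k < n -> f ∘ binj n k = g ∘ binj n k) -> f = g.
Proof.
elim: n f g => [|n IH] f g h; first by rewrite (from_zero_uniq f) (from_zero_uniq g).
apply: copair_ext; first exact: (h 0%N).
by apply: IH => k kn; rewrite !compA; apply: (h k.+1).
Qed.

Lemma bpow_mono n X (f g : hom X (bpow n)) :
  (forall k, k < n -> bprj n k ∘ f = bprj n k ∘ g) -> f = g.
Proof.
elim: n f g => [|n IH] f g h; first by rewrite (to_zero_uniq f) (to_zero_uniq g).
apply: pair_ext; first exact: (h 0%N).
by apply: IH => k kn; rewrite -!compA; apply: (h k.+1).
Qed.

Lemma bpow_copair n X (y : nat -> hom I X) :
  exists f, forall k, k < n -> f ∘ binj n k = y k.
Proof.
elim: n y => [|n IH] y; first by exists 0.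
have [f hf] := IH (fun k => y k.+1); exists (biprod_copair (y 0%N) f) => -[|k] kn /=.
  exact: copair_inl.
by rewrite -compA copair_inr hf.
Qed.

(** Replaces the expansion of x ∘ u over coordinates: [p] kills the coordinates at which x vanishes,
    so x = x ∘ p, and if u vanished at all the others then p ∘ u would be 0. *)
Lemma bpow_neq0 n (x : hom (bpow n) I) (u : hom I (bpow n)) : x ∘ u <> 0 ->
  exists k, [/\ k < n, x ∘ binj n k <> 0 & bprj n k ∘ u <> 0].
Proof.
move=> xu; apply: NNPP => h; apply: xu.
have [p hp] := bpow_copair n (fun k =>
  if excluded_middle_informative (x ∘ binj n k = 0) then 0 else binj n k).
have px : x = x ∘ p.
  apply: bpow_epi => k kn; rewrite compA hp //.
  by case: excluded_middle_informative => //= ->; rewrite compf0.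
rewrite px compA; have -> : p ∘ u = 0; last by rewrite compf0.
apply: bpow_mono => k kn; rewrite compf0 -compA.
have pp : bprj n k ∘ p =
    if excluded_middle_informative (x ∘ binj n k = 0) then 0 else bprj n k.
  apply: bpow_epi => l ln; rewrite compA hp //.
  do 2!case: excluded_middle_informative => //=; rewrite ?compf0 ?comp0f //.
    by move=> xk xl; rewrite bprj_inj //; case: eqP => // kl; case: xk; rewrite kl.
  by move=> xk xl; rewrite bprj_inj //; case: eqP => // kl; case: xl; rewrite -kl.
rewrite pp; case: excluded_middle_informative => /= [_|xk]; first exact: comp0f.
by apply: NNPP => uk; apply: h; exists k.
Qed.

Lemma bprj_ge n k : n <= k -> bprj n k = 0.
Proof. by elim: n k => [|n IH] [|k] //= nk; rewrite IH // comp0f. Qed.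

Lemma bprj_inj_lt n k l :
  bprj n k ∘ binj n l = if (k == l) && (l < n) then idc I else 0.
Proof.
have [nl|ln] := leqP n l; last by rewrite bprj_inj // andbT.
rewrite andbF; elim: n k l nl => [|n IH] [|k] [|l] //= nl; rewrite ?comp0f //.
  by rewrite -compA prl_inr comp0f.
by rewrite compA (precomp _ (prr_inr _ _ _)) comp1f IH.
Qed.

(** The map is diagonal and so acts alike on injections and projections; dinaturality along it
    transfers a killed coordinate from points to tests. *)
Lemma bpow_kill n k : exists p : hom (bpow n) (bpow n),
  (forall l, l < n -> p ∘ binj n l = if l == k then 0 else binj n l) /\
  (forall l, bprj n l ∘ p = if l == k then 0 else bprj n l).
Proof.
have [p hp] := bpow_copair n (fun l => if l == k then 0 else binj n l).
exists p; split=> // l; have [nl|ln] := leqP n l.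
  by rewrite bprj_ge // comp0f if_same.
apply: bpow_epi => m mn; rewrite compA hp //.
case: (m =P k) => mk; case: (l =P k) => lk; rewrite ?compf0 ?comp0f //.
  by rewrite bprj_inj //; case: (l =P m) => // lm; case: lk; rewrite lm.
by rewrite bprj_inj //; case: (l =P m) => // lm; case: mk; rewrite -lm.
Qed.

End Additive.

(** * Values and coefficients of a transformation *)

Section Literals.
Variable N : nat.
Implicit Types (A B : formula N) (G H : seq (formula N)).

Fixpoint flits A : seq (seq bool * (bool * 'I_N)) :=
  match A with
  | Lit b i => [:: ([::], (b, i))]
  | Tens A B | Par A B =>
      [seq (false :: x.1, x.2) | x <- flits A] ++ [seq (true :: x.1, x.2) | x <- flits B]
  end.

Fixpoint slits G : seq (addr * (bool * 'I_N)) :=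
  if G is A :: G' then
    [seq ((0, x.1), x.2) | x <- flits A]
    ++ [seq ((x.1.1.+1, x.1.2), x.2) | x <- slits G']
  else [::].

Lemma flitsP A p b i : reflect (subf A p = Some (Lit b i)) ((p, (b, i)) \in flits A).
Proof.
apply/(iffP idP).
  elim: A p => [b' j|A IA B IB|A IA B IB] p /=.
  - by rewrite inE => /eqP[-> -> ->].
  - by rewrite mem_cat => /orP[]/mapP[[q a] h [-> e]]; [apply: IA|apply: IB]; rewrite e.
  - by rewrite mem_cat => /orP[]/mapP[[q a] h [-> e]]; [apply: IA|apply: IB]; rewrite e.
elim: A p => [b' j|A IA B IB|A IA B IB] [|[] p] //=.
- by case=> -> ->; rewrite mem_head.
- by move/IB => h; rewrite mem_cat; apply/orP; right; apply/mapP; eexists; [exact: h|].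
- by move/IA => h; rewrite mem_cat; apply/orP; left; apply/mapP; eexists; [exact: h|].
- by move/IB => h; rewrite mem_cat; apply/orP; right; apply/mapP; eexists; [exact: h|].
- by move/IA => h; rewrite mem_cat; apply/orP; left; apply/mapP; eexists; [exact: h|].
Qed.

Lemma slitsP G v b i : reflect (occ G v = Some (Lit b i)) ((v, (b, i)) \in slits G).
Proof.
apply/(iffP idP).
  elim: G v => [//|A G IH] v /=; rewrite mem_cat => /orP[]/mapP[[q a] h [-> ea]].
    by apply/flitsP; rewrite ea.
  by apply: (IH (q.1, q.2)); rewrite ea; case: (q) h.
elim: G v => [|A G IH] [k p] /=; first by rewrite /occ onth0n.
rewrite mem_cat; case: k => [|k] h; apply/orP.
  by left; apply/mapP; exists (p, (b, i)) => //; apply/flitsP.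
by right; apply/mapP; exists ((k, p), (b, i)) => //; apply: IH.
Qed.

Lemma unzip1_map (S T U : Type) (f : S -> T) (s : seq (S * U)) :
  unzip1 [seq (f x.1, x.2) | x <- s] = map f (unzip1 s).
Proof. by rewrite /unzip1 -!map_comp. Qed.

Lemma uniq_cat_map (S T : eqType) (f g : S -> T) (s t : seq S) :
  injective f -> injective g -> (forall x y, f x <> g y) ->
  uniq s -> uniq t -> uniq (map f s ++ map g t).
Proof.
move=> fi gi fg us ut; rewrite cat_uniq !map_inj_uniq // us ut andbT.
apply/hasPn => _ /mapP[q _ ->]; apply/mapP => -[r _ e]; exact: fg (esym e).
Qed.

Lemma flits_uniq A : uniq (unzip1 (flits A)).
Proof.
elim: A => [b i|A IA B IB|A IA B IB] //=; rewrite /unzip1 map_cat -!/(unzip1 _) !unzip1_map;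
  by apply: uniq_cat_map => // ? ? [].
Qed.

Lemma slits_uniq G : uniq (unzip1 (slits G)).
Proof.
elim: G => [|A G IH] //=; rewrite /unzip1 map_cat -!/(unzip1 _).
rewrite (unzip1_map (pair 0)) (unzip1_map (fun v : addr => (v.1.+1, v.2))).
have inj0 : injective (pair 0 : seq bool -> addr) by move=> ? ? [].
have injS : injective (fun v : addr => (v.1.+1, v.2)) by move=> [? ?] [? ?] [-> ->].
rewrite cat_uniq (map_inj_uniq inj0) (map_inj_uniq injS) flits_uniq IH andbT /=.
by apply/hasPn => _ /mapP[q _ ->]; apply/mapP => -[].
Qed.

Definition addrs G := unzip1 (slits G).
Definition poss G := [seq x.1 | x <- slits G & x.2.1].
Definition negs G := [seq x.1 | x <- slits G & ~~ x.2.1].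

Lemma mem_addrs G v b i : occ G v = Some (Lit b i) -> v \in addrs G.
Proof. by move/slitsP => h; apply/mapP; exists (v, (b, i)). Qed.

Lemma possP G v : reflect (exists i, occ G v = Some (Lit true i)) (v \in poss G).
Proof.
apply: (iffP mapP) => [[[w [b i]]]|[i /slitsP h]]; last first.
  by exists (v, (true, i)); rewrite ?mem_filter.
by rewrite mem_filter /= => /andP[-> h ->]; exists i; apply/slitsP.
Qed.

Lemma negsP G v : reflect (exists i, occ G v = Some (Lit false i)) (v \in negs G).
Proof.
apply: (iffP mapP) => [[[w [b i]]]|[i /slitsP h]]; last first.
  by exists (v, (false, i)); rewrite ?mem_filter.
by rewrite mem_filter /= => /andP[/negPf-> h ->]; exists i; apply/slitsP.
Qed.

Lemma poss_uniq G : uniq (poss G).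
Proof. exact/(subseq_uniq (map_subseq _ (filter_subseq _ _)))/slits_uniq. Qed.
Lemma negs_uniq G : uniq (negs G).
Proof. exact/(subseq_uniq (map_subseq _ (filter_subseq _ _)))/slits_uniq. Qed.

End Literals.

Section Values.
Variable D : star_autonomous.
Variables (iota : hom (tunit : D) bot) (iotai : hom (bot : D) tunit).
Hypothesis iotaiK : iotai ∘ iota = idc _.
Hypothesis iotaK : iota ∘ iotai = idc _.
Variable bp : biproducts D.
Local Notation "0" := (zerom bp _ _) : cat_scope.
Local Notation stest := (stest iota iotai).
Variable N : nat.
Variables (A : formula N) (G : seq (formula N)) (tau : family (glue D) A G).
Hypothesis tauN : mll_transformation tau.
Implicit Types (V W : 'I_N -> D).

Definition value (R : 'I_N -> glue D) (x : tests R addr) (y : points R addr) :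
  hom (tunit : D) tunit := stest A G x y ∘ und (tau R).

(** Dinaturality read at a pure test: arrows move from the tests at positive literals to the points
    at negative ones. *)
Lemma value_nat (R S : 'I_N -> glue D) (f : forall i, hom (R i) (S i))
    (x : tests S addr) (y : points R addr) :
  @value R (fun p i => x p i ∘ und (f i)) y = @value S x (fun p i => und (f i) ∘ y p i).
Proof using tauN.
have e := congr1 (fun h => @stest N S R A G x y ∘ h) (congr1 (@und D _ _) (tauN f)).
move: e; rewrite !und_comp -2!compA !stest_seqmap => e.
refine (etrans _ (etrans e _)); congr comp; apply: eq_stest => v i; split=> _ //.
  exact: esym (comp1f _).
exact: compf1.
Qed.

(* Between objects with all copoints and no points every arrow is a morphism, so
   values are natural in all arrows and do not depend on the glueing. *)
Definition free (X : D) : glue D := @GObj D X (fun=> False) (fun=> True).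

Definition free_map (X Y : D) (f : hom X Y) : hom (free X) (free Y).
Proof. by exists f; split. Defined.

Definition free_counit (P : glue D) : hom (free (car P)) P.
Proof. by exists (idc (car P)); split. Defined.

Definition fvalue V (x : forall v : addr, forall i, hom (V i) tunit)
    (y : forall v : addr, forall i, hom tunit (V i)) :=
  @value (fun i => free (V i)) x y.

(** The identity is an arrow from [free (car (R i))] to [R i], and dinaturality along it changes
    nothing but the glueing. *)
Lemma value_free (R : 'I_N -> glue D) (x : tests R addr) (y : points R addr) :
  value x y = @fvalue (fun i => car (R i)) x y.
Proof using tauN.
have := @value_nat (fun i => free (car (R i))) R (fun i => free_counit (R i)) x y.
move=> e; refine (etrans (etrans _ (esym e)) _); congr comp; apply: eq_stest => v i; split=> _ //.
  exact: esym (comp1f _).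
exact: compf1.
Qed.

Lemma fvalue_nat V W (f : forall i, hom (V i) (W i)) x y :
  @fvalue V (fun p i => x p i ∘ f i) y = @fvalue W x (fun p i => f i ∘ y p i).
Proof using tauN.
exact: (@value_nat (fun i => free (V i)) (fun i => free (W i)) (fun i => free_map (f i))).
Qed.

Lemma eq_fvalue V x x' y y' :
  (forall v i, (occ (A :: G) v = Some (Lit true i) -> x v i = x' v i) /\
               (occ (A :: G) v = Some (Lit false i) -> y v i = y' v i)) ->
  @fvalue V x y = @fvalue V x' y'.
Proof. by move=> h; congr comp; apply: eq_stest. Qed.

Lemma fvalue_test V q i x y : occ (A :: G) q = Some (Lit true i) -> exists u, forall x' y',
  (forall v j, v <> q -> (occ (A :: G) v = Some (Lit true j) -> x v j = x' v j) /\
               (occ (A :: G) v = Some (Lit false j) -> y v j = y' v j)) ->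
  @fvalue V x' y' = x' q i ∘ u.
Proof using iotaiK iotaK.
move=> qi; have [h _] := stest_linear iotaiK iotaK (R := fun i => free (V i))
  (S := fun i => free (V i)) q x y (und (tau (fun i => free (V i)))).
have [u hu] := h _ qi; exists u => x' y' e.
exact: hu.
Qed.

Lemma fvalue_point V q i x y : occ (A :: G) q = Some (Lit false i) -> exists t, forall x' y',
  (forall v j, v <> q -> (occ (A :: G) v = Some (Lit true j) -> x v j = x' v j) /\
               (occ (A :: G) v = Some (Lit false j) -> y v j = y' v j)) ->
  @fvalue V x' y' = t ∘ y' q i.
Proof using iotaiK iotaK.
move=> qi; have [_ h] := stest_linear iotaiK iotaK (R := fun i => free (V i))
  (S := fun i => free (V i)) q x y (und (tau (fun i => free (V i)))).
have [u hu] := h _ qi; exists u => x' y' e.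
exact: hu.
Qed.

Lemma fvalue_test0 V q i x y : occ (A :: G) q = Some (Lit true i) -> x q i = 0 ->
  @fvalue V x y = 0.
Proof using iotaiK iotaK.
move=> qi x0; have [u ->] := @fvalue_test V q i x y qi; last by [].
by rewrite x0 comp0f.
Qed.

Lemma fvalue_point0 V q i x y : occ (A :: G) q = Some (Lit false i) -> y q i = 0 ->
  @fvalue V x y = 0.
Proof using iotaiK iotaK.
move=> qi x0; have [u ->] := @fvalue_point V q i x y qi; last by [].
by rewrite x0 compf0.
Qed.

End Values.

Section Coefficients.
Variable D : star_autonomous.
Variables (iota : hom (tunit : D) bot) (iotai : hom (bot : D) tunit).
Hypothesis iotaiK : iotai ∘ iota = idc _.
Hypothesis iotaK : iota ∘ iotai = idc _.
Variable bp : biproducts D.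
Local Notation "0" := (zerom bp _ _) : cat_scope.
Variable N : nat.
Variables (A : formula N) (G : seq (formula N)) (tau : family (glue D) A G).
Hypothesis tauN : mll_transformation tau.
Implicit Types (V W : 'I_N -> D) (g : addr -> addr).
Local Notation fvalue := (fvalue iota iotai tau).
Local Notation bprj := (bprj bp (tunit : D)).
Local Notation binj := (binj bp (tunit : D)).
Local Notation bpow := (bpow bp (tunit : D)).
Local Notation sq := (A :: G).

Definition label_value n (k : addr -> nat) : hom (tunit : D) tunit :=
  @fvalue (fun _ => bpow n) (fun v _ => bprj n (k v)) (fun v _ => binj n (k v)).

Definition width := size (addrs sq).
Definition idx v := index v (addrs sq).
(** A positive literal is tested at the coordinate of its partner, a negative one receives its own
    coordinate vector. If g v is not a literal its index is [width], where [bprj] is 0. *)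
Definition link_label g v := idx (if v \in poss sq then g v else v).
Definition coeff g := label_value width (link_label g).

Lemma idx_lt v b i : occ sq v = Some (Lit b i) -> idx v < width.
Proof. by move/mem_addrs; rewrite index_mem. Qed.

Lemma link_label_pos g v i : occ sq v = Some (Lit true i) -> link_label g v = idx (g v).
Proof. by move=> h; rewrite /link_label ifT //; apply/possP; exists i. Qed.

Lemma link_label_neg g v i : occ sq v = Some (Lit false i) -> link_label g v = idx v.
Proof.
move=> h; rewrite /link_label ifF //; apply/possP => -[j]; by rewrite h.
Qed.

Lemma idx_inj v w : v \in addrs sq -> w \in addrs sq -> idx v = idx w -> v = w.
Proof. by move=> va wa e; rewrite -(nth_index v va) -(nth_index v wa) [index _ _]e. Qed.

Lemma coeffE g : coeff g = @fvalue (fun _ => bpow width)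
  (fun v _ => bprj width (idx (g v))) (fun v _ => binj width (idx v)).
Proof.
apply: eq_fvalue => v i; split=> h; first by rewrite (link_label_pos _ h).
by rewrite (link_label_neg _ h).
Qed.

(** The tests become projections one positive literal at a time, with [bpow_neq0] choosing the
    coordinate. *)
Lemma fvalue_expand (x : addr -> forall i : 'I_N, hom (bpow width) tunit) y :
  @fvalue (fun _ => bpow width) x y <> 0 -> exists g,
  @fvalue (fun _ => bpow width) (fun v _ => bprj width (idx (g v))) y <> 0 /\
  forall v i, occ sq v = Some (Lit true i) ->
    g v \in addrs sq /\ x v i ∘ binj width (idx (g v)) <> 0.
Proof using iotaiK iotaK.
move=> xy.
suff key (s : seq addr) : exists g,
  @fvalue (fun _ => bpow width) (fun v i => if v \in s then bprj width (idx (g v)) else x v i) y <> 0 /\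
  forall v i, v \in s -> occ sq v = Some (Lit true i) ->
    g v \in addrs sq /\ x v i ∘ binj width (idx (g v)) <> 0.
  have [g [h1 h2]] := key (addrs sq); exists g; split=> [|v i h]; last by apply: h2 => //; apply: mem_addrs h.
  move=> e; apply: h1; rewrite -e; apply: eq_fvalue => v i; split=> // h.
  by rewrite (mem_addrs h).
elim: s => [|q s [g [h1 h2]]]; first by exists id; split.
case: (@idP (q \in poss sq)) => [/possP[i qi]|qn]; last first.
  exists g; split=> [e|v i]; last first.
    rewrite inE => /predU1P[->|]; last exact: h2.
    by move=> h; case: qn; apply/possP; exists i.
  apply: h1; rewrite -e; apply: eq_fvalue => v i; split=> // h; rewrite inE.
  by case: eqP => //= vq; case: qn; rewrite -vq; apply/possP; exists i.
have [|qs] := boolP (q \in s).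
  move=> qs; exists g; split=> [e|v j]; last (rewrite inE => /predU1P[->|vs]; [exact: h2|exact: h2]).
  apply: h1; rewrite -e; apply: eq_fvalue => v j; split=> // h; rewrite inE.
  by case: eqP => //= ->; rewrite qs.
have [u hu] := @fvalue_test _ _ _ iotaiK iotaK _ _ _ tau _ q i
  (fun v i => if v \in s then bprj width (idx (g v)) else x v i) y qi.
have := h1; rewrite (hu _ y) // (negPf qs) => /bpow_neq0[k [kn xk ku]].
pose w := nth q (addrs sq) k; pose g' v := if v == q then w else g v.
have kw : idx w = k by rewrite /idx index_uniq //; apply: slits_uniq.
have wa : w \in addrs sq by apply: mem_nth.
exists g'; split=> [e|v j].
  have e0 := hu (fun v i => if v \in q :: s then bprj width (idx (g' v)) else x v i) y.
  apply: ku; rewrite -kw; move: e0; rewrite mem_head /g' eqxx => <- // v j vq; split=> // _.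
  by rewrite inE; case: eqP.
rewrite inE /g'; case: eqP => [-> _|vq vs]; last exact: h2.
rewrite qi => -[<-]; by rewrite kw.
Qed.

(** Dinaturality along arrows W → V i that send the coordinate of each w to y w i turns arbitrary
    points into coordinate vectors. *)
Lemma fvalue_neq0 V x y : @fvalue V x y <> 0 -> exists g, coeff g <> 0 /\
  forall v i, occ sq v = Some (Lit true i) -> x v i ∘ y (g v) i <> 0.
Proof using iotaiK iotaK tauN.
have ex i : {f : hom (bpow width) (V i) | forall k, k < width -> f ∘ binj width k = y (nth (0%N, [::]) (addrs sq) k) i}.
  exact: constructive_indefinite_description (bpow_copair _ _ _).
pose f i := proj1_sig (ex i).
have fE i v : v \in addrs sq -> f i ∘ binj width (idx v) = y v i.
  by move=> va; rewrite /f; case: (ex i) => h /= ->; rewrite ?nth_index ?index_mem.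
have -> : @fvalue V x y = @fvalue (fun _ => bpow width) (fun v i => x v i ∘ f i) (fun v _ => binj width (idx v)).
  rewrite (fvalue_nat iota iotai tauN (V := fun _ => bpow width) (W := V) f).
  by apply: eq_fvalue => v i; split=> // /mem_addrs va; rewrite fE.
move/fvalue_expand => [g [h1 h2]]; exists g; split=> [|v i h]; first by rewrite coeffE.
by have [va] := h2 v i h; rewrite compA fE.
Qed.

Section Nonzero.
Variable g : addr -> addr.
Hypothesis cg : coeff g <> 0.

(** If g v is not a negative literal of the variable i, killing its coordinate at i alone changes no
    point but annihilates the test at v. *)
Lemma coeff_pos v i : occ sq v = Some (Lit true i) ->
  occ sq (g v) = Some (Lit false i).
Proof using iotaiK iotaK tauN cg.
move=> vi; apply: NNPP => gv; apply: cg; rewrite coeffE.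
have [p [p1 p2]] := bpow_kill bp (tunit : D) width (idx (g v)).
pose f j := if j == i then p else idc (bpow width).
transitivity (@fvalue (fun _ => bpow width)
    (fun v j => bprj width (idx (g v)) ∘ f j) (fun v _ => binj width (idx v))).
  rewrite (fvalue_nat iota iotai tauN (V := fun _ => bpow width) (W := fun _ => bpow width) f).
  apply: eq_fvalue => w j; split=> // wj; rewrite /f; case: eqP => [ij|_]; last by rewrite comp1f.
  have wa := mem_addrs wj; rewrite p1 ?index_mem //; case: eqP => // e; case: gv.
  rewrite -ij; suff <- : w = g v by [].
  have [ga|gn] := boolP (g v \in addrs sq); first exact: idx_inj e.
  by move: wa; rewrite -index_mem [index _ _]e /idx memNindex // ltnn.
apply: (fvalue_test0 iotaiK iotaK tau _ vi); by rewrite /f eqxx p2 eqxx.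
Qed.

(** Dual to [coeff_pos]: killing the coordinate of a w without partner changes no test but
    annihilates the point at w. *)
Lemma coeff_neg w j : occ sq w = Some (Lit false j) ->
  exists v, occ sq v = Some (Lit true j) /\ g v = w.
Proof using iotaiK iotaK tauN cg.
move=> wj; apply: NNPP => gw; apply: cg; rewrite coeffE.
have [p [p1 p2]] := bpow_kill bp (tunit : D) width (idx w).
pose f i := if i == j then p else idc (bpow width).
have wa := mem_addrs wj.
transitivity (@fvalue (fun _ => bpow width)
    (fun v i => bprj width (idx (g v)) ∘ f i) (fun v _ => binj width (idx v))).
  apply: eq_fvalue => v i; split=> // vi; rewrite /f; case: eqP => [ij|_]; last by rewrite compf1.
  rewrite p2; case: eqP => // e; case: gw; exists v; rewrite -ij; split=> //.
  by apply: idx_inj e => //; apply: mem_addrs (coeff_pos vi).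
rewrite (fvalue_nat iota iotai tauN (V := fun _ => bpow width) (W := fun _ => bpow width) f).
by apply: (fvalue_point0 iotaiK iotaK tau _ wj); rewrite /f eqxx p1 ?index_mem // eqxx.
Qed.

(* Doubling the coordinate shared by v1 and v2 is natural in one literal and lets
   v1 and v2 test different coordinates, so by linearity the value vanishes. *)
Lemma coeff_inj v1 v2 : v1 \in poss sq -> v2 \in poss sq -> g v1 = g v2 -> v1 = v2.
Proof using iotaiK iotaK tauN cg.
move=> /possP[i v1i] /possP[i2 v2i] e; apply: NNPP => v12; apply: cg; rewrite coeffE.
have wi := coeff_pos v1i; set w := g v1 in wi e.
have : occ sq w = Some (Lit false i2) by rewrite e; apply: coeff_pos.
rewrite wi => -[ii]; rewrite -{i2}ii in v2i.
have wa := mem_addrs wi; have kn : idx w < width by rewrite index_mem.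
set k := idx w in kn; set n := width in kn *.
have nn : n < n.+1 by []; have kS : k < n.+1 by lia.
have nS l : l < n -> l < n.+1 by lia.
(* [a] is the sum of the coordinate vectors k and n, where n is a new coordinate; [f] below sends
   coordinate k to [a] and fixes the others. *)
have [a [ak an al]] : exists a, [/\ bprj n.+1 k ∘ a = idc _, bprj n.+1 n ∘ a = idc _ &
    forall l, l < n.+1 -> l <> k -> l <> n -> bprj n.+1 l ∘ a = 0].
  exists (add bp (binj n.+1 k) (binj n.+1 n)).
  have ne : k == n = false by lia.
  have ne' : n == k = false by lia.
  split=> [||l ln lk ll]; rewrite compDr !bprj_inj ?eqxx ?ne ?ne' ?addf0 ?add0f //.
  by case: (l =P k) => // _; case: (l =P n) => // _; rewrite addf0.
have [f fE] := bpow_copair bp n (fun l => if l == k then a else binj n.+1 l).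
have [f0 f0E] := bpow_copair bp n (fun l => binj n.+1 l).
pose F j := if j == i then f else f0.
pose x (v : addr) := bprj n.+1 (if v == v2 then n else idx (g v)).
pose y (b : hom tunit (bpow n.+1)) (v : addr) := if v == w then b else binj n.+1 (idx v).
have fprj l : l < n -> bprj n.+1 l ∘ f = bprj n l.
  move=> ln; apply: bpow_epi => m mn; rewrite compA fE // bprj_inj //.
  case: (m =P k) => [mk|mk]; last by rewrite bprj_inj //; apply: nS.
  rewrite mk.
  case: (l =P k) => [->//|lk]; apply: al => //; [exact: nS|lia].
have fn : bprj n.+1 n ∘ f = bprj n k.
  apply: bpow_epi => m mn; rewrite compA fE // bprj_inj //.
  case: (m =P k) => [mk|mk]; first by rewrite mk an eqxx.
  rewrite bprj_inj; last exact: nS.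
  by case: (n =P m) => h; case: (k =P m) => h' //; lia.
have f0prj l : l < n -> bprj n.+1 l ∘ f0 = bprj n l.
  by move=> ln; apply: bpow_epi => m mn; rewrite compA f0E // !bprj_inj ?nS.
transitivity (@fvalue (fun _ => bpow n.+1) (fun v _ => x v) (fun v _ => y a v)).
  transitivity (@fvalue (fun _ => bpow n) (fun v j => x v ∘ F j) (fun v _ => binj n (idx v))).
    apply: eq_fvalue => v j; split=> // vj; rewrite /F /x.
    have gn : idx (g v) < n by apply: idx_lt (coeff_pos vj).
    case: (v =P v2) => [vv|_].
      by move: vj; rewrite vv v2i -e => -[<-]; rewrite eqxx fn.
    by case: eqP => _; rewrite ?fprj ?f0prj.
  rewrite (fvalue_nat iota iotai tauN (V := fun _ => bpow n) (W := fun _ => bpow n.+1) F).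
  apply: eq_fvalue => v j; split=> // vj; rewrite /F /y.
  have vn : idx v < n by apply: idx_lt vj.
  case: (v =P w) => [vw|vw].
    by move: vj; rewrite vw wi => -[<-]; rewrite eqxx fE // eqxx.
  case: eqP => _; rewrite ?f0E // fE //; case: eqP => // ek; case: vw.
  by apply: idx_inj ek => //; apply: mem_addrs vj.
have [t ht] := @fvalue_point _ _ _ iotaiK iotaK _ _ _ tau _ w i
  (fun v _ => x v) (fun v _ => y a v) wi.
have {}ht b : @fvalue (fun _ => bpow n.+1) (fun v _ => x v) (fun v _ => y b v) = t ∘ b.
  rewrite (ht (fun v _ => x v) (fun v _ => y b v)) /y ?eqxx // => v j vw; split=> // _.
  by case: eqP.
(* With a single coordinate vector at w, killing the other one of k and n changes no point, but
   annihilates the test at v2 if l = k and the test at v1 if l = n. *)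
have tl l : l = k \/ l = n -> t ∘ binj n.+1 l = 0.
  move=> lkn; rewrite -ht.
  pose m := if l == k then n else k.
  have [p [p1 p2]] := bpow_kill bp (tunit : D) n.+1 m.
  pose P j := if j == i then p else idc (bpow n.+1).
  transitivity (@fvalue (fun _ => bpow n.+1) (fun v j => x v ∘ P j) (fun v _ => y (binj n.+1 l) v)).
    rewrite (fvalue_nat iota iotai tauN (V := fun _ => bpow n.+1) (W := fun _ => bpow n.+1) P).
    apply: eq_fvalue => v j; split=> // vj; rewrite /P /y; case: (j =P i) => [ji|_]; last by rewrite comp1f.
    have vn := idx_lt vj; rewrite -/n in vn.
    case: (v =P w) => [vw|vw].
      rewrite p1; last by lia.
      by rewrite /m; case: (l =P k) => lk; case: eqP => //; lia.
    rewrite p1; last by lia.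
    case: eqP => // em; case: vw; apply: idx_inj; rewrite ?(mem_addrs vj) //.
    by move: em; rewrite /m; case: (l =P k) => lk //; lia.
  have [lk|lk] := eqVneq l k.
    by apply: (fvalue_test0 iotaiK iotaK tau _ v2i); rewrite /P /x !eqxx p2 /m lk !eqxx.
  apply: (fvalue_test0 iotaiK iotaK tau _ v1i); rewrite /P /x eqxx; case: eqP => // _.
  by rewrite p2 /m (negPf lk) eqxx.
rewrite ht; apply: NNPP => /bpow_neq0[l [ln tl0 la]].
have lkn : l = k \/ l = n.
  by apply: NNPP => h; apply: la; apply: al => // e'; apply: h; [left|right].
exact: tl0 (tl l lkn).
Qed.


End Nonzero.
End Coefficients.

(** * Three glueings *)

Section GlueTests.
Variable D : star_autonomous.
Variables (iota : hom (tunit : D) bot) (iotai : hom (bot : D) tunit).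
Hypothesis iotaiK : iotai ∘ iota = idc _.
Hypothesis iotaK : iota ∘ iotai = idc _.
Implicit Types P Q : glue D.
Local Notation par_test := (par_test iota iotai).
Local Notation dual_test := (dual_test iotai).
Local Notation dual_point := (dual_point iota).

Definition gpoint P (w : hom tunit (car P)) : Prop := @gpt D P w.
Definition gtest P (t : hom (car P) tunit) : Prop := @gcopt D P (iota ∘ t).

(** 1_I is a point of the unit; this is how a glueing constrains the components of tau. *)
Lemma gpoint_und P (f : hom tunit P) : gpoint (und f).
Proof.
have [h _] := proj2_sig f; have := h (idc _) erefl.
by rewrite compf1.
Qed.

Lemma gpoint_pull P Q (f : hom P Q) w : gpoint w -> gpoint (und f ∘ w).
Proof. by have [h _] := proj2_sig f; apply: h. Qed.

Lemma gtest_pull P Q (f : hom P Q) t : gtest t -> gtest (t ∘ und f).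
Proof. by have [_ h] := proj2_sig f; rewrite /gtest -compA; apply: h. Qed.

Lemma gdual_point P (w : hom tunit (car P^⊥)) : gpoint w ->
  exists2 t : hom (car P) tunit, gtest t & w = dual_point t.
Proof using iotaK.
case=> x hx ->; exists (iotai ∘ x); first by rewrite /gtest iotaiotai.
by rewrite dual_pointE iotaiotai.
Qed.

Lemma gdual_test P (u : hom tunit (car P)) : gpoint u -> gtest (P := P^⊥) (dual_test u).
Proof using iotaK. by move=> hu; exists u => //; apply: iotaiotai. Qed.

Lemma gtens_point P Q (w : hom tunit (car (P ⊗ Q))) : gpoint w ->
  exists u v, [/\ gpoint (P := P) u, gpoint (P := Q) v & w = (u ⊗m v) ∘ luni tunit].
Proof. by []. Qed.

Lemma gtens_test P Q (z : hom (car (P ⊗ Q)) tunit) :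
  (forall v : hom tunit (car Q), gpoint v ->
    gtest (P := P) (z ∘ (idc (car P) ⊗m v) ∘ runi (car P))) ->
  (forall u : hom tunit (car P), gpoint u ->
    gtest (P := Q) (z ∘ (u ⊗m idc (car Q)) ∘ luni (car Q))) ->
  gtest (P := P ⊗ Q) z.
Proof.
move=> h1 h2; split=> [v /h1|u /h2]; rewrite /gtest ?compA //.
Qed.

Lemma gpar_test P Q (t : hom (car P) tunit) (s : hom (car Q) tunit) :
  gtest t -> gtest s -> gtest (P := par P Q) (par_test t s).
Proof using iotaK.
move=> ht hs; exists ((dual_point t ⊗m dual_point s) ∘ luni tunit); last exact: iotaiotai.
exists (dual_point t), (dual_point s); split=> //.
  by exists (iota ∘ t).
by exists (iota ∘ s).
Qed.

(** w is an arrow out of the glued unit, so [coname] makes it an arrow of the glued category, which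
    maps the point dual to s to a point. *)
Lemma gpar_point_r P Q (w : hom tunit (car (par P Q))) (s : hom (car Q) tunit) :
  gpoint w -> gtest s ->
  exists2 u : hom tunit (car P), gpoint u & forall t, par_test t s ∘ w = t ∘ u.
Proof using iotaiK.
move=> hw hs; have wh : @is_ghom D (gunit D) (par P Q) w.
  by split=> [_ ->|//]; rewrite compf1.
pose f : hom (tunit : glue D) (par P Q) := exist _ w wh.
exists (und (coname f) ∘ dual_point s); last by move=> t; apply: (par_test_coname iotaiK).
by apply: gpoint_pull; exists (iota ∘ s).
Qed.

Lemma gpar_point_l P Q (w : hom tunit (car (par P Q))) (t : hom (car P) tunit) :
  gpoint w -> gtest t ->
  exists2 u : hom tunit (car Q), gpoint u & forall s, par_test t s ∘ w = s ∘ u.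
Proof using iotaiK.
move=> /(gpoint_pull (par_braid P Q)) hw ht; have [u hu e] := gpar_point_r hw ht.
exists u => // s; rewrite -e -compA; congr (_ ∘ _); exact: esym (par_test_braid _ _ _ _).
Qed.

End GlueTests.

Section BasisTests.
Variable D : star_autonomous.
Variables (iota : hom (tunit : D) bot) (iotai : hom (bot : D) tunit).
Variable bp : biproducts D.
Local Notation bpow := (bpow bp (tunit : D)).
Local Notation bprj := (bprj bp (tunit : D)).
Local Notation binj := (binj bp (tunit : D)).
Variables (N n : nat).
Variables (pt : 'I_N -> hom tunit (bpow n) -> Prop) (cpt : 'I_N -> hom (bpow n) bot -> Prop).
Implicit Types (A B : formula N) (G : seq (formula N)).

Definition bobj i : glue D := GObj (pt i) (cpt i).

Definition bftest A (k : seq bool -> nat) : hom (car (fobj bobj bobj A)) tunit :=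
  @ftest D iota iotai N bobj bobj A (fun p _ => bprj n (k p)) (fun p _ => binj n (k p)).

Definition bstest A G (k : addr -> nat) : hom (car (seqobj bobj bobj A G)) tunit :=
  @stest D iota iotai N bobj bobj A G (fun p _ => bprj n (k p)) (fun p _ => binj n (k p)).

(** As values do not depend on the glueing, [pt] and [cpt] can be chosen anew for every claim about
    the same scalar. *)
Lemma label_valueE A G (tau : family (glue D) A G) (k : addr -> nat) :
  mll_transformation tau ->
  label_value iota iotai bp tau n k = bstest A G k ∘ und (tau bobj).
Proof. by move=> tauN; apply: esym; apply: (value_free iota iotai tauN (R := bobj)). Qed.

End BasisTests.

(** * The counting glueing on I ⊕ I *)

Section Counting.
Variable D : star_autonomous.
Variables (iota : hom (tunit : D) bot) (iotai : hom (bot : D) tunit).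
Hypothesis iotaiK : iotai ∘ iota = idc _.
Hypothesis iotaK : iota ∘ iotai = idc _.
Variable bp : biproducts D.
Local Notation "0" := (zerom bp _ _) : cat_scope.
Implicit Types P Q : glue D.
Local Notation par_test := (par_test iota iotai).
Local Notation dual_test := (dual_test iotai).
Local Notation dual_point := (dual_point iota).
Local Notation gtest := (gtest iota).

(** Takes the place of t being a linear combination of members of B; if t has a nonzero value at w,
    so has some member of B. *)
Definition spans X (B : hom (X : D) tunit -> Prop) (t : hom X tunit) :=
  forall w : hom tunit X, (forall b, B b -> b ∘ w = 0) -> t ∘ w = 0.

Lemma spans_mem X (B : hom (X : D) tunit -> Prop) t : B t -> spans B t.
Proof. by move=> Bt w; apply. Qed.

Lemma spans_add X (B : hom (X : D) tunit -> Prop) t s :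
  spans B t -> spans B s -> spans B (add bp t s).
Proof. by move=> ht hs w hw; rewrite compDl ht // hs // addf0. Qed.

Section Combination.
Variables (X Y Z : D) (test : hom X tunit -> hom Y tunit -> hom Z tunit).
Hypothesis contract_r : forall (w : hom tunit Z) s, exists u, forall t, test t s ∘ w = t ∘ u.
Hypothesis contract_l : forall (w : hom tunit Z) t, exists u, forall s, test t s ∘ w = s ∘ u.

Lemma spans_comb B1 B2 B t s : (forall b c, B1 b -> B2 c -> B (test b c)) ->
  spans B1 t -> spans B2 s -> spans B (test t s).
Proof using contract_r contract_l.
move=> h ht hs w hw; have [u hu] := contract_l w t; rewrite hu.
apply: hs => c Bc; rewrite -hu; have [v hv] := contract_r w c; rewrite hv.
by apply: ht => b Bb; rewrite -hv; apply: hw; apply: h.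
Qed.

End Combination.

(** [k] yields the value 1; its companion [z], of value 0, is a test of the glued object and so can
    be used to build tests on pars. *)
Definition counts P (k z : hom (car P) tunit) :=
  gtest z /\ forall w, gpoint w -> k ∘ w = idc _ /\ z ∘ w = 0.

(** At a point of Q the sum restricts to z and at a point of P to z', and both are tests of the
    glued objects. *)
Lemma counts_tens P Q (k z : hom (car P) tunit) (k' z' : hom (car Q) tunit) :
  counts k z -> counts k' z' ->
  counts (P := P ⊗ Q) (tens_test k k') (add bp (tens_test z k') (tens_test k z')).
Proof.
move=> [hz h] [hz' h']; split.
  apply: gtens_test => [v hv|u hu].
    rewrite !compDl !tens_test_r.
    by have [-> ->] := h' v hv; rewrite comp1f comp0f addf0.
  rewrite !compDl !tens_test_l.
  by have [-> ->] := h u hu; rewrite comp1f comp0f add0f.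
move=> w /gtens_point[u [v [hu hv ->]]]; rewrite !compDl !tens_test_point.
have [-> ->] := h u hu; have [-> ->] := h' v hv.
by rewrite comp1f comp0f compf0 addf0.
Qed.

(** Contraction with the glued test z' turns a point of P ⅋ Q into a point of P, where k is 1 and z
    is 0. *)
Lemma counts_par P Q (k z : hom (car P) tunit) (k' z' : hom (car Q) tunit) :
  counts k z -> counts k' z' ->
  counts (P := par P Q) (par_test k z') (par_test z z').
Proof using iotaiK iotaK.
move=> [hz h] [hz' h']; split; first exact: gpar_test.
move=> w hw; have [u hu e] := gpar_point_r iotaiK hw hz'.
rewrite !e; exact: h.
Qed.

Definition count_obj : glue D :=
  @GObj D (bpow bp tunit 2) (fun u => u = binj bp tunit 2 0%N)
    (fun y => y = iota ∘ bprj bp tunit 2 1%N).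

Lemma counts_pos : counts (P := count_obj) (bprj bp tunit 2 0%N) (bprj bp tunit 2 1%N).
Proof. by split=> // w ->; rewrite !bprj_inj. Qed.

Lemma counts_neg : counts (P := count_obj^⊥) (dual_test (binj bp tunit 2 1%N))
  (dual_test (binj bp tunit 2 0%N)).
Proof using iotaiK iotaK.
split; first exact: gdual_test.
move=> _ /(gdual_point iotaK)[t ht ->]; rewrite !(dual_test_point iotaiK).
have -> : t = bprj bp tunit 2 1%N.
  have e : iotai ∘ (iota ∘ t) = iotai ∘ (iota ∘ bprj bp tunit 2 1%N) by rewrite ht.
  by move: e; rewrite -!compA iotaiK !comp1f.
by rewrite !bprj_inj.
Qed.

Variable N : nat.
Implicit Types (A B : formula N) (G H : seq (formula N)).

Fixpoint npars A : nat :=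
  match A with
  | Lit _ _ => 0
  | Tens A B => npars A + npars B
  | Par A B => (npars A + npars B).+1
  end.

Fixpoint snpars A G : nat :=
  if G is B :: G' then (npars A + snpars B G').+1 else npars A.

(** For labels 0 and 1, the ends of a link with a common label contribute 1 together, so the degree
    of a labelling constant along the links is their number. *)
Definition degree T (s : seq (T * (bool * 'I_N))) (k : T -> nat) : nat :=
  \sum_(x <- s) (if x.2.1 then k x.1 else 1 - k x.1).

Local Notation pt := (fun (_ : 'I_N) u => u = binj bp tunit 2 0%N).
Local Notation cpt := (fun (_ : 'I_N) y => y = iota ∘ bprj bp tunit 2 1%N).
Local Notation bftest := (bftest iota iotai pt cpt).
Local Notation bstest := (bstest iota iotai pt cpt).

Definition fbasis A d (t : hom _ tunit) := exists k : seq bool -> nat,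
  [/\ forall p, k p < 2, degree (flits A) k = d & t = bftest A k].
Definition sbasis A G d (t : hom _ tunit) := exists k : addr -> nat,
  [/\ forall p, k p < 2, degree (slits (A :: G)) k = d & t = bstest A G k].

Lemma degree_cat T (s t : seq (T * (bool * 'I_N))) k :
  degree (s ++ t) k = degree s k + degree t k.
Proof. by rewrite /degree big_cat. Qed.

Lemma degree_map S T (f : S -> T) (s : seq (S * (bool * 'I_N))) k :
  degree [seq (f x.1, x.2) | x <- s] k = degree s (fun v => k (f v)).
Proof. by rewrite /degree big_map. Qed.

Lemma fbasis_tens A B d e t s : fbasis d t -> fbasis e s ->
  fbasis (A := Tens A B) (d + e) (tens_test t s).
Proof.
move=> [k [kn <- ->]] [k' [kn' <- ->]].
exists (join_tests k k' 0%N); split=> //; first by case=> [|[]].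
by rewrite degree_cat !degree_map.
Qed.

Lemma fbasis_par A B d e t s : fbasis d t -> fbasis e s ->
  fbasis (A := Par A B) (d + e) (par_test t s).
Proof.
move=> [k [kn <- ->]] [k' [kn' <- ->]].
exists (join_tests k k' 0%N); split=> //; first by case=> [|[]].
by rewrite degree_cat !degree_map.
Qed.

Lemma sbasis_cons A B G d e t s : fbasis (A := A) d t -> sbasis (A := B) (G := G) e s ->
  sbasis (A := A) (G := B :: G) (d + e) (par_test t s).
Proof.
move=> [k [kn <- ->]] [k' [kn' <- ->]].
exists (fun v => if v.1 is i.+1 then k' (i, v.2) else k v.2); split=> //.
- by move=> [[|i] p] /=.
- have -> : slits [:: A, B & G] = [seq ((0%N, x.1), x.2) | x <- flits A]
      ++ [seq ((x.1.1.+1, x.1.2), x.2) | x <- slits (B :: G)] by [].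
  rewrite degree_cat (degree_map (pair 0%N)) (degree_map (fun v : addr => (v.1.+1, v.2))).
  by congr addn; apply: eq_bigr => -[[i p] ?] _.
- congr par_test; apply: eq_stest => -[i p] j; by [].
Qed.

(* k and z are homogeneous: with a the number of pars, they are combinations of
   basis tests of degree a and a + 1. *)
Lemma fcount A : exists k z, [/\ counts k z, spans (fbasis (A := A) (npars A)) k &
  spans (fbasis (A := A) (npars A).+1) z].
Proof using iotaiK iotaK.
elim: A => [[] i|A [k [z [c hk hz]]] B [k' [z' [c' hk' hz']]]|A [k [z [c hk hz]]] B [k' [z' [c' hk' hz']]]].
- exists (bprj bp tunit 2 0%N), (bprj bp tunit 2 1%N); split; first exact: counts_pos.
    apply: spans_mem; exists (fun _ => 0%N); split=> //; by rewrite /degree big_seq1.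
  apply: spans_mem; exists (fun _ => 1%N); split=> //; by rewrite /degree big_seq1.
- exists (dual_test (binj bp tunit 2 1%N)), (dual_test (binj bp tunit 2 0%N)); split; first exact: counts_neg.
    apply: spans_mem; exists (fun _ => 1%N); split=> //; by rewrite /degree big_seq1.
  apply: spans_mem; exists (fun _ => 0%N); split=> //; by rewrite /degree big_seq1.
- exists (tens_test k k'), (add bp (tens_test z k') (tens_test k z')); split.
  + exact: counts_tens c c'.
  + apply: spans_comb hk hk'; [exact: tens_contract_r|exact: tens_contract_l|].
    exact: fbasis_tens.
  + apply: spans_add.
      apply: spans_comb hz hk'; [exact: tens_contract_r|exact: tens_contract_l|].
      move=> b b' hb hb'; exact: (fbasis_tens hb hb').
    apply: spans_comb hk hz'; [exact: tens_contract_r|exact: tens_contract_l|].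
    move=> b b' hb hb'; have := fbasis_tens hb hb'; by rewrite addnS.
- exists (par_test k z'), (par_test z z'); split.
  + exact: counts_par c c'.
  + apply: spans_comb hk hz'; [exact: par_contract_r|exact: par_contract_l|].
    move=> b b' hb hb'; have := fbasis_par hb hb'; by rewrite addnS.
  + apply: spans_comb hz hz'; [exact: par_contract_r|exact: par_contract_l|].
    move=> b b' hb hb'; have := fbasis_par hb hb'; by rewrite addnS.
Qed.

Lemma scount A G : exists k z, [/\ counts k z, spans (sbasis (A := A) (G := G) (snpars A G)) k &
  spans (sbasis (A := A) (G := G) (snpars A G).+1) z].
Proof using iotaiK iotaK.
elim: G A => [|B G IH] A.
  have [k [z [c hk hz]]] := fcount A; exists k, z.
  have h d t : fbasis (A := A) d t -> sbasis (A := A) (G := [::]) d t.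
    move=> [l [ln <- ->]]; exists (fun v => l v.2); split=> //.
    by rewrite /= cats0 (degree_map (pair 0%N)).
  split=> // w hw; [apply: hk|apply: hz] => b /h; exact: hw.
have [k [z [c hk hz]]] := fcount A; have [k' [z' [c' hk' hz']]] := IH B.
exists (par_test k z'), (par_test z z'); split.
- exact: counts_par c c'.
- apply: spans_comb hk hz'; [exact: par_contract_r|exact: par_contract_l|].
  move=> b b' hb hb'; have := sbasis_cons hb hb'; by rewrite addnS.
- apply: spans_comb hz hz'; [exact: par_contract_r|exact: par_contract_l|].
  move=> b b' hb hb'; have := sbasis_cons hb hb'; by rewrite addnS.
Qed.

Hypothesis zero_neq_one : (0 : hom (tunit : D) tunit) <> idc _.

Lemma count_label A G (tau : family (glue D) A G) : mll_transformation tau ->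
  exists k : addr -> nat, [/\ forall v, k v < 2,
    degree (slits (A :: G)) k = snpars A G & label_value iota iotai bp tau 2 k <> 0].
Proof using iotaiK iotaK zero_neq_one.
move=> tauN; have [k [z [[_ c] hk _]]] := scount A G.
have [e _] := c _ (gpoint_und (tau (bobj pt cpt))).
apply: NNPP => h; apply: zero_neq_one; rewrite -e; apply: esym; apply: hk => _ [l [ln ld ->]].
apply: NNPP => h0; apply: h; exists l; split=> //.
by rewrite (label_valueE _ _ pt cpt).
Qed.

End Counting.

Section Label.
Variable N : nat.
Implicit Types (A B : formula N) (G : seq (formula N)).

Fixpoint flabel A (k : seq bool -> nat) : lform ('I_N * nat)%type :=
  match A with
  | Lit b i => LLit b (i, k [::])
  | Tens A B => LTens (flabel A (fun p => k (false :: p))) (flabel B (fun p => k (true :: p)))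
  | Par A B => LPar (flabel A (fun p => k (false :: p))) (flabel B (fun p => k (true :: p)))
  end.

Fixpoint slabel G (k : addr -> nat) : seq (lform ('I_N * nat)%type) :=
  if G is A :: G' then
    flabel A (fun p => k (0, p)) :: slabel G' (fun v => k (v.1.+1, v.2))
  else [::].

End Label.

(** * The glueing by three sets of scalars *)

Section Phase.
Variable D : star_autonomous.
Variables (iota : hom (tunit : D) bot) (iotai : hom (bot : D) tunit).
Hypothesis iotaiK : iotai ∘ iota = idc _.
Hypothesis iotaK : iota ∘ iotai = idc _.
Hypothesis points_sep : forall (A B : D) (f g : hom A B),
  (forall h : hom tunit A, f ∘ h = g ∘ h) -> f = g.
Variable bp : biproducts D.
Local Notation "0" := (zerom bp _ _) : cat_scope.
Implicit Types P Q : glue D.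
Local Notation par_test := (par_test iota iotai).
Local Notation dual_test := (dual_test iotai).
Local Notation dual_point := (dual_point iota).
Local Notation gtest := (gtest iota).

Lemma par_testZ A B (a b : hom (tunit : D) tunit) (t : hom A tunit) (s : hom B tunit) :
  par_test (a ∘ t) (b ∘ s) = a ∘ b ∘ par_test t s.
Proof using iotaiK points_sep.
apply: points_sep => w.
have [u hu] := par_contract_r iotaiK w (b ∘ s).
have [v hv] := par_contract_l iotaiK w t.
by rewrite hu 2!compA -hu hv [in RHS]compA hv !compA.
Qed.

Lemma dual_testZ A (a : hom (tunit : D) tunit) (b : hom tunit A) :
  a ∘ dual_test b = dual_test (b ∘ a).
Proof using iotaiK iotaK points_sep.
apply: points_sep => w; have [t ->] := dual_point_surj iotaK w.
by rewrite compA !(dual_test_point iotaiK) scalC compA.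
Qed.

Lemma gtest_inj P (t s : hom (car P) tunit) : iota ∘ t = iota ∘ s -> t = s.
Proof using iotaiK. exact: (split_mono iotaiK). Qed.

(* The values F, O and T as sets of scalars: {0}, {0, 1} and all scalars. *)
Definition pts r (a : hom (tunit : D) tunit) : Prop :=
  match r with VF => a = 0 | VO => a = 0 \/ a = idc _ | VT => True end.
Definition cpts r := pts (dual3 r).

Lemma pts0 r : pts r 0.
Proof. by case: r => /=; auto. Qed.

Lemma pts_tens r s a b : pts r a -> pts s b -> pts (tens3 r s) (a ∘ b).
Proof.
case: r s => [] [] //=; try by move=> -> ->; rewrite ?comp0f.
- by move=> ->; rewrite comp0f.
- by move=> ->; rewrite comp0f.
- by move=> _ ->; rewrite compf0.
- by case=> ->; case=> ->; rewrite ?comp0f ?compf0 ?comp1f; auto.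
- by move=> _ ->; rewrite compf0.
Qed.

Lemma cpts_tens r s z b : cpts (tens3 r s) z -> pts s b -> cpts r (z ∘ b).
Proof.
move=> hz hb; have : pts (tens3 (dual3 (tens3 r s)) s) (z ∘ b) by apply: pts_tens.
rewrite /cpts; move: hz hb; case: r s => [] [] //= hz hb; rewrite ?hz ?hb ?comp0f ?compf0 //; auto.
Qed.

Lemma cpts_par r s z : cpts (par3 r s) z -> exists a b, [/\ cpts r a, cpts s b & z = a ∘ b].
Proof.
rewrite /cpts; case: r s => [] [] /=;
  try (by move=> h; exists z, (idc _); rewrite compf1; split; auto);
  try (by move=> h; exists (idc _), z; rewrite comp1f; split; auto).
by move=> ->; exists 0, 0; rewrite comp0f.
Qed.

(** It is enough to take z = 1, which lies in [cpts s] unless s is VT; in that case the par is VT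
    and nothing is claimed. *)
Lemma pts_par r s a : (forall z, cpts s z -> pts r (z ∘ a)) ->
  (forall z, cpts r z -> pts s (z ∘ a)) -> pts (par3 r s) a.
Proof.
rewrite /cpts => h h'; have := h (idc _); have := h' (idc _); move: h h'; rewrite comp1f.
by case: r s => [] [] //= h h' h1 h2; auto.
Qed.

(** The two halves depend on each other: the tests on a tensor use the points of its arguments, and
    the points of a par use the tests on its arguments. *)
Definition sound P r (t : hom (car P) tunit) :=
  (forall z, cpts r z -> gtest (z ∘ t)) /\ (forall w, gpoint w -> pts r (t ∘ w)).

Lemma sound_tens P Q r s (t : hom (car P) tunit) (t' : hom (car Q) tunit) :
  sound r t -> sound s t' -> sound (P := P ⊗ Q) (tens3 r s) (tens_test t t').
Proof.
move=> [h1 h2] [h1' h2']; split=> [z hz|w /gtens_point[u [v [hu hv ->]]]].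
  apply: gtens_test => [v hv|u hu].
    rewrite 2!compA -[X in z ∘ X]compA tens_test_r -compA; apply: h1.
    exact: cpts_tens hz (h2' v hv).
  rewrite 2!compA -[X in z ∘ X]compA tens_test_l -compA; apply: h1'.
  apply: cpts_tens (h2 u hu); move: hz; congr (cpts _ z).
  by case: (r) (s) => [] [].
by rewrite tens_test_point; apply: pts_tens; [apply: h2|apply: h2'].
Qed.

Lemma sound_par P Q r s (t : hom (car P) tunit) (t' : hom (car Q) tunit) :
  sound r t -> sound s t' -> sound (P := par P Q) (par3 r s) (par_test t t').
Proof using iotaiK iotaK points_sep.
move=> [h1 h2] [h1' h2']; split=> [z /cpts_par[a [b [ha hb ->]]]|w hw].
  by rewrite -par_testZ; apply: gpar_test => //; [apply: h1|apply: h1'].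
apply: pts_par => z hz.
  have [u hu e] := gpar_point_r iotaiK hw (h1' z hz).
  have := h2 u hu; rewrite -e -[t in par_test t _]comp1f par_testZ comp1f compA.
  by [].
have [u hu e] := gpar_point_l iotaiK hw (h1 z hz).
have := h2' u hu; rewrite -e -[t' in par_test _ t']comp1f par_testZ compf1 compA.
by [].
Qed.

Section Basis.
Variables (N n : nat) (val_of : 'I_N * nat -> val3).
Local Notation bprj := (bprj bp (tunit : D) n).
Local Notation binj := (binj bp (tunit : D) n).

Definition phase_pt i (u : hom tunit (bpow bp (tunit : D) n)) :=
  exists k a, pts (val_of (i, k)) a /\ u = binj k ∘ a.
Definition phase_cpt i (y : hom (bpow bp (tunit : D) n) bot) :=
  exists k a, cpts (val_of (i, k)) a /\ y = iota ∘ (a ∘ bprj k).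
Local Notation bftest := (bftest iota iotai phase_pt phase_cpt).
Local Notation bstest := (bstest iota iotai phase_pt phase_cpt).
Local Notation R := (bobj phase_pt phase_cpt).

Lemma sound_pos i k : sound (P := R i) (val_of (i, k)) (bprj k).
Proof.
split=> [z hz|_ [l [a [ha ->]]]]; first by exists k, z.
rewrite -compA bprj_inj_lt; case: andP => [[/eqP-> _]|_]; rewrite ?comp1f ?comp0f //.
exact: pts0.
Qed.

Lemma sound_neg i k : sound (P := (R i)^⊥) (dual3 (val_of (i, k))) (dual_test (binj k)).
Proof using iotaiK iotaK points_sep.
split=> [z hz|_ /(gdual_point iotaK)[t [l [a [ha /(gtest_inj (P := R i))-> ]]] ->]].
  rewrite dual_testZ; apply: gdual_test => //; exists k, z; split=> //.
  by move: hz; rewrite /cpts; case: (val_of _).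
rewrite (dual_test_point iotaiK) compA bprj_inj_lt.
by case: andP => [[/eqP<- _]|_]; rewrite ?compf1 ?compf0 //; apply: pts0.
Qed.

Lemma fsound A k : sound (val val_of (flabel A k)) (bftest A k).
Proof using iotaiK iotaK points_sep.
elim: A k => [[] i|A IA B IB|A IA B IB] k /=.
- exact: sound_pos.
- exact: sound_neg.
- exact: (sound_tens (IA _) (IB _)).
- exact: (sound_par (IA _) (IB _)).
Qed.

Lemma ssound A G k : sound (vpar val_of (slabel (A :: G) k)) (bstest A G k).
Proof using iotaiK iotaK points_sep.
elim: G A k => [|B G IH] A k.
  by rewrite /vpar /= big_seq1; apply: fsound.
have -> : vpar val_of (slabel [:: A, B & G] k) = par3 (val val_of (flabel A (fun p => k (0%N, p))))
    (vpar val_of (slabel (B :: G) (fun v => k (v.1.+1, v.2)))) by rewrite /vpar big_cons.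
exact: (sound_par (fsound _ _) (IH _ _)).
Qed.

End Basis.

(** The constant valuation VO shows that every label value is 0 or 1; a valuation that makes the
    sequent VF forces the value 0. *)
Lemma label_value_pts N (A : formula N) G (tau : family (glue D) A G) n k v :
  mll_transformation tau ->
  pts (vpar v (slabel (A :: G) k)) (label_value iota iotai bp tau n k).
Proof using iotaiK iotaK points_sep.
move=> tauN; rewrite (label_valueE _ _ (@phase_pt N n v) (@phase_cpt N n v)) //.
by have [_ h] := @ssound N n v A G k; apply: h; apply: gpoint_und.
Qed.

End Phase.

(** * The glueing by coordinate vectors and 0/1-valued functionals *)

Section Separation.
Variable D : star_autonomous.
Variables (iota : hom (tunit : D) bot) (iotai : hom (bot : D) tunit).
Hypothesis iotaiK : iotai ∘ iota = idc _.
Hypothesis iotaK : iota ∘ iotai = idc _.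
Hypothesis points_sep : forall (A B : D) (f g : hom A B),
  (forall h : hom tunit A, f ∘ h = g ∘ h) -> f = g.
Variable bp : biproducts D.
Local Notation "0" := (zerom bp _ _) : cat_scope.
Implicit Types P Q : glue D.
Local Notation par_test := (par_test iota iotai).
Local Notation dual_test := (dual_test iotai).
Local Notation dual_point := (dual_point iota).
Local Notation gtest := (gtest iota).
Local Notation add := (add bp).
Implicit Types a b : hom (tunit : D) tunit.

Lemma par_testDl A B (t t' : hom A tunit) (s : hom B tunit) :
  par_test (add t t') s = add (par_test t s) (par_test t' s).
Proof using iotaiK points_sep.
apply: points_sep => w; have [u hu] := par_contract_r iotaiK w s.
by rewrite hu !compDl !hu.
Qed.

Lemma par_test0 A B (s : hom (B : D) tunit) : par_test (0 : hom A tunit) s = 0.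
Proof using iotaiK points_sep.
apply: points_sep => w; have [u hu] := par_contract_r iotaiK w s.
by rewrite hu !comp0f.
Qed.

Definition bit a := a = 0 \/ a = idc _.
Definition le1 a b := [\/ a = 0 /\ b = 0, a = idc _ /\ b = 0 | a = 0 /\ b = idc _].

Definition boolean P (t : hom (car P) tunit) :=
  [/\ gtest t, gtest (0 : hom (car P) tunit) & forall w, gpoint w -> bit (t ∘ w)].

Definition kills X (M : hom (X : D) tunit -> Prop) (w : hom tunit X) :=
  forall m, M m -> m ∘ w = 0.

(* Up to points killed by M, the tests t and t' coincide with tests that are
   never both 1 on a point. *)
Definition apart P (t t' : hom (car P) tunit) (M : hom (car P) tunit -> Prop) :=
  gtest (0 : hom (car P) tunit) /\ exists z z', [/\ gtest z, gtest z', gtest (add z z'),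
    forall w, gpoint w -> le1 (z ∘ w) (z' ∘ w) &
    forall w, kills M w -> z ∘ w = t ∘ w /\ z' ∘ w = t' ∘ w].

Lemma gtest_bit P (t : hom (car P) tunit) a :
  gtest t -> gtest (0 : hom (car P) tunit) -> bit a -> gtest (a ∘ t).
Proof. by move=> ht h0 [->|->]; rewrite ?comp0f ?comp1f. Qed.

Lemma boolean_tens P Q (t : hom (car P) tunit) (s : hom (car Q) tunit) :
  boolean t -> boolean s -> boolean (P := P ⊗ Q) (tens_test t s).
Proof.
move=> [h1 h2 h3] [k1 k2 k3]; split.
- apply: gtens_test => [v hv|u hu]; rewrite ?tens_test_r ?tens_test_l.
    by apply: gtest_bit => //; apply: k3.
  by apply: gtest_bit => //; apply: h3.
- by apply: gtens_test => [v hv|u hu]; rewrite !comp0f.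
- move=> w /gtens_point[u [v [hu hv ->]]]; rewrite tens_test_point.
  by case: (h3 u hu) => ->; case: (k3 v hv) => ->; rewrite ?comp0f ?comp1f; [left|left|left|right].
Qed.

Lemma boolean_par P Q (t : hom (car P) tunit) (s : hom (car Q) tunit) :
  boolean t -> boolean s -> boolean (P := par P Q) (par_test t s).
Proof using iotaiK iotaK points_sep.
move=> [h1 h2 h3] [k1 k2 k3]; split; first exact: gpar_test.
  by have := gpar_test iotaK h2 k1; rewrite par_test0.
move=> w hw; have [u hu ->] := gpar_point_r iotaiK hw k1; exact: h3.
Qed.

Lemma apart_pull P Q (f : hom P Q) t t' M M' : apart (P := Q) t t' M' ->
  (forall m, M' m -> M (m ∘ und f)) -> apart (P := P) (t ∘ und f) (t' ∘ und f) M.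
Proof.
move=> [h0 [z [z' [h1 h2 h3 h4 h5]]]] MM; split.
  by rewrite -(comp0f bp _ (und f)); apply: gtest_pull.
exists (z ∘ und f), (z' ∘ und f); split.
- exact: gtest_pull.
- exact: gtest_pull.
- by rewrite -compDl; apply: gtest_pull.
- by move=> w hw; rewrite !compA; apply: h4; apply: gpoint_pull.
- by move=> w hw; rewrite !compA; apply: h5 => m /MM h; rewrite -compA; apply: hw.
Qed.

Lemma le1_bit a b : le1 a b -> bit a /\ bit b.
Proof. by case=> -[-> ->]; split; rewrite /bit; auto. Qed.

(** A point of Q leaves 0, z, z' or z + z', which is why [apart] asks for z + z' to be a glued test.
    A point of P leaves at most one of s and s', as z and z' are never both 1. *)
Lemma apart_tens_l P Q (t t' : hom (car P) tunit) (s s' : hom (car Q) tunit) M1 M :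
  apart t t' M1 -> boolean s -> boolean s' ->
  (forall m, M1 m -> M (tens_test m s) /\ M (tens_test m s')) ->
  apart (P := P ⊗ Q) (tens_test t s) (tens_test t' s') M.
Proof.
move=> [h0 [z [z' [h1 h2 h3 h4 h5]]]] [s1 s0 sb] [s1' _ sb'] MM; split.
  by apply: gtens_test => [v hv|u hu]; rewrite !comp0f.
exists (tens_test z s), (tens_test z' s'); split.
- apply: gtens_test => [v hv|u hu]; rewrite ?tens_test_r ?tens_test_l.
    by apply: gtest_bit => //; apply: sb.
  by apply: gtest_bit => //; have [] := le1_bit (h4 u hu).
- apply: gtens_test => [v hv|u hu]; rewrite ?tens_test_r ?tens_test_l.
    by apply: gtest_bit => //; apply: sb'.
  by apply: gtest_bit => //; have [] := le1_bit (h4 u hu).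
- apply: gtens_test => [v hv|u hu]; rewrite !compDl ?tens_test_r ?tens_test_l.
    by case: (sb v hv) (sb' v hv) => -> [] ->; rewrite ?comp1f ?comp0f ?add0f ?addf0.
  by case: (h4 u hu) => -[-> ->]; rewrite ?comp1f ?comp0f ?add0f ?addf0.
- move=> w /gtens_point[u [v [hu hv ->]]]; rewrite !tens_test_point.
  case: (h4 u hu) => -[-> ->]; case: (sb v hv) (sb' v hv) => -> [] ->;
  rewrite ?comp1f ?comp0f; first [by constructor 1|by constructor 2|by constructor 3].
- move=> w hw; split.
    have [u hu] := tens_contract_r w s; rewrite !hu.
    by apply: (h5 u _).1 => m /MM[Mm _]; rewrite -hu; apply: hw.
  have [u hu] := tens_contract_r w s'; rewrite !hu.
  by apply: (h5 u _).2 => m /MM[_ Mm]; rewrite -hu; apply: hw.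
Qed.

Lemma apart_par_l P Q (t t' : hom (car P) tunit) (s : hom (car Q) tunit) M1 M :
  apart t t' M1 -> boolean s -> (forall m, M1 m -> M (par_test m s)) ->
  apart (P := par P Q) (par_test t s) (par_test t' s) M.
Proof using iotaiK iotaK points_sep.
move=> [h0 [z [z' [h1 h2 h3 h4 h5]]]] [s1 s0 sb] MM; split.
  by have := gpar_test iotaK h0 s1; rewrite par_test0.
exists (par_test z s), (par_test z' s); split; try exact: gpar_test.
- by rewrite -par_testDl; apply: gpar_test.
- move=> w hw; have [u hu e] := gpar_point_r iotaiK hw s1; rewrite !e; exact: h4.
- move=> w hw; have [u hu] := par_contract_r iotaiK w s; rewrite !hu.
  by apply: h5 => m /MM Mm; rewrite -hu; apply: hw.
Qed.

Lemma tens_test_braid A B (t : hom (A : D) tunit) (s : hom (B : D) tunit) :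
  tens_test s t ∘ braid A B = tens_test t s.
Proof. by rewrite /tens_test compA -braid_nat -compA lun_braid lun_run. Qed.

(** Reduced to [apart_tens_l] along the symmetry; M' collects the mixed tests before the exchange of
    the arguments. *)
Lemma apart_tens_r P Q (t t' : hom (car P) tunit) (s s' : hom (car Q) tunit) M2 M :
  boolean t -> boolean t' -> apart s s' M2 ->
  (forall m, M2 m -> M (tens_test t m) /\ M (tens_test t' m)) ->
  apart (P := P ⊗ Q) (tens_test t s) (tens_test t' s') M.
Proof.
move=> ht ht' a MM.
pose M' x := exists2 m, M2 m & x = tens_test m t \/ x = tens_test m t'.
have := @apart_pull (P ⊗ Q) (Q ⊗ P) (braid P Q) _ _ M M'
  (@apart_tens_l Q P s s' t t' M2 M' a ht ht' _).
rewrite ![_ ∘ und _]tens_test_braid; apply.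
  by move=> m hm; split; exists m; auto.
by move=> x [m /MM[h h'] [->|->]]; rewrite [_ ∘ und _]tens_test_braid.
Qed.

Lemma apart_par_r P Q (t : hom (car P) tunit) (s s' : hom (car Q) tunit) M2 M :
  boolean t -> apart s s' M2 -> (forall m, M2 m -> M (par_test t m)) ->
  apart (P := par P Q) (par_test t s) (par_test t s') M.
Proof using iotaiK iotaK points_sep.
move=> ht a MM; pose M' x := exists2 m, M2 m & x = par_test m t.
have := @apart_pull (par P Q) (par Q P) (par_braid P Q) _ _ M M'
  (@apart_par_l Q P s s' t M2 M' a ht _).
rewrite ![_ ∘ und _]par_test_braid; apply.
  by move=> m hm; exists m; auto.
by move=> x [m /MM h ->]; rewrite [_ ∘ und _]par_test_braid.
Qed.

(** With the common factor y + y' both tests are read at the same point of P, where z and z' are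
    never both 1. The sum adds the mixed tests t ⅋ s' and t' ⅋ s to the values, and these are killed
    by assumption. *)
Lemma apart_par P Q (t t' : hom (car P) tunit) (s s' : hom (car Q) tunit) M1 M2 M :
  apart t t' M1 -> apart s s' M2 ->
  (forall m, M1 m -> M (par_test m s) /\ M (par_test m s')) ->
  (forall m, M2 m -> M (par_test t m) /\ M (par_test t' m)) ->
  (forall m m', M1 m -> M2 m' -> M (par_test m m')) ->
  M (par_test t s') -> M (par_test t' s) ->
  apart (P := par P Q) (par_test t s) (par_test t' s') M.
Proof using iotaiK iotaK points_sep.
move=> [h0 [z [z' [h1 h2 h3 h4 h5]]]] [k0 [y [y' [k1 k2 k3 k4 k5]]]] M1M M2M MM tsM t'sM; split.
  by have := gpar_test iotaK h0 k1; rewrite par_test0.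
exists (par_test z (add y y')), (par_test z' (add y y')); split; try exact: gpar_test.
- by rewrite -par_testDl; apply: gpar_test.
- move=> w hw; have [u hu e] := gpar_point_r iotaiK hw k3; rewrite !e; exact: h4.
move=> w hw; have [u hu] := par_contract_r iotaiK w (add y y'); rewrite !hu.
have key r : (forall m, M2 m -> par_test r m ∘ w = 0) ->
    r ∘ u = add (par_test r s ∘ w) (par_test r s' ∘ w).
  move=> hr; rewrite -hu; have [v hv] := par_contract_l iotaiK w r; rewrite !hv compDl.
  by have [|-> ->] := k5 v; first by move=> m /hr; rewrite hv.
have [|-> ->] := h5 u.
  move=> m hm; rewrite key; last by move=> m' hm'; apply: hw; apply: MM.
  by have [hs hs'] := M1M m hm; rewrite (hw _ hs) (hw _ hs') addf0.
rewrite !key; first 1 last.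
- by move=> m /M2M[_ h]; apply: hw.
- by move=> m /M2M[h _]; apply: hw.
by rewrite (hw _ tsM) (hw _ t'sM) addf0 add0f.
Qed.

Section Labels.
Variables (N n : nat).
Implicit Types (A B : formula N) (G : seq (formula N)).
Local Notation bprj := (bprj bp (tunit : D) n).
Local Notation binj := (binj bp (tunit : D) n).

Definition bit_pt (i : 'I_N) (u : hom tunit (bpow bp (tunit : D) n)) :=
  u = 0 \/ exists k, u = binj k.
Definition bit_cpt (i : 'I_N) (y : hom (bpow bp (tunit : D) n) bot) :=
  exists x, (forall k, bit (x ∘ binj k)) /\ y = iota ∘ x.
Local Notation bftest := (bftest iota iotai bit_pt bit_cpt).
Local Notation bstest := (bstest iota iotai bit_pt bit_cpt).
Local Notation R := (bobj bit_pt bit_cpt).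

Lemma bprj_binj_bit k l : bit (bprj k ∘ binj l).
Proof. by rewrite bprj_inj_lt; case: ifP; [right|left]. Qed.

Lemma boolean_pos i k : boolean (P := R i) (bprj k).
Proof.
split; first by exists (bprj k); split=> // l; apply: bprj_binj_bit.
  by exists 0; split=> // l; rewrite comp0f; left.
by move=> _ [->|[l ->]]; [rewrite compf0; left|apply: bprj_binj_bit].
Qed.

Lemma boolean_neg i k : boolean (P := (R i)^⊥) (dual_test (binj k)).
Proof using iotaiK iotaK points_sep.
have d0 : dual_test (0 : hom tunit (bpow bp (tunit : D) n)) = 0.
  apply: points_sep => w; have [t ->] := dual_point_surj iotaK w.
  by rewrite (dual_test_point iotaiK) comp0f compf0.
split; first by apply: gdual_test => //; right; exists k.
  by have := @gdual_test _ _ _ iotaK (R i) 0 (or_introl erefl); rewrite d0.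
move=> _ /(gdual_point iotaK)[t [x [hx /(gtest_inj iotaiK (P := R i))->]] ->].
by rewrite (dual_test_point iotaiK).
Qed.

Lemma fboolean A k : boolean (bftest A k).
Proof using iotaiK iotaK points_sep.
elim: A k => [[] i|A IA B IB|A IA B IB] k.
- exact: boolean_pos.
- exact: boolean_neg.
- exact: boolean_tens (IA _) (IB _).
- exact: boolean_par (IA _) (IB _).
Qed.

Lemma sboolean A G k : boolean (bstest A G k).
Proof using iotaiK iotaK points_sep.
elim: G A k => [|B G IH] A k; first exact: fboolean.
exact: boolean_par (fboolean _ _) (IH _ _).
Qed.

Definition fdiff A (k l : seq bool -> nat) :=
  exists p i, subf A p = Some (Lit true i) /\ k p <> l p.
Definition sdiff G (k l : addr -> nat) :=
  exists v i, occ G v = Some (Lit true i) /\ k v <> l v.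
Definition fagree A (k l : seq bool -> nat) :=
  forall p i, subf A p = Some (Lit false i) -> k p = l p.
Definition sagree_neg G (k l : addr -> nat) :=
  forall v i, occ G v = Some (Lit false i) -> k v = l v.

Definition fmixed A (k l : seq bool -> nat) (m : hom _ tunit) := exists j,
  [/\ forall p, j p = k p \/ j p = l p, fdiff A j k, fdiff A j l & m = bftest A j].
Definition smixed A G (k l : addr -> nat) (m : hom _ tunit) := exists j,
  [/\ forall p, j p = k p \/ j p = l p, sdiff (A :: G) j k, sdiff (A :: G) j l &
    m = bstest A G j].

Lemma eq_bftest A k l : fagree A k l -> ~ fdiff A k l -> bftest A k = bftest A l.
Proof.
move=> a nd; apply: eq_ftest => p i; split=> h; last by rewrite (a p i h).
have -> // : k p = l p by apply: NNPP => ne; apply: nd; exists p, i.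
Qed.

Lemma eq_bstest A G k l : sagree_neg (A :: G) k l -> ~ sdiff (A :: G) k l ->
  bstest A G k = bstest A G l.
Proof.
move=> a nd; apply: eq_stest => p i; split=> h; last by rewrite (a p i h).
have -> // : k p = l p by apply: NNPP => ne; apply: nd; exists p, i.
Qed.

Lemma apart_pos i k l : k <> l ->
  apart (P := R i) (bprj k) (bprj l) (fun=> False).
Proof.
move=> kl; have [hk h0 hk'] := boolean_pos i k; have [hl _ _] := boolean_pos i l.
have e j : le1 (bprj k ∘ binj j) (bprj l ∘ binj j).
  rewrite !bprj_inj_lt; case: (k =P j) => kj; case: (l =P j) => lj /=;
    [by case: kl; rewrite kj| | |by constructor 1].
    by case: ifP => _; [constructor 2|constructor 1].
  by case: ifP => _; [constructor 3|constructor 1].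
split=> //; exists (bprj k), (bprj l); split=> //.
  exists (add (bprj k) (bprj l)); split=> // j; rewrite compDl.
  by case: (e j) => -[-> ->]; rewrite ?addf0 ?add0f; [left|right|right].
by move=> _ [->|[j ->]]; [rewrite !compf0; constructor 1|apply: e].
Qed.

Lemma fmixed_tens A B (j j' kk ll : seq bool -> nat) :
  (forall p, j p = kk (false :: p) \/ j p = ll (false :: p)) ->
  (forall p, j' p = kk (true :: p) \/ j' p = ll (true :: p)) ->
  fdiff A j (fun p => kk (false :: p)) \/ fdiff B j' (fun p => kk (true :: p)) ->
  fdiff A j (fun p => ll (false :: p)) \/ fdiff B j' (fun p => ll (true :: p)) ->
  fmixed (A := Tens A B) kk ll (tens_test (bftest A j) (bftest B j')) /\
  fmixed (A := Par A B) kk ll (par_test (bftest A j) (bftest B j')).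
Proof.
move=> hj hj' dk dl; split; exists (join_tests j j' (kk [::])); split=> //;
  try (by case=> [|[] p]; [left|exact: hj'|exact: hj]);
  try (by case: dk => -[p [i [h1 h2]]]; [exists (false :: p), i|exists (true :: p), i]);
  by case: dl => -[p [i [h1 h2]]]; [exists (false :: p), i|exists (true :: p), i].
Qed.

Lemma smixed_cons A B G (j : seq bool -> nat) (j' kk ll : addr -> nat) :
  (forall p, j p = kk (0%N, p) \/ j p = ll (0%N, p)) ->
  (forall v, j' v = kk (v.1.+1, v.2) \/ j' v = ll (v.1.+1, v.2)) ->
  fdiff A j (fun p => kk (0%N, p)) \/ sdiff (B :: G) j' (fun v => kk (v.1.+1, v.2)) ->
  fdiff A j (fun p => ll (0%N, p)) \/ sdiff (B :: G) j' (fun v => ll (v.1.+1, v.2)) ->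
  smixed (A := A) (G := B :: G) kk ll (par_test (bftest A j) (bstest B G j')).
Proof.
move=> hj hj' dk dl; exists (fun v => if v.1 is i.+1 then j' (i, v.2) else j v.2); split=> //.
- by move=> [[|i] p]; [exact: hj|exact: (hj' (i, p))].
- case: dk => [[p [i [h1 h2]]]|[[i p] [x [h1 h2]]]]; [by exists (0%N, p), i|by exists (i.+1, p), x].
- case: dl => [[p [i [h1 h2]]]|[[i p] [x [h1 h2]]]]; [by exists (0%N, p), i|by exists (i.+1, p), x].
- congr par_test; by apply: eq_stest => -[i p] x.
Qed.

Lemma fapart A k l : fagree A k l -> fdiff A k l ->
  apart (bftest A k) (bftest A l) (fmixed (A := A) k l).
Proof using iotaiK iotaK points_sep.
elim: A k l => [b i|A IA B IB|A IA B IB] k l a.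
- move=> [[|c p] [x [h kl]]] //; case: b a h => // a _.
  have [h0 [z [z' [h1 h2 h3 h4 h5]]]] := apart_pos i kl.
  split=> //; exists z, z'; split=> // w _; exact: h5.
- set k1 := fun p => k (false :: p); set k2 := fun p => k (true :: p).
  set l1 := fun p => l (false :: p); set l2 := fun p => l (true :: p).
  have aA : fagree A k1 l1 by move=> p; apply: (a (false :: p)).
  have aB : fagree B k2 l2 by move=> p; apply: (a (true :: p)).
  move=> d; have dd : fdiff A k1 l1 \/ fdiff B k2 l2.
    by case: d => -[|[] p] [i [h1 h2]] //; [right|left]; exists p, i.
  case: dd => [d1|d2].
    apply: (apart_tens_l (IA _ _ aA d1) (fboolean _ _) (fboolean _ _)).
    by move=> _ [j [bj jk jl ->]]; split; apply: (proj1 (fmixed_tens _ _ _ _)); auto.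
  apply: (apart_tens_r (fboolean _ _) (fboolean _ _) (IB _ _ aB d2)).
  by move=> _ [j [bj jk jl ->]]; split; apply: (proj1 (fmixed_tens _ _ _ _)); auto.
- set k1 := fun p => k (false :: p); set k2 := fun p => k (true :: p).
  set l1 := fun p => l (false :: p); set l2 := fun p => l (true :: p).
  have aA : fagree A k1 l1 by move=> p; apply: (a (false :: p)).
  have aB : fagree B k2 l2 by move=> p; apply: (a (true :: p)).
  have sym C h h' : fdiff C h h' -> fdiff C h' h.
    by move=> [p [i [h1 h2]]]; exists p, i; split=> // e; apply: h2.
  move=> d; have dd : fdiff A k1 l1 \/ fdiff B k2 l2.
    by case: d => -[|[] p] [i [h1 h2]] //; [right|left]; exists p, i.
  (* If the labellings agree on one side of the par, the two tests on that side coincide and only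
     the other side has to be told apart. *)
  have [d1|n1] := classic (fdiff A k1 l1); last first.
    case: dd => // d2; have e := eq_bftest aA n1.
    refine (eq_ind (bftest A k1) (fun t => apart (P := fobj R R (Par A B))
      (par_test (bftest A k1) (bftest B k2)) (par_test t (bftest B l2)) _) _ (bftest A l1) e).
    apply: (apart_par_r (fboolean _ _) (IB _ _ aB d2)).
    by move=> _ [j [bj jk jl ->]]; apply: (proj2 (fmixed_tens _ _ _ _)); auto.
  have [d2|n2] := classic (fdiff B k2 l2); last first.
    have e := eq_bftest aB n2.
    refine (eq_ind (bftest B k2) (fun t => apart (P := fobj R R (Par A B))
      (par_test (bftest A k1) (bftest B k2)) (par_test (bftest A l1) t) _) _ (bftest B l2) e).
    apply: (apart_par_l (IA _ _ aA d1) (fboolean _ _)).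
    by move=> _ [j [bj jk jl ->]]; apply: (proj2 (fmixed_tens _ _ _ _)); auto.
  apply: (apart_par (IA _ _ aA d1) (IB _ _ aB d2)).
  + by move=> _ [j [bj jk jl ->]]; split; apply: (proj2 (fmixed_tens _ _ _ _)); auto.
  + by move=> _ [j [bj jk jl ->]]; split; apply: (proj2 (fmixed_tens _ _ _ _)); auto.
  + by move=> _ _ [j [bj jk jl ->]] [j' [bj' jk' jl' ->]]; apply: (proj2 (fmixed_tens _ _ _ _)); auto.
  + by apply: (proj2 (fmixed_tens _ _ _ _)); auto.
  + by apply: (proj2 (fmixed_tens _ _ _ _)); auto.
Qed.

Lemma sapart A G k l : sagree_neg (A :: G) k l -> sdiff (A :: G) k l ->
  apart (bstest A G k) (bstest A G l) (smixed (A := A) (G := G) k l).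
Proof using iotaiK iotaK points_sep.
elim: G A k l => [|B G IH] A k l a.
  case=> [[[|i] p] [x [h1 h2]]]; last by move: h1; rewrite /occ /= onth0n.
  have aA : fagree A (fun p => k (0%N, p)) (fun p => l (0%N, p)) by move=> q; apply: (a (0%N, q)).
  have dA : fdiff A (fun p => k (0%N, p)) (fun p => l (0%N, p)) by exists p, x.
  have [h0 [z [z' [z1 z2 z3 z4 z5]]]] := fapart aA dA.
  split=> //; exists z, z'; split=> // w hw; apply: z5 => _ [j [bj [q [y [qy qk]]] [q' [y' [qy' ql]]] ->]].
  apply: hw; exists (fun v => if v.1 is 0 then j v.2 else k v); split=> //.
  - by move=> [[|i'] q0]; [exact: bj|left].
  - by exists (0%N, q), y.
  - by exists (0%N, q'), y'.
set k1 := fun p => k (0%N, p); set k2 := fun v : addr => k (v.1.+1, v.2).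
set l1 := fun p => l (0%N, p); set l2 := fun v : addr => l (v.1.+1, v.2).
have aA : fagree A k1 l1 by move=> p; apply: (a (0%N, p)).
have aB : sagree_neg (B :: G) k2 l2 by move=> p; apply: (a (p.1.+1, p.2)).
have sym C h h' : fdiff C h h' -> fdiff C h' h.
  by move=> [p [i [h1 h2]]]; exists p, i; split=> // e; apply: h2.
have syms H h h' : sdiff H h h' -> sdiff H h' h.
  by move=> [p [i [h1 h2]]]; exists p, i; split=> // e; apply: h2.
move=> d; have dd : fdiff A k1 l1 \/ sdiff (B :: G) k2 l2.
  by case: d => -[[|m] p] [i [h1 h2]]; [left; exists p, i|right; exists (m, p), i].
have [d1|n1] := classic (fdiff A k1 l1); last first.
  case: dd => // d2; have e := eq_bftest aA n1.
  refine (eq_ind (bftest A k1) (fun t => apart (P := seqobj R R A (B :: G))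
    (par_test (bftest A k1) (bstest B G k2)) (par_test t (bstest B G l2)) _) _ (bftest A l1) e).
  apply: (apart_par_r (fboolean _ _) (IH _ _ _ aB d2)).
  by move=> _ [j [bj jk jl ->]]; apply: smixed_cons; auto.
have [d2|n2] := classic (sdiff (B :: G) k2 l2); last first.
  have e := eq_bstest aB n2.
  refine (eq_ind (bstest B G k2) (fun t => apart (P := seqobj R R A (B :: G))
    (par_test (bftest A k1) (bstest B G k2)) (par_test (bftest A l1) t) _) _ (bstest B G l2) e).
  apply: (apart_par_l (fapart aA d1) (sboolean _ _ _)).
  by move=> _ [j [bj jk jl ->]]; apply: smixed_cons; auto.
apply: (apart_par (fapart aA d1) (IH _ _ _ aB d2)).
- by move=> _ [j [bj jk jl ->]]; split; apply: smixed_cons; auto.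
- by move=> _ [j [bj jk jl ->]]; split; apply: smixed_cons; auto.
- by move=> _ _ [j [bj jk jl ->]] [j' [bj' jk' jl' ->]]; apply: smixed_cons; auto.
- by apply: smixed_cons; auto.
- by apply: smixed_cons; auto.
Qed.

(** Otherwise tau is killed by all mixed tests, so its values at k and l are those of two tests that
    are never both 1, and one of them is 0. *)
Lemma label_value_between A G (tau : family (glue D) A G) k l :
  mll_transformation tau -> sagree_neg (A :: G) k l -> sdiff (A :: G) k l ->
  label_value iota iotai bp tau n k <> 0 -> label_value iota iotai bp tau n l <> 0 ->
  exists j, [/\ forall p, j p = k p \/ j p = l p, sdiff (A :: G) j k, sdiff (A :: G) j l &
    label_value iota iotai bp tau n j <> 0].
Proof using iotaiK iotaK points_sep.
move=> tauN a d; rewrite !(label_valueE _ _ bit_pt bit_cpt) // => vk vl.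
apply: NNPP => h; have [_ [z [z' [_ _ _ h4 h5]]]] := sapart a d.
have [|ek el] := h5 (und (tau R)).
  move=> _ [j [bj jk jl ->]]; apply: NNPP => ne; apply: h; exists j; split=> //.
  by rewrite (label_valueE _ _ bit_pt bit_cpt).
by have := h4 _ (gpoint_und (tau R)); rewrite ek el; case=> -[].
Qed.

End Labels.
End Separation.

(** * Full completeness *)

Lemma count_lt (T : eqType) (s : seq T) (a b : pred T) x :
  {in s, forall y, a y -> b y} -> x \in s -> b x -> ~~ a x -> count a s < count b s.
Proof.
move=> ab xs bx ax; have e : count a s = count a (filter b s).
  by rewrite count_filter; apply: eq_in_count => y ys /=; case: (boolP (a y)) => // /ab ->.
rewrite e -size_filter -(size_filter b) -(count_predC a (filter b s)) size_filter.
rewrite -[ltnLHS]addn0 ltn_add2l -has_count; apply/hasP; exists x => //.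
by rewrite mem_filter bx.
Qed.

Section LabelledSequents.
Variable N : nat.
Implicit Types (A B : formula N) (G : seq (formula N)).

Lemma erase_flabel A k : erase (flabel A k) = A.
Proof. by elim: A k => //= A IA B IB k; rewrite IA IB. Qed.

Lemma erase_slabel G k : map (@erase N) (slabel G k) = G.
Proof. by elim: G k => //= A G IH k; rewrite IH erase_flabel. Qed.

Lemma lleaf_flabel A k p : lleaf (flabel A k) p =
  if subf A p is Some (Lit b i) then Some (b, (i, k p)) else None.
Proof.
elim: A k p => [b i|A IA B IB|A IA B IB] k [|c p] //=; by case: c; rewrite ?IA ?IB.
Qed.

Lemma leaf_at_slabel G k v : leaf_at (slabel G k) v =
  if occ G v is Some (Lit b i) then Some (b, (i, k v)) else None.
Proof.
rewrite /leaf_at /look /occ; case: v => m p /=.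
elim: G m k => [|A G IH] [|m] k //=; first exact: lleaf_flabel.
by rewrite IH.
Qed.

Lemma leaves_flabel A k :
  leaves (flabel A k) = [seq (x.2.1, (x.2.2, k x.1)) | x <- flits A].
Proof.
by elim: A k => //= A IA B IB k; rewrite IA IB map_cat -!map_comp.
Qed.

Lemma sleaves_slabel G k :
  sleaves (slabel G k) = [seq (x.2.1, (x.2.2, k x.1)) | x <- slits G].
Proof.
elim: G k => //= A G IH k; rewrite sleaves_cons leaves_flabel IH map_cat -!map_comp.
congr (_ ++ _); by apply: eq_map => -[].
Qed.

Lemma size_flits A k : size (flits A) = (ntens (flabel A k) + npars A).+1.
Proof.
elim: A k => //= A IA B IB k; rewrite size_cat !size_map.
  by rewrite (IA (fun p => k (false :: p))) (IB (fun p => k (true :: p))); lia.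
by rewrite (IA (fun p => k (false :: p))) (IB (fun p => k (true :: p))); lia.
Qed.

Lemma size_slits A G k :
  size (slits (A :: G)) = (total (@ntens _) (slabel (A :: G) k) + snpars A G).+1.
Proof.
rewrite /total; elim: G A k => [|B G IH] A k.
  by rewrite /= cats0 size_map (size_flits _ (fun p => k (0, p))); lia.
have -> : size (slits [:: A, B & G]) = size (flits A) + size (slits (B :: G)).
  by rewrite [slits [:: A, B & G]]/= size_cat !size_map.
rewrite (IH B (fun v => k (v.1.+1, v.2))) (size_flits _ (fun p => k (0, p))) /=; lia.
Qed.

End LabelledSequents.

Lemma vpar_acyc (L : eqType) (v : L -> val3) K :
  (forall E, E \in K -> val v E <> VT) -> vpar v K <> VF ->
  forall E, E \in K -> val v E = VO.
Proof.
elim: K => // E K IH noT; rewrite vpar_cons => nF.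
have nE := noT E (mem_head _ _).
have nK F : F \in K -> val v F <> VT by move=> FK; apply: noT; rewrite inE FK orbT.
have nT : vpar v K <> VT.
  elim: (K) nK => [_|F K' IH' nK]; first by rewrite /vpar big_nil.
  rewrite vpar_cons; have := nK F (mem_head _ _).
  have : vpar v K' <> VT by apply: IH' => E' h; apply: nK; rewrite inE h orbT.
  by case: (val v F) (vpar v K') => [] [].
have [eE eK] : val v E = VO /\ vpar v K = VO.
  by move: nE nT nF; case: (val v E) (vpar v K) => [] [].
by move=> F; rewrite inE => /predU1P[->//|]; apply: IH; rewrite ?eK.
Qed.

Section Links.
Variable D : star_autonomous.
Variables (iota : hom (tunit : D) bot) (iotai : hom (bot : D) tunit).
Hypothesis iotaiK : iotai ∘ iota = idc _.
Hypothesis iotaK : iota ∘ iotai = idc _.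
Hypothesis points_sep : forall (A B : D) (f g : hom A B),
  (forall h : hom tunit A, f ∘ h = g ∘ h) -> f = g.
Variable bp : biproducts D.
Local Notation "0" := (zerom bp _ _) : cat_scope.
Hypothesis zero_neq_one : (0 : hom (tunit : D) tunit) <> idc _.
Variable N : nat.
Variables (A : formula N) (G : seq (formula N)) (tau : family (glue D) A G).
Hypothesis tauN : mll_transformation tau.
Local Notation sq := (A :: G).
Local Notation coeff := (coeff iota iotai bp tau).
Local Notation width := (width A G).
Local Notation idx := (idx A G).
Local Notation link_label := (link_label A G).
Local Notation label_value := (label_value iota iotai bp tau).

Lemma coeff_unique g g' v : coeff g <> 0 -> coeff g' <> 0 -> v \in poss sq -> g v = g' v.
Proof using iotaiK iotaK points_sep tauN.
have [m] := ubnP (count (fun u => g u != g' u) (poss sq)).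
elim: m g g' v => // m IH g g' v sz cg cg' vp; apply/eqP; apply: contraT => /eqP ne; exfalso.
have ga g0 u i : coeff g0 <> 0 -> occ sq u = Some (Lit true i) -> g0 u \in addrs sq.
  by move=> c0 ui; apply: mem_addrs (coeff_pos iotaiK iotaK tauN c0 ui).
have [i vi] := possP _ _ vp.
have [||j [bj [u [x [ux jg]]] [u' [x' [ux' jg']]] cj]] :=
  label_value_between iotaiK iotaK points_sep tauN _ _ cg cg'.
- by move=> w y wy; rewrite !(link_label_neg _ wy).
- exists v, i; split=> //; rewrite !(link_label_pos _ vi) => e; apply: ne.
  by apply: idx_inj e; [apply: ga cg vi|apply: ga cg' vi].
(* [h] is the link map read off the intermediate labelling j. It agrees with g at u', where g and g'
   differ, so it is closer to g than g' is; but it differs from g at u, against the induction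
   hypothesis. *)
pose h w := if j w == link_label g w then g w else g' w.
have hj w y : occ sq w = Some (Lit true y) -> link_label h w = j w.
  move=> wy; rewrite (link_label_pos _ wy) /h; case: eqP => [->|n]; first by rewrite (link_label_pos _ wy).
  by case: (bj w) => // ->; rewrite (link_label_pos _ wy).
have ch : coeff h <> 0.
  move=> c0; apply: cj; rewrite -c0; apply: eq_fvalue => w y; split=> wy; first by rewrite (hj _ _ wy).
  by rewrite (link_label_neg _ wy); case: (bj w) => ->; rewrite (link_label_neg _ wy).
have gh : g u = h u.
  apply: (IH g h u _ cg ch); last by apply/possP; exists x.
  rewrite -ltnS; apply: leq_trans sz; rewrite ltnS.
  apply: (@count_lt _ _ _ _ u').
  - by move=> w wp; rewrite /h; case: ifP => //; rewrite eqxx.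
  - by apply/possP; exists x'.
  - apply/eqP => e; apply: jg'; case: (bj u') => // ->.
    by rewrite !(link_label_pos _ ux') e.
  - have -> : h u' = g u' by rewrite /h; case: eqP => [_|n] //; case: jg'; case: (bj u').
    by rewrite eqxx.
by apply: jg; rewrite -(hj _ _ ux) !(link_label_pos _ ux) gh.
Qed.

Section Nonzero.
Variable g : addr -> addr.
Hypothesis cg : coeff g <> 0.
Let K := slabel sq (link_label g).

Lemma coeff_one : coeff g = idc _.
Proof using iotaiK iotaK points_sep tauN cg.
have := label_value_pts iotaiK iotaK points_sep bp width (link_label g) (fun=> VO) tauN.
have -> : vpar (fun=> VO) (slabel sq (link_label g)) = VO.
  by rewrite /vpar big1 // => E _; apply: val_O.
by case.
Qed.

Lemma poss_negs : perm_eq (map g (poss sq)) (negs sq).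
Proof using iotaiK iotaK tauN cg.
apply: uniq_perm; last 1 first.
- move=> w; apply/mapP/negsP => [[v /possP[i vi] ->]|[j wj]].
    by exists i; apply: (coeff_pos iotaiK iotaK tauN cg vi).
  have [v [vj <-]] := coeff_neg iotaiK iotaK tauN cg wj.
  by exists v => //; apply/possP; exists j.
- rewrite map_inj_in_uniq ?poss_uniq // => u v up vp.
  exact: (coeff_inj iotaiK iotaK tauN cg).
- exact: negs_uniq.
Qed.

Lemma coeff_acyc : acyc K.
Proof using iotaiK iotaK points_sep tauN cg.
move=> v noT; apply: vpar_acyc noT _ => vF.
have := label_value_pts iotaiK iotaK points_sep bp width (link_label g) v tauN.
by rewrite -/K vF.
Qed.

Lemma coeff_closed : closed K.
Proof using iotaiK iotaK tauN cg.
move=> b l; rewrite /K sleaves_slabel => /mapP[[v [b' i]] vi [-> ->]] /=.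
have {}vi : occ sq v = Some (Lit b' i) by apply/slitsP.
case: b' vi => vi; apply/mapP.
  have wi := coeff_pos iotaiK iotaK tauN cg vi.
  exists (g v, (false, i)); first exact: introT (slitsP _ _ _ _) wi.
  by rewrite /= (link_label_pos _ vi) (link_label_neg _ wi).
have [u [ui uv]] := coeff_neg iotaiK iotaK tauN cg vi.
exists (u, (true, i)); first exact: introT (slitsP _ _ _ _) ui.
by rewrite /= (link_label_pos _ ui) (link_label_neg _ vi) uv.
Qed.

Lemma coeff_linear : linear K.
Proof using iotaiK iotaK tauN cg.
rewrite /linear /K sleaves_slabel map_inj_in_uniq; first exact/map_uniq/(slits_uniq sq).
move=> [v [b i]] [w [b' j]] /slitsP vi /slitsP wj /= [eb ei]; subst b' j.
case: b vi wj => vi wi e; congr (_, _).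
  move: e; rewrite !(link_label_pos _ vi) !(link_label_pos _ wi) => e.
  have va := mem_addrs (coeff_pos iotaiK iotaK tauN cg vi).
  have wa := mem_addrs (coeff_pos iotaiK iotaK tauN cg wi).
  apply: (coeff_inj iotaiK iotaK tauN cg); [by apply/possP; exists i|by apply/possP; exists i|].
  exact: idx_inj e.
move: e; rewrite !(link_label_neg _ vi) !(link_label_neg _ wi).
by apply: idx_inj; apply: mem_addrs; eauto.
Qed.

End Nonzero.

Lemma degree_poss_negs (k : addr -> nat) :
  degree (slits sq) k = \sum_(v <- poss sq) k v + \sum_(w <- negs sq) (1 - k w).
Proof.
rewrite /degree /poss /negs !big_map !big_filter (bigID (fun x => x.2.1)) /=.
by congr addn; apply: eq_bigr => -[v [[] i]].
Qed.

Lemma size_poss_negs : size (slits sq) = size (poss sq) + size (negs sq).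
Proof.
by rewrite /poss /negs !size_map !size_filter -(count_predC (fun x => x.2.1)).
Qed.

Lemma exists_coeff : exists g, coeff g <> 0 /\ size (poss sq) = snpars A G.
Proof using iotaiK iotaK tauN zero_neq_one.
have [k [k2 kd kn]] := count_label iotaiK iotaK zero_neq_one tauN.
have [g [cg kg]] := fvalue_neq0 iotaiK iotaK tauN kn.
exists g; split=> //; rewrite -kd degree_poss_negs -(perm_big _ (poss_negs cg)) (big_map g) -big_split.
rewrite -sum1_size; apply: eq_big_seq => v /possP[i vi] /=.
(* A nonzero composite means that v and g v carry the same label, so each link adds 1 to the
   degree. *)
have := kg v i vi; rewrite bprj_inj_lt.
by case: andP => [[/eqP<- _] _|//]; have := k2 v; lia.
Qed.

Lemma exists_deriv : exists g (d : deriv sq), coeff g <> 0 /\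
  forall v w, (v, w) \in links d = linked (slabel sq (link_label g)) v w.
Proof using iotaiK iotaK points_sep tauN zero_neq_one.
have [g [cg sz]] := exists_coeff; exists g.
have lin := coeff_linear cg.
have dK : der (slabel sq (link_label g)).
  apply: sequentialisation => //; [exact: coeff_closed|exact: coeff_acyc|].
  rewrite sleaves_slabel size_map.
  (* With p pars and commas and t tensors there are t + p + 1 literals; half of them are positive
     and p is the number of these, so p = t + 1. *)
  have := size_slits A G (link_label g); rewrite size_poss_negs -(perm_size (poss_negs cg)) (size_map g) sz.
  by lia.
have hd := der_has_deriv dK lin; move: hd; rewrite /has_deriv.
(* The relation is generalised so that the sequent is rewritten in the type of the derivation
   alone. *)
move: (linked _) => lk; rewrite erase_slabel => -[d hd]; by exists d.
Qed.

End Links.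

Section LinkProducts.
Variables (D : star_autonomous) (N : nat).

Lemma eq_link_prod (R R' : 'I_N -> glue D) G (d : deriv G) (x : tests R addr) (y : points R addr)
    (x' : tests R' addr) (y' : points R' addr) :
  (forall v w i, (v, w) \in links d -> x v i ∘ y w i = x' v i ∘ y' w i) ->
  link_prod d x y = link_prod d x' y'.
Proof.
elim: d x y x' y' => {G} [i|A B G H d1 I1 d2 I2|A B G d I|G A B H d I] x y x' y' e /=.
- by apply: e; rewrite mem_head.
- congr comp; [apply: I1|apply: I2] => v w i vw; apply: e; rewrite mem_cat; apply/orP.
    by left; apply/mem_map_links; exists v, w.
  by right; apply/mem_map_links; exists v, w.
- by apply: I => v w i vw; apply: e; apply/mem_map_links; exists v, w.
- by apply: I => v w i vw; apply: e; apply/mem_map_links; exists v, w.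
Qed.

Lemma link_prod_one (R : 'I_N -> glue D) G (d : deriv G) (x : tests R addr) (y : points R addr) :
  (forall v w i, (v, w) \in links d -> x v i ∘ y w i = idc _) -> link_prod d x y = idc _.
Proof.
elim: d x y => {G} [i|A B G H d1 I1 d2 I2|A B G d I|G A B H d I] x y e /=.
- by apply: e; rewrite mem_head.
- rewrite I1; last first.
    by move=> v w i vw; apply: e; rewrite mem_cat; apply/orP; left; apply/mem_map_links; exists v, w.
  rewrite I2 ?comp1f // => v w i vw; apply: e; rewrite mem_cat; apply/orP; right.
  by apply/mem_map_links; exists v, w.
- by apply: I => v w i vw; apply: e; apply/mem_map_links; exists v, w.
- by apply: I => v w i vw; apply: e; apply/mem_map_links; exists v, w.
Qed.

Lemma link_prod_zero (bp : biproducts D) (R : 'I_N -> glue D) G (d : deriv G)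
    (x : tests R addr) (y : points R addr) v w :
  (v, w) \in links d -> (forall i, x v i ∘ y w i = zerom bp _ _) ->
  link_prod d x y = zerom bp _ _.
Proof.
elim: d x y v w => {G} [i|A B G H d1 I1 d2 I2|A B G d I|G A B H d I] x y v w /=.
- by rewrite inE => /eqP[-> ->].
- rewrite mem_cat => /orP[]/mem_map_links[u [u' [h -> ->]]] e.
    by rewrite (I1 _ _ _ _ h) ?comp0f.
  by rewrite (I2 _ _ _ _ h) ?compf0.
- by move=> /mem_map_links[u [u' [h -> ->]]]; apply: I.
- by move=> /mem_map_links[u [u' [h -> ->]]]; apply: I.
Qed.

End LinkProducts.

Section Completeness.
Variable D : star_autonomous.
Variables (iota : hom (tunit : D) bot) (iotai : hom (bot : D) tunit).
Hypothesis iotaiK : iotai ∘ iota = idc _.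
Hypothesis iotaK : iota ∘ iotai = idc _.
Hypothesis points_sep : forall (A B : D) (f g : hom A B),
  (forall h : hom tunit A, f ∘ h = g ∘ h) -> f = g.
Hypothesis tens_tests_sep : forall (A B : D) (w w' : hom tunit (A ⊗ B)),
  (forall t s, tens_test t s ∘ w = tens_test t s ∘ w') -> w = w'.
Variable bp : biproducts D.
Local Notation "0" := (zerom bp _ _) : cat_scope.
Hypothesis zero_neq_one : (0 : hom (tunit : D) tunit) <> idc _.
Variable N : nat.
Implicit Types (A : formula N) (G : seq (formula N)).

(** By linearity in each literal, projections are replaced by arbitrary tests one literal at a
    time. *)
Lemma stest_basis_eq n A G (R := fun _ : 'I_N => free (bpow bp (tunit : D) n))
    (y : points R addr) (w w' : hom tunit (car (seqobj R R A G))) :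
  (forall k : addr -> nat, let x : tests R addr := fun v (_ : 'I_N) => bprj bp (tunit : D) n (k v) in
    stest iota iotai A G x y ∘ w = stest iota iotai A G x y ∘ w') ->
  forall x : tests R addr, stest iota iotai A G x y ∘ w = stest iota iotai A G x y ∘ w'.
Proof using iotaiK iotaK.
move=> h x.
suff key (s : seq addr) (k : addr -> nat) :
    let x' : tests R addr := fun v i => if v \in s then x v i else bprj bp (tunit : D) n (k v) in
    stest iota iotai A G x' y ∘ w = stest iota iotai A G x' y ∘ w'.
  have := key (addrs (A :: G)) (fun=> 0%N); cbv zeta.
  set x1 := fun _ _ => _; suff -> : stest iota iotai A G x1 y = stest iota iotai A G x y by [].
  by apply: eq_stest => v i; split=> // /mem_addrs va; rewrite /x1 va.
elim: s k => [|q s IH] k; first exact: (h k).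
move=> x1.
pose x2 : tests R addr := fun v i => if v \in s then x v i else bprj bp (tunit : D) n (k v).
have [/andP[/possP[i qi] qs]|qn] := boolP ((q \in poss (A :: G)) && (q \notin s)); last first.
  have e : stest iota iotai A G x1 y = stest iota iotai A G x2 y.
    apply: eq_stest => v i; split=> // vi; rewrite /x1 /x2 inE; case: (v =P q) => //= vq.
    rewrite ifT //; apply: contraR qn; rewrite vq => ->; rewrite andbT.
    by apply/possP; exists i; rewrite -vq.
  by rewrite e; apply: IH.
have [[hu _] [hu' _]] := (stest_linear iotaiK iotaK q x1 y w, stest_linear iotaiK iotaK q x1 y w').
have [[u {}hu] [u' {}hu']] := (hu i qi, hu' i qi).
suff uu : u = u' by rewrite (hu x1 y) // (hu' x1 y) // uu.
apply: bpow_mono => m mn; pose k' v := if v == q then m else k v.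
pose x3 : tests R addr := fun v i => if v \in s then x v i else bprj bp (tunit : D) n (k' v).
have e3 : sagree_but (A :: G) q x1 x3 y y.
  move=> v j vq; split=> // _; rewrite /x1 /x3 /k' inE; by case: (v =P q).
have q3 : x3 q i = bprj bp (tunit : D) n m by rewrite /x3 (negPf qs) /k' eqxx.
by rewrite -q3 -(hu x3 y e3) -(hu' x3 y e3); apply: IH.
Qed.

Section Transformation.
Variables (A : formula N) (G : seq (formula N)) (tau : family (glue D) A G).
Hypothesis tauN : mll_transformation tau.
Local Notation sq := (A :: G).
Local Notation coeff := (coeff iota iotai bp tau).
Local Notation link_label := (link_label A G).
Local Notation width := (width A G).
Local Notation idx := (idx A G).
Variables (g : addr -> addr) (d : deriv sq).
Hypothesis cg : coeff g <> 0.
Hypothesis dg : forall v w, (v, w) \in links d = linked (slabel sq (link_label g)) v w.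

Lemma deriv_linksP v w :
  (v, w) \in links d <-> (exists i, occ sq v = Some (Lit true i)) /\ w = g v.
Proof using iotaiK iotaK tauN cg dg.
rewrite dg; split=> [/linkedP[[i l]]|[[i vi] ->]].
  rewrite !leaf_at_slabel; case vi: (occ sq v) => [[[] j| |]|] //.
  case wi: (occ sq w) => [[[] j'| |]|] // [_ <-] [_ e]; split; first by exists j.
  move: e; rewrite (link_label_pos _ vi) (link_label_neg _ wi).
  by apply: idx_inj; [apply: mem_addrs wi|apply: mem_addrs (coeff_pos iotaiK iotaK tauN cg vi)].
have wi := coeff_pos iotaiK iotaK tauN cg vi.
apply/linkedP; exists (i, link_label g v); rewrite leaf_at_slabel ?vi ?wi //.
by rewrite (link_label_pos _ vi) (link_label_neg _ wi).
Qed.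

Lemma deriv_structure : exists th : proof_structure sq, sequentialises d th.
Proof using iotaiK iotaK tauN cg dg.
have l1 v w : (v, w) \in links d -> exists i, occ sq v = Some (Lit true i) /\ occ sq w = Some (Lit false i).
  by move=> /deriv_linksP[[i vi] ->]; exists i; split=> //; apply: (coeff_pos iotaiK iotaK tauN cg vi).
have l2 v i : occ sq v = Some (Lit true i) -> exists! w, (v, w) \in links d.
  move=> vi; exists (g v); split=> [|w /deriv_linksP[_ ->] //].
  by apply/deriv_linksP; split=> //; exists i.
have l3 w i : occ sq w = Some (Lit false i) -> exists! v, (v, w) \in links d.
  move=> wi; have [v [vi vw]] := coeff_neg iotaiK iotaK tauN cg wi; exists v; split.
    by apply/deriv_linksP; split=> //; exists i.
  move=> u /deriv_linksP[[j uj] e]; apply: (coeff_inj iotaiK iotaK tauN cg); last by rewrite vw.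
    by apply/possP; exists i.
  by apply/possP; exists j.
by exists (@ProofStructure _ _ (fun v w => (v, w) \in links d) l1 l2 l3).
Qed.

(** Both sides are compared at pure tests. Dinaturality moves the arrows f across tau, and
    associativity moves them across the link product. This reduces the claim to coordinate vectors
    and projections on W, where both values are 1 if the labels follow g and 0 otherwise. *)
Lemma tau_interp R : tau R = interp d R.
Proof using iotaiK iotaK points_sep tens_tests_sep zero_neq_one tauN cg dg.
apply: ghom_eq; apply: (stest_separating iotaiK iotaK points_sep tens_tests_sep
  (fun i => zerom bp (car (R i)) tunit) (fun i => zerom bp tunit (car (R i)))).
move=> _ [x [y ->]].
pose W := fun _ : 'I_N => bpow bp (tunit : D) width.
pose yb (v : addr) (_ : 'I_N) := binj bp (tunit : D) width (idx v).
have ex i : {f : hom (W i) (car (R i)) | forall k, k < width ->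
    f ∘ binj bp tunit width k = y (nth (0%N, [::]) (addrs sq) k) i}.
  exact: constructive_indefinite_description (bpow_copair _ _ _).
pose f i := proj1_sig (ex i).
have fE i v : v \in addrs sq -> f i ∘ yb v i = y v i.
  by move=> va; rewrite /f /yb; case: (ex i) => h /= ->; rewrite ?nth_index ?index_mem.
have lk v w i : (v, w) \in links d -> f i ∘ yb w i = y w i.
  move=> /deriv_linksP[[j vj] ->]; apply: fE.
  exact: mem_addrs (coeff_pos iotaiK iotaK tauN cg vj).
transitivity (@fvalue D iota iotai N A G tau W (fun v i => x v i ∘ f i) yb).
  refine (etrans (value_free iota iotai tauN x y) _).
  rewrite (fvalue_nat iota iotai tauN (V := W) (W := fun i => car (R i)) f).
  by apply: eq_fvalue => v i; split=> // /mem_addrs va; rewrite fE.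
transitivity (@link_prod D N (fun i => free (W i)) sq d (fun v i => x v i ∘ f i) yb); last first.
  refine (etrans _ (esym (stest_interp iotaiK iotaK d x y))).
  by apply: eq_link_prod => v w i vw; rewrite compA (lk _ _ _ vw).
refine (etrans _ (stest_interp iotaiK iotaK (R := fun i => free (W i)) d (fun v i => x v i ∘ f i) yb)).
apply: (@stest_basis_eq width A G) => k x1.
rewrite (stest_interp iotaiK iotaK).
have [h|h] := classic (forall v i, occ sq v = Some (Lit true i) -> k v = idx (g v)).
  rewrite link_prod_one.
    rewrite -(coeff_one iotaiK iotaK points_sep tauN cg) coeffE.
    by apply: eq_fvalue => v i; split=> // vi; rewrite /x1 (h _ _ vi).
  move=> v w i /deriv_linksP[[j vj] ->]; rewrite /x1 /yb (h _ _ vj) bprj_inj ?eqxx //.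
  exact: idx_lt (coeff_pos iotaiK iotaK tauN cg vj).
have {h}[v [i [vi kv]]] : exists v i, occ sq v = Some (Lit true i) /\ k v <> idx (g v).
  by apply: NNPP => n; apply: h => v i vi; apply: NNPP => ne; apply: n; exists v, i.
rewrite (@link_prod_zero _ _ bp _ _ d _ _ v (g v)); first last.
- move=> j; rewrite /x1 /yb bprj_inj; first by case: eqP.
  exact: idx_lt (coeff_pos iotaiK iotaK tauN cg vi).
- by apply/deriv_linksP; split=> //; exists i.
(* A nonzero value of tau would come from a g' with nonzero coefficient for which [k v] is the
   coordinate of g' v; uniqueness gives g' v = g v, against the choice of v. *)
apply: NNPP => /(fvalue_expand iotaiK iotaK)[g' [cg' hg']].
have {}cg' : coeff g' <> 0 by rewrite coeffE.
have [_] := hg' v i vi; rewrite /x1 bprj_inj_lt.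
have -> : g' v = g v.
  by apply: (coeff_unique iotaiK iotaK points_sep tauN cg' cg); apply/possP; exists i.
by case: eqP.
Qed.

End Transformation.

Lemma glue_fully_complete A G (tau : family (glue D) A G) : mll_transformation tau ->
  exists2 th : proof_structure (A :: G), proof_net th & interprets th tau.
Proof using iotaiK iotaK points_sep tens_tests_sep zero_neq_one.
move=> tauN.
have [g [d [cg dg]]] := exists_deriv iotaiK iotaK points_sep zero_neq_one tauN.
have [th s] := deriv_structure tauN cg dg.
exists th; first exact: deriv_proof_net s.
by exists d => // R; apply: tau_interp cg dg R.
Qed.

End Completeness.

Theorem corollary4p26 (C : compact_closed) (bp : biproducts C)
    (tensor_gen : tensor_generated C)
    (zero_neq_one : zerom bp tunit tunit <> idc (tunit : C)) :
  mll_fully_complete (glue (compact_star C)).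
Proof.
have points_sep (A B : C) (f g : hom A B) :
    (forall h : hom tunit A, f ∘ h = g ∘ h) -> f = g.
  move=> h; apply: NNPP => /tensor_gen[p]; apply; exact: h.
move=> N A G tau; apply: (@glue_fully_complete (compact_star C) (cc_iota C) (cc_iotai C)
  (cc_iotaiK C) (cc_iotaK C) points_sep _ bp zero_neq_one).
apply: (compact_tens_tests_sep points_sep).
exact: (@tests_sep (compact_star C) (cc_iota C) (cc_iotai C) (cc_iotaiK C) (cc_iotaK C) points_sep).
Qed.
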